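(* Let $0<H<1$, $1<T<\infty$ and $0<\kappa<\infty$, and let $B_1^{(H)},B_2^{(H)},\ldots$ be i.i.d. sample continuous fractional Brownian motions with Hurst index $H$. Then, with probability $1$, the sequence of processes $$\left\{\frac{t^\kappa v_n(t,x)}{\sqrt{2\log\log n}}:(t,x)\in[0,T]\times\mathbb{R}\right\},\quad n\ge 3,$$ is relatively compact in $\ell_\infty([0,T]\times\mathbb{R})$, and its limit set is the unit ball of the reproducing kernel Hilbert space determined by the covariance function $$K_\kappa\big((s,x),(t,y)\big)=s^\kappa t^\kappa\big(P\{B^{(H)}(s)\le x,B^{(H)}(t)\le y\}-P\{B^{(H)}(s)\le x\}P\{B^{(H)}(t)\le y\}\big),\quad (s,x),(t,y)\in[0,T]\times\mathbb{R}.$$ Consequently, $$\limsup_{n\to\infty}\ \sup_{(t,x)\in[0,T]\times\mathbb{R}}\left|\frac{t^\kappa v_n(t,x)}{\sqrt{2\log\log n}}\right|=\frac{T^\kappa}{2}\quad\text{a.s.}$$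
   Context: A sample continuous fractional Brownian motion $B^{(H)}$ with Hurst index $H$ is a mean zero Gaussian process on $[0,\infty)$ with continuous trajectories and covariance $E(B^{(H)}(s)B^{(H)}(t))=\frac12(|s|^{2H}+|t|^{2H}-|s-t|^{2H})$. Versions are chosen so that for all trajectories $\sup_{0\le s\neq t\le T}|B^{(H)}(t)-B^{(H)}(s)|/f_H(|t-s|)<\infty$, where $f_H(u)=u^H\sqrt{\max\{1,\log u^{-1}\}}$. The time dependent empirical process is $v_n(t,x)=\frac{1}{\sqrt n}\sum_{j=1}^n\big(1\{B_j^{(H)}(t)\le x\}-P\{B^{(H)}(t)\le x\}\big)$. $\ell_\infty(S)$ is the space of bounded real functions on $S$ with the supremum norm. The limit set of a sequence is the set of its limit points (limits of subsequences) in this norm. *)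

(* Defs.v *)
From HB Require Import structures.
From mathcomp Require Import all_boot all_order all_algebra.
From mathcomp Require Import finmap.
From mathcomp Require Import all_classical all_reals all_analysis.

Set Implicit Arguments.
Unset Strict Implicit.
Unset Printing Implicit Defensive.

Import Order.TTheory GRing.Theory Num.Theory.
Import numFieldNormedType.Exports.

Local Open Scope classical_set_scope.
Local Open Scope ring_scope.

Section bounded_functions.
Context (S : Type) (R : realType).

Definition bounded_pred : {pred (S -> R)} := fun f => `[< bounded_fun f >].

Lemma bounded_predP (f : S -> R) :
  reflect (exists M, forall p, `|f p| <= M) (f \in bounded_pred).
Proof.
apply: (iffP (asboolP _)) => [[M [_ HM]]|[M HM]].
  by exists (M + 1) => p; apply: (HM (M + 1)) => //; rewrite ltrDl.
exists M; split; first exact: num_real.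
by move=> y My p _; apply: le_trans (HM p) (ltW My).
Qed.

Lemma bounded_pred_submod : submod_closed bounded_pred.
Proof.
split; first by apply/bounded_predP; exists 0 => p; rewrite normr0.
move=> a f g /bounded_predP[M fM] /bounded_predP[N gN].
apply/bounded_predP; exists (`|a| * M + N) => p.
by rewrite (le_trans (ler_normD _ _))// lerD// normrM ler_wpM2l.
Qed.

HB.instance Definition _ :=
  GRing.isSubmodClosed.Build R (S -> R) bounded_pred bounded_pred_submod.

(* The space $\ell_\infty(S)$; its norm is [ell_norm] below. *)
Record ell_infty := EllInfty {
  ell_fun :> S -> R;
  ell_funP : ell_fun \in bounded_pred }.

HB.instance Definition _ := [isSub for ell_fun].
HB.instance Definition _ := gen_eqMixin ell_infty.
HB.instance Definition _ := gen_choiceMixin ell_infty.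
HB.instance Definition _ := [SubChoice_isSubLmodule of ell_infty by <:].

Definition ell_norm (f : ell_infty) : R := sup (range (fun p => `|f p|)).

Lemma ell_norm_ub (f : ell_infty) p : `|f p| <= ell_norm f.
Proof.
apply: ub_le_sup; last by exists p.
by have /bounded_predP[M fM] := ell_funP f; exists M => _ [q _ <-].
Qed.

Lemma ell_norm_le (f : ell_infty) M :
  0 <= M -> (forall p, `|f p| <= M) -> ell_norm f <= M.
Proof.
move=> M0 fM; have [[p _]|S0] := pselect ([set: S] !=set0).
  by apply: ge_sup => [|_ [q _ <-]//]; exists `|f p|, p.
suff f0 : range (fun p => `|f p|) = set0 by rewrite /ell_norm f0 sup0.
by apply/seteqP; split=> // y [q _ _]; exfalso; apply: S0; exists q.
Qed.

Lemma ell_norm_ge0 f : 0 <= ell_norm f.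
Proof.
have [[p _]|S0] := pselect ([set: S] !=set0).
  exact: le_trans (ell_norm_ub f p).
suff f0 : range (fun p => `|f p|) = set0 by rewrite /ell_norm f0 sup0.
by apply/seteqP; split=> // y [q _ _]; exfalso; apply: S0; exists q.
Qed.

Let ell_normD f g : ell_norm (f + g) <= ell_norm f + ell_norm g.
Proof.
apply: ell_norm_le => [|p]; first by rewrite addr_ge0 ?ell_norm_ge0.
by rewrite (le_trans (ler_normD _ _))// lerD// ell_norm_ub.
Qed.

Let ell_normZ (a : R) f : ell_norm (a *: f) = `|a| * ell_norm f.
Proof.
have le_ b g : ell_norm (b *: g) <= `|b| * ell_norm g.
  apply: ell_norm_le => [|p]; first by rewrite mulr_ge0 ?ell_norm_ge0.
  by rewrite normrM ler_wpM2l ?ell_norm_ub.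
apply/eqP; rewrite eq_le le_/=.
have [->|a0] := eqVneq a 0; first by rewrite normr0 mul0r ell_norm_ge0.
have := le_ a^-1 (a *: f); rewrite scalerK// normfV mulrC.
by rewrite ler_pdivlMr ?normr_gt0// mulrC.
Qed.

Let ell_norm_eq0 f : ell_norm f = 0 -> f = 0.
Proof.
move=> f0; apply/val_inj/funext => p; apply/eqP.
by rewrite -normr_le0 -f0 ell_norm_ub.
Qed.

HB.instance Definition _ :=
  Lmodule_isNormed.Build R ell_infty ell_normD ell_normZ ell_norm_eq0.

Lemma ell_infty_normE (f : ell_infty) : `|f| = sup (range (fun p => `|f p|)).
Proof. by []. Qed.

End bounded_functions.

Definition limit_set (V : topologicalType) (u : V^nat) : set V :=
  [set h | exists2 phi : nat -> nat,
    increasing_seq phi & u \o phi @ \oo --> h].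

Section rkhs.
Context (S : Type) (R : realType).
Implicit Types (K : S -> S -> R) (H : set (S -> R))
  (ip : (S -> R) -> (S -> R) -> R).

(* A real Hilbert space of functions on S is given by its carrier [H] and its
   inner product [ip], of which only the values on [H] are relevant. *)
Record is_hilbert_space H ip : Prop := {
  hilbert0 : H 0 ;
  hilbert_lin : forall a f g, H f -> H g -> H (a *: f + g) ;
  hilbert_ipC : forall f g, H f -> H g -> ip f g = ip g f ;
  hilbert_ipP : forall a f g h, H f -> H g -> H h ->
    ip (a *: f + g) h = a * ip f h + ip g h ;
  hilbert_ip_ge0 : forall f, H f -> 0 <= ip f f ;
  hilbert_ip_eq0 : forall f, H f -> ip f f = 0 -> f = 0 ;
  hilbert_complete : forall u : nat -> S -> R, (forall n, H (u n)) ->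
    (forall e : R, 0 < e -> exists N, forall m n, (N <= m)%N -> (N <= n)%N ->
      Num.sqrt (ip (u m - u n) (u m - u n)) < e) ->
    exists2 f, H f &
      (fun n => Num.sqrt (ip (u n - f) (u n - f))) @ \oo --> (0 : R) }.

Record is_rkhs K H ip : Prop := {
  rkhs_hilbert : is_hilbert_space H ip ;
  rkhs_kernel : forall p, H (K p) ;
  rkhs_reproducing : forall f p, H f -> f p = ip f (K p) }.

(* By the Moore-Aronszajn theorem there is, for positive semidefinite [K],
   exactly one [H], with one inner product on it, such that [is_rkhs K H ip]. *)
Definition rkhs_unit_ball K : set (S -> R) :=
  [set f | exists H ip, [/\ is_rkhs K H ip, H f & Num.sqrt (ip f f) <= 1]].

End rkhs.

(* Processes on $[0,\infty)$ are families indexed by all reals, of which only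
   the values at times t >= 0 are ever used. *)
Section processes.
Context (d : measure_display) (Omega : measurableType d) (R : realType)
  (P : probability Omega R).
Implicit Types (X : R -> {RV P >-> R}) (Xs : nat -> R -> {RV P >-> R}).

(* Degenerate laws are allowed; they have to be treated apart because
   [normal_prob m 0] is not a Dirac mass but the uniform law on [0, 1]. *)
Definition is_gaussian (Y : Omega -> R) :=
  exists m s : R, 0 <= s /\ forall A : set R, measurable A ->
    P (Y @^-1` A) = if s == 0 then \d_m A else normal_prob m s A.

Definition gaussian_process X :=
  forall (n : nat) (t c : 'I_n -> R), (forall i, 0 <= t i) ->
    is_gaussian (fun w => \sum_(i < n) c i * X (t i) w).

Record is_continuous_fbm (H : R) X : Prop := {
  fbm_gaussian : gaussian_process X ;
  fbm_mean : forall t, 0 <= t -> ('E_P[X t] = 0)%E ;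
  fbm_cov : forall s t, 0 <= s -> 0 <= t ->
    ('E_P[fun w => (X s w * X t w)%R])%E =
      (2^-1 * (`|s| `^ (2 * H) + `|t| `^ (2 * H) - `|s - t| `^ (2 * H)))%:E ;
  fbm_continuous : forall w, {within `[0, +oo[, continuous (X ^~ w)} }.

Definition fbm_modulus (H u : R) : R :=
  u `^ H * Num.sqrt (Num.max 1 (ln u^-1)).

Definition has_fbm_modulus (H T : R) X := forall w,
  has_ubound [set `|X st.2 w - X st.1 w| / fbm_modulus H `|st.2 - st.1|
             | st in [set st : R * R | [/\ 0 <= st.1 <= T, 0 <= st.2 <= T
                                         & st.1 != st.2]]].

Definition process_sigma_algebra X : set (set Omega) :=
  <<s [set X t @^-1` A | t in `[0, +oo[ & A in measurable] >>.

Definition independent_processes Xs :=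
  forall (J : {fset nat}) (E : nat -> set Omega),
    (forall j, j \in J -> process_sigma_algebra (Xs j) (E j)) ->
    P (\bigcap_(j in [set` J]) E j) = (\prod_(j <- J) P (E j))%E.

Definition identically_distributed_processes Xs :=
  forall (i j n : nat) (t : 'I_n -> R) (A : 'I_n -> set R),
    (forall k, 0 <= t k) -> (forall k, measurable (A k)) ->
    P (\bigcap_k (Xs i (t k) @^-1` A k)) = P (\bigcap_k (Xs j (t k) @^-1` A k)).

Definition iid_processes Xs :=
  independent_processes Xs /\ identically_distributed_processes Xs.

Definition marginal_cdf X (t x : R) : R := fine (P [set w | X t w <= x]).

(* [Xs 0], ..., [Xs n.-1] are the first n copies; [Xs 0] also stands for the
   generic process whose law is used for centering. *)
Definition empirical_process Xs (n : nat) (w : Omega) (t x : R) : R :=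
  (Num.sqrt n%:R)^-1 *
  \sum_(j < n) (\1_[set w' | Xs j t w' <= x] w - marginal_cdf (Xs 0%N) t x).

Definition weighted_covariance (kappa : R) X (p q : R * R) : R :=
  p.1 `^ kappa * q.1 `^ kappa *
  (fine (P [set w | X p.1 w <= p.2 /\ X q.1 w <= q.2])
   - marginal_cdf X p.1 p.2 * marginal_cdf X q.1 q.2).

Definition lil_fun (kappa : R) Xs (n : nat) (w : Omega) (p : R * R) : R :=
  p.1 `^ kappa * empirical_process Xs n w p.1 p.2
  / Num.sqrt (2 * ln (ln n%:R)).

Definition time_space (T : R) : set (R * R) := `[0, T] `*` [set: R].

Lemma lil_fun_bounded kappa Xs n w (T : R) : 0 < kappa ->
  (fun p : set_type (time_space T) => lil_fun kappa Xs n w (\val p))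
    \in @bounded_pred (set_type (time_space T)) R.
Proof.
move=> k0; apply/bounded_predP.
exists (T `^ kappa * (`|(Num.sqrt n%:R)^-1| * (n%:R * 2))
        / `|Num.sqrt (2 * ln (ln n%:R))|) => q; have := set_valP q; case: (\val q) => t x tx.
have [/= t0T _] := tx.
have /andP[t0 tT] : 0 <= t <= T by move: t0T; rewrite in_itv.
rewrite /lil_fun /= normrM normfV ler_wpM2r ?invr_ge0// normrM.
apply: ler_pM => //.
  rewrite ger0_norm ?powR_ge0//.
  by rewrite ge0_ler_powR ?nnegrE ?(ltW k0) ?(le_trans t0 tT).
rewrite /empirical_process normrM ler_wpM2l//.
rewrite (le_trans (ler_norm_sum _ _ _))//.
have -> : n%:R * 2 = \sum_(j < n) (2 : R).
  by rewrite sumr_const card_ord mulr_natl.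
apply: ler_sum => j _; rewrite (le_trans (ler_normB _ _))//.
rewrite -(_ : 1 + 1 = 2 :> R)// lerD//.
  by rewrite indicE; case: (_ \in _); rewrite ?normr1 ?normr0.
have mX : measurable [set w' | Xs 0%N t w' <= x].
  have -> : [set w' | Xs 0%N t w' <= x] = [set: Omega] `&` Xs 0%N t @^-1` `]-oo, x].
    by rewrite setTI; apply/seteqP; split => y /=; rewrite in_itv.
  exact: measurable_funPT (Xs 0%N t) measurableT _ (measurable_itv `]-oo, x]).
rewrite /marginal_cdf ger0_norm ?fine_ge0// -lee_fin fineK ?fin_num_measure//.
exact: probability_le1.
Qed.

(* The n-th normalized process as an element of $\ell_\infty([0,T]\times R)$. *)
Definition lil_process (T kappa : R) (k0 : 0 < kappa) Xs (w : Omega) (n : nat)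
  : ell_infty (set_type (time_space T)) R :=
  EllInfty (lil_fun_bounded Xs n w T k0).

End processes.

(* Main.v *)
Require Import Defs.
From mathcomp Require Import all_boot all_order all_algebra.
From mathcomp Require Import finmap.
From mathcomp Require Import all_classical all_reals all_analysis.
From mathcomp Require Import measurable_realfun.
From mathcomp Require Import ring lra zify.

Set Implicit Arguments.
Unset Strict Implicit.
Unset Printing Implicit Defensive.

Import Order.TTheory GRing.Theory Num.Theory.
Import numFieldNormedType.Exports.

Local Open Scope classical_set_scope.
Local Open Scope ring_scope.

(** Up to the factor [1 / lilr n], the normalized process is the sum over [n]
    independent copies of the bounded centred functions [summand] of a time and
    a level. The compact law of the iterated logarithm for such sums has a
    finite-dimensional part, a uniform part and a deterministic part.

    At finitely many points the summands are functions of the pattern of the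
    indicators there, which takes finitely many values. Exponential moments bound
    every linear combination from above ([upper_lil]); tilting the law of a
    geometrically long block in a given direction shows that every vector of the
    open unit ball of the covariance is approached infinitely often
    ([lower_lil]).

    The uniform part is asymptotic equicontinuity ([lil_equicontinuity]). A point
    is rounded to a grid of level [l], which has exponentially many points in
    [l] and is geometrically close in mean square ([rho2_gfloor_le]): rounding
    changes an indicator only if the path is near the level, and the density of
    [B t] is at most of the order of [t ^ -H], while near time zero the weight is
    small. Chaining ([chain_increments]) then compares a coarse grid with a grid
    whose level is proportional to the logarithm of [n]. From that grid to
    arbitrary points the argument is pathwise: by Kolmogorov's criterion
    ([ae_dyadic_increments]) the first [n] paths oscillate little over one mesh,
    so that only those paths matter that visit a strip around the grid point.
    Binomial tails and the number of grid points show that there are at most of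
    the order of [ln n] of them, simultaneously for all grid points
    ([ae_few_visits], [fine_grid]), and this is negligible.

    On one almost sure event where countably many of these statements hold
    ([lil_laws]), the rest is deterministic. Equicontinuity gives relative
    compactness ([ell_precompact]). A function [f] belongs to the unit ball of
    the reproducing kernel Hilbert space iff twice [\sum_i c i * f (p i)] is at
    most [1 + \sum_i \sum_k c i * c k * K (p i) (p k)] for all finite families
    ([rkhs_unit_ball_nsq]). The upper laws give this bound for limit points
    ([limit_point_nsq_le]); conversely, on a finite set such an [f] is the image
    under [K] of a vector of the unit ball ([finite_duality]), so that the lower
    laws produce a subsequence that tends to [f] ([limit_set_unit_ball]).

    Finally the largest value of the limit functions at a point is the square
    root of the variance, that is [t ^ kappa] times the square root of [F (1 - F)]
    with [F] the distribution function of [B t]; its supremum is reached at time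
    [T] and the median of [B T]. *)


(** * Words in a finite alphabet: exponential bounds and tilting *)

Section exponential_bounds.
Context {R : realType}.
Implicit Types x y : R.

Lemma exp_coeff_sum_bound x (n : nat) : `|x| <= 1 ->
  `|\sum_(0 <= k < n.+3) exp_coeff x k - (1 + x + x ^+ 2 / 2)|
    <= `|x| ^+ 3 * (1 - 2^-1 ^+ n).
Proof.
move=> x1; elim: n => [|n IHn].
  rewrite !big_nat_recr//= big_nil /exp_coeff/= expr0 expr1 fact0 invr1 add0r.
  by rewrite !mulr1 !subrr normr0 mulr0.
rewrite big_nat_recr//=.
rewrite addrAC (le_trans (ler_normD _ _))//.
rewrite (_ : _ * _ = `|x| ^+ 3 * (1 - 2^-1 ^+ n) + `|x| ^+ 3 * 2^-1 ^+ n.+1); last first.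
  by rewrite [2^-1 ^+ n.+1]exprS; field.
apply: lerD => //.
rewrite /exp_coeff/= normrM normrX normfV normr_nat.
rewrite (_ : n.+3 = (3 + n)%N)// exprD -mulrA ler_wpM2l ?exprn_ge0//.
apply: (@le_trans _ _ (((3 + n)`!)%:R^-1)).
  by rewrite ler_piMl ?invr_ge0// exprn_ile1.
rewrite exprVn lef_pV2 ?posrE ?ltr0n ?fact_gt0 ?exprn_gt0//.
rewrite -natrX ler_nat; elim: n {IHn} => // n IHn.
by rewrite expnS addnS factS leq_mul.
Qed.

Lemma expR_taylor2 x : `|x| <= 1 ->
  `|expR x - (1 + x + x ^+ 2 / 2)| <= `|x| ^+ 3.
Proof.
move=> x1.
have cv : (fun n => \sum_(0 <= k < n.+3) exp_coeff x k) @ \oo --> expR x.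
  rewrite /expR; have := is_cvg_series_exp_coeff x.
  by rewrite -(cvg_shiftn 3); under [X in X @ _]eq_fun do rewrite addn3.
have cv2 : (fun n => `|\sum_(0 <= k < n.+3) exp_coeff x k
    - (1 + x + x ^+ 2 / 2)|) @ \oo --> `|expR x - (1 + x + x ^+ 2 / 2)|.
  by apply: cvg_norm; apply: cvgB => //; exact: cvg_cst.
rewrite -(cvg_lim _ cv2)//; apply: limr_le; first by apply/cvg_ex; eexists; exact: cv2.
apply: nearW => n; rewrite (le_trans (exp_coeff_sum_bound n x1))//.
by rewrite ler_piMr ?exprn_ge0// gerBl exprn_ge0.
Qed.

Lemma expR_le_taylor2 x : `|x| <= 1 -> expR x <= 1 + x + x ^+ 2 / 2 + `|x| ^+ 3.
Proof. by move=> /expR_taylor2; rewrite ler_norml => /andP[_]; rewrite lerBlDl. Qed.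

Lemma expR_ge_taylor2 x : `|x| <= 1 -> 1 + x + x ^+ 2 / 2 - `|x| ^+ 3 <= expR x.
Proof. by move=> /expR_taylor2; rewrite ler_norml => /andP[+ _]; rewrite lerBrDl. Qed.

(** The second-order term is half of the variance that enters the exponent of
    [tilt_lower], where it has to be sharp. *)
Lemma ln1D_le_taylor2 y : `|y| <= 4^-1 -> ln (1 + y) <= y - y ^+ 2 / 2 + 4 * `|y| ^+ 3.
Proof.
move=> y4.
have [y4l y4r] : - 4^-1 <= y /\ y <= 4^-1 by apply/andP; rewrite -ler_norml.
have y0 : 0 < 1 + y by lra.
rewrite -[leRHS]expRK ler_ln ?posrE ?expR_gt0//.
have [y_ge0|y_lt0] := leP 0 y.
  rewrite ger0_norm//; set u := y - _ + _.
  have u0 : 0 <= u by rewrite /u; nra.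
  have uy : u <= 5/4 * y by rewrite /u; nra.
  have u1 : `|u| <= 1 by rewrite ger0_norm//; lra.
  apply: le_trans (expR_ge_taylor2 u1); rewrite ger0_norm//.
  have u2 : y - y ^+ 2 / 2 <= u by rewrite /u; nra.
  have h1 : y ^+ 2 - y ^+ 3 <= u ^+ 2.
    have w0 : 0 <= y - y ^+ 2 / 2 by nra.
    apply: (@le_trans _ _ ((y - y ^+ 2 / 2) ^+ 2)); last first.
      by rewrite lerXn2r ?nnegrE.
    rewrite -subr_ge0 (_ : _ - _ = (y ^+ 2 / 2) ^+ 2); last by field.
    exact: sqr_ge0.
  have h2 : u ^+ 3 <= 125/64 * y ^+ 3.
    rewrite (_ : 125/64 * y ^+ 3 = (5/4 * y) ^+ 3); last by field.
    by rewrite lerXn2r// nnegrE; lra.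
  rewrite /u in h1 h2 *; have : 0 <= y ^+ 3 by rewrite exprn_ge0.
  by lra.
rewrite ltr0_norm//; set z := - y.
have zy : y = - z by rewrite /z opprK.
have [z0 z4] : 0 <= z /\ z <= 4^-1 by split; rewrite /z; lra.
rewrite zy; set u := _ - _ + _.
have u0 : - u <= 9/8 * z by rewrite /u; nra.
have u0' : 0 <= - u by rewrite /u; nra.
have u1 : `|u| <= 1 by rewrite ler0_norm; lra.
apply: le_trans (expR_ge_taylor2 u1); rewrite ler0_norm; last by lra.
have h2 : (- u) ^+ 3 <= 729/512 * z ^+ 3.
  rewrite (_ : 729/512 * z ^+ 3 = (9/8 * z) ^+ 3); last by field.
  by rewrite lerXn2r// nnegrE; lra.
have h1 : z ^+ 2 - z ^+ 3 <= u ^+ 2.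
  have w1 : z * (1 - z / 2) <= - u by rewrite /u; nra.
  have w0 : 0 <= z * (1 - z / 2) by nra.
  apply: (@le_trans _ _ ((z * (1 - z / 2)) ^+ 2)); last first.
    by rewrite -[leRHS]sqrrN lerXn2r ?nnegrE.
  rewrite -subr_ge0 (_ : _ - _ = (z ^+ 2 / 2) ^+ 2); last by field.
  exact: sqr_ge0.
rewrite /u in h1 h2 *; have : 0 <= z ^+ 3 by rewrite exprn_ge0.
by lra.
Qed.

End exponential_bounds.

Section words.
Context {R : realType} {A : finType}.
Implicit Types (p f h : A -> R) (g : seq A -> R) (n m : nat) (s : seq A).

(** The expectation of [g] of a word of [n] independent letters of law [p]. The
    recursion on the first letter turns the estimates for finite alphabets into
    inductions on [n]. *)
Fixpoint wexp p n g : R :=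
  if n is m.+1 then \sum_a p a * wexp p m (fun s => g (a :: s)) else g [::].

Definition wprob p n (Q : pred (seq A)) := wexp p n (fun s => (Q s)%:R).

Lemma eq_wexp p n g1 g2 :
  (forall s, size s = n -> g1 s = g2 s) -> wexp p n g1 = wexp p n g2.
Proof.
elim: n g1 g2 => [|n IHn] g1 g2 g12 /=; first exact: g12.
by apply: eq_bigr => a _; congr (_ * _); apply: IHn => s sn; apply: g12; rewrite /= sn.
Qed.

Lemma wexpD p n g1 g2 :
  wexp p n (fun s => g1 s + g2 s) = wexp p n g1 + wexp p n g2.
Proof.
elim: n g1 g2 => [|n IHn] g1 g2 //=.
by rewrite -big_split; apply: eq_bigr => a _ /=; rewrite IHn mulrDr.
Qed.

Lemma wexpZ p n (c : R) g : wexp p n (fun s => c * g s) = c * wexp p n g.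
Proof.
elim: n g => [|n IHn] g //=.
by rewrite mulr_sumr; apply: eq_bigr => a _ /=; rewrite IHn mulrCA.
Qed.

Lemma wexp0 p n : wexp p n (fun=> 0) = 0.
Proof. by elim: n => //= n IHn; apply: big1 => a _; rewrite IHn mulr0. Qed.

Lemma wexp_sum p n (I : Type) (r : seq I) (G : I -> seq A -> R) :
  wexp p n (fun s => \sum_(i <- r) G i s) = \sum_(i <- r) wexp p n (G i).
Proof.
elim: r => [|i r IHr].
  by under eq_wexp do rewrite big_nil; rewrite big_nil wexp0.
by under eq_wexp do rewrite big_cons; rewrite big_cons wexpD IHr.
Qed.

Lemma wexp_cat p n m g :
  wexp p (n + m) g = wexp p n (fun s => wexp p m (fun s' => g (s ++ s'))).
Proof.
elim: n g => [|n IHn] g //=.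
by apply: eq_bigr => a _; rewrite IHn.
Qed.

(** Change of law: the likelihood ratio of a word is the product over its
    letters. *)
Lemma wexp_tilt p h n g :
  wexp (fun a => p a * h a) n g = wexp p n (fun s => (\prod_(a <- s) h a) * g s).
Proof.
elim: n g => [|n IHn] g /=; first by rewrite big_nil mul1r.
apply: eq_bigr => a _; rewrite IHn -mulrA -wexpZ; congr (_ * _).
by apply: eq_wexp => s _; rewrite big_cons mulrA.
Qed.

Section law.
Variable p : A -> R.
Hypothesis p_ge0 : forall a, 0 <= p a.

Lemma le_wexp n g1 g2 :
  (forall s, size s = n -> g1 s <= g2 s) -> wexp p n g1 <= wexp p n g2.
Proof.
elim: n g1 g2 => [|n IHn] g1 g2 g12 /=; first exact: g12.
apply: ler_sum => a _; rewrite ler_wpM2l//.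
by apply: IHn => s sn; apply: g12; rewrite /= sn.
Qed.

Lemma le_wprob n (Q1 Q2 : pred (seq A)) :
  (forall s, size s = n -> Q1 s -> Q2 s) -> wprob p n Q1 <= wprob p n Q2.
Proof.
move=> Q12; apply: le_wexp => s sn; have := Q12 s sn.
by case: (Q1 s) => // ->.
Qed.

Lemma wprob_union n (I : Type) (r : seq I) (Q : I -> pred (seq A)) :
  wprob p n (fun s => has (Q ^~ s) r) <= \sum_(i <- r) wprob p n (Q i).
Proof.
rewrite /wprob -wexp_sum; apply: le_wexp => s _.
elim: r => [|i r IHr]; first by rewrite big_nil.
rewrite big_cons/=; case: (Q i s) => /=; last by rewrite add0r.
by rewrite lerDl sumr_ge0.
Qed.

Hypothesis p_sum1 : \sum_a p a = 1.

Lemma wexp_cst n (c : R) : wexp p n (fun=> c) = c.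
Proof. by elim: n => //= n IHn; rewrite IHn -mulr_suml p_sum1 mul1r. Qed.

Lemma wprobC n Q : wprob p n (predC Q) = 1 - wprob p n Q.
Proof.
rewrite -[1](wexp_cst n) -[X in X - _](subrK (wprob p n Q)) addrK.
apply/esym/eqP; rewrite subr_eq -wexpD; apply/eqP.
by apply: eq_wexp => s _ /=; case: (Q s); rewrite /= ?add0r ?addr0.
Qed.

Lemma wprob_block n m Q1 Q2 :
  wprob p (n + m) (fun s => Q1 (take n s) && Q2 (drop n s)) =
  wprob p n Q1 * wprob p m Q2.
Proof.
rewrite /wprob wexp_cat mulrC -wexpZ; apply: eq_wexp => s sn.
rewrite mulrC -wexpZ; apply: eq_wexp => s' _.
by rewrite take_size_cat// drop_size_cat// -mulnb natrM.
Qed.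

(** Some prefix of the word, possibly empty, has a sum of at least [l]. *)
Fixpoint hit f (l : R) s : bool :=
  (l <= 0) || (if s is a :: s' then hit f (l - f a) s' else false).

Lemma hit_take f l s k : l <= \sum_(a <- take k s) f a -> hit f l s.
Proof.
elim: s l k => [|a s IHs] l [|k] /=; rewrite ?big_nil ?orbF//; first by move=> ->.
by rewrite big_cons -lerBlDl => /IHs ->; rewrite orbT.
Qed.

Lemma mgf_ge1 f (t : R) : \sum_a p a * f a = 0 ->
  1 <= \sum_a p a * expR (t * f a).
Proof.
move=> f0; apply: (@le_trans _ _ (\sum_a p a * (1 + t * f a))); last first.
  by apply: ler_sum => a _; rewrite ler_wpM2l// expR_ge1Dx.
under eq_bigr do rewrite mulrDr mulr1 mulrCA.
by rewrite big_split/= -mulr_sumr f0 mulr0 addr0 p_sum1.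
Qed.

(** A maximal inequality, by induction on the first letter: as long as the level
    is not reached each letter costs one factor of the moment generating
    function, and this factor is at least 1 because [f] is centred. *)
Lemma hit_mgf f (t l : R) n : 0 <= t -> \sum_a p a * f a = 0 ->
  wprob p n (hit f l) <= expR (- (t * l)) * (\sum_a p a * expR (t * f a)) ^+ n.
Proof.
move=> t0 f0; set M := \sum_a _.
have M1 : 1 <= M by exact: mgf_ge1.
have le1 l' m : l' <= 0 -> 1 <= expR (- (t * l')) * M ^+ m.
  move=> l'0; rewrite -[1]mulr1 ler_pM ?exprn_ege1// -expR0 ler_expR.
  by rewrite oppr_ge0 mulr_ge0_le0.
rewrite /wprob; elim: n l => [|n IHn] l.
  rewrite /= orbF; have [/le1//|_] := leP l 0.
  by rewrite mulr_ge0 ?expR_ge0.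
have [l0|l0] := leP l 0.
  apply: le_trans (le1 _ _ l0); rewrite -[leRHS](wexp_cst n.+1).
  by apply: le_wexp => s _; case: hit.
have l0F : (l <= 0) = false by rewrite leNgt l0.
rewrite /= l0F /=.
apply: (@le_trans _ _ (\sum_a p a * (expR (- (t * (l - f a))) * M ^+ n))).
  by apply: ler_sum => a _; rewrite ler_wpM2l.
rewrite exprS mulrA [X in _ <= X * _]mulrC /M !mulr_suml.
apply: ler_sum => a _; rewrite !mulrA ler_wpM2r//; first by rewrite exprn_ge0// (le_trans _ M1).
by rewrite -mulrA -expRD ler_wpM2l// ler_expR; lra.
Qed.

Lemma hit_bound f (c v t l : R) n : 0 <= t -> t * c <= 1 ->
  (forall a, `|f a| <= c) -> \sum_a p a * f a = 0 ->
  \sum_a p a * f a ^+ 2 <= v ->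
  wprob p n (hit f l) <= expR (- (t * l) + n%:R * (t ^+ 2 * v * (1 + 2 * (t * c)) / 2)).
Proof.
move=> t0 tc1 fc f0 fv; apply: (le_trans (hit_mgf l n t0 f0)).
rewrite expRD ler_wpM2l ?expR_ge0// expRM_natl lerXn2r ?nnegrE ?expR_ge0//.
  by rewrite sumr_ge0// => a _; rewrite mulr_ge0 ?expR_ge0.
apply: le_trans (expR_ge1Dx _).
apply: (@le_trans _ _ (\sum_a p a * (1 + t * f a
    + (t ^+ 2 * f a ^+ 2 * (1 + 2 * (t * c)) / 2)))).
  apply: ler_sum => a _; rewrite ler_wpM2l//.
  have tfc : `|t * f a| <= t * c by rewrite normrM ger0_norm// ler_wpM2l.
  apply: le_trans (expR_le_taylor2 (le_trans tfc tc1)) _.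
  rewrite -!addrA !lerD2l.
  have h : `|t * f a| ^+ 3 <= (t * f a) ^+ 2 * (t * c).
    by rewrite exprS mulrC -normrX ger0_norm ?sqr_ge0// ler_wpM2l ?sqr_ge0.
  by move: h; lra.
under eq_bigr do rewrite !mulrDr mulr1 mulrCA.
rewrite !big_split/= p_sum1 -mulr_sumr f0 mulr0 addr0 lerD2l.
under eq_bigr => a _.
  rewrite (_ : _ * _ = t ^+ 2 * (1 + 2 * (t * c)) / 2 * (p a * f a ^+ 2)); last by lra.
  over.
have tc0 : 0 <= t * c.
  have [a _|A0] := pickP (@predT A).
    by rewrite mulr_ge0// (le_trans _ (fc a)).
  by move: p_sum1; rewrite big_pred0// => /esym/eqP; rewrite oner_eq0.
rewrite -mulr_sumr (_ : _ * v * _ / 2 = t ^+ 2 * (1 + 2 * (t * c)) / 2 * v); last by lra.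
rewrite ler_wpM2l// divr_ge0// mulr_ge0 ?sqr_ge0//; lra.
Qed.

Lemma wexp_sqr_sum f n (x : R) : \sum_a p a * f a = 0 ->
  wexp p n (fun s => (x + \sum_(a <- s) f a) ^+ 2) =
  x ^+ 2 + n%:R * \sum_a p a * f a ^+ 2.
Proof.
move=> f0; set v := \sum_a p a * f a ^+ 2.
elim: n x => [|n IHn] x /=; first by rewrite big_nil addr0 mul0r addr0.
transitivity (\sum_a p a * ((x + f a) ^+ 2 + n%:R * v)).
  apply: eq_bigr => a _; rewrite -IHn; congr (_ * _); apply: eq_wexp => s _.
  by rewrite big_cons addrA.
under eq_bigr => a _.
  rewrite (_ : p a * _ = (x ^+ 2 + n%:R * v) * p a + x *+ 2 * (p a * f a) + p a * f a ^+ 2); last by ring.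
  over.
rewrite !big_split/= -!mulr_sumr p_sum1 f0.
by rewrite -/v mulr1 mulr0 addr0 -addrA -[in RHS]natr1 mulrDl mul1r.
Qed.

Lemma wprob_chebyshev f (mu v l : R) n : 0 < l ->
  \sum_a p a * f a = mu -> \sum_a p a * f a ^+ 2 <= v ->
  wprob p n (fun s => l <= `|\sum_(a <- s) f a - n%:R * mu|) <= n%:R * v / l ^+ 2.
Proof.
move=> l0 fmu fv.
have f0 : \sum_a p a * (f a - mu) = 0.
  under eq_bigr do rewrite mulrBr.
  by rewrite sumrB -mulr_suml p_sum1 fmu mul1r subrr.
have fv' : \sum_a p a * (f a - mu) ^+ 2 <= v.
  apply: le_trans fv; rewrite -subr_ge0 -sumrB.
  under eq_bigr => a _.
    rewrite (_ : _ - _ = 2 * mu * (p a * f a) - p a * mu ^+ 2); last by ring.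
    over.
  rewrite sumrB -mulr_sumr -mulr_suml fmu p_sum1 mul1r; nra.
rewrite ler_pdivlMr ?exprn_gt0// mulrC -wexpZ.
apply: (@le_trans _ _ (wexp p n (fun s => (0 + \sum_(a <- s) (f a - mu)) ^+ 2))).
  apply: le_wexp => s sn; rewrite add0r sumrB big_const_seq count_predT iter_addr sn.
  rewrite addr0 -[mu *+ n]mulr_natl; case: (leP l) => [h|_] /=; last by rewrite mulr0n mulr0 sqr_ge0.
  by rewrite mulr1n mulr1 -[leRHS]real_normK ?num_real// lerXn2r ?nnegrE// ltW.
by rewrite wexp_sqr_sum// expr0n add0r ler_wpM2l.
Qed.

End law.

(** Under the law with density [1 + t g] the means of the [f i] are [t] times
    their covariances with [g], so that by Chebyshev the event has probability
    at least one half. The likelihood ratio is there at least the exponential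
    on the left, as long as its logarithm is close to its mean too. *)
Lemma tilt_lower p (I : finType) (f : I -> A -> R) (g : A -> R)
    (c t delta : R) n :
  (forall a, 0 <= p a) -> \sum_a p a = 1 ->
  (forall i a, `|f i a| <= c) -> (forall a, `|g a| <= c) ->
  (forall i, \sum_a p a * f i a = 0) -> \sum_a p a * g a = 0 ->
  0 < delta -> 0 < t -> t * c <= 4^-1 -> 6 * t * c ^+ 3 <= delta ->
  2 * ((#|I|%:R + 4) * c ^+ 2 * 2) <= delta ^+ 2 * (n%:R * t ^+ 2) ->
  2^-1 * expR (- (n%:R * t ^+ 2 * ((\sum_a p a * g a ^+ 2) / 2 + 2 * delta))) <=
  wprob p n (fun s => [forall i,
    `|\sum_(a <- s) f i a - n%:R * (t * \sum_a p a * (g a * f i a))| <= n%:R * t * delta]).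
Proof.
move=> p0 p1 fc gc fm gm d0 t0 tc tc3 nt.
set r2 := \sum_a p a * g a ^+ 2.
pose q a := p a * (1 + t * g a).
have c0 : 0 <= c.
  have [a _|A0] := pickP (@predT A); first by rewrite (le_trans _ (gc a)).
  by move: p1; rewrite big_pred0// => /esym/eqP; rewrite oner_eq0.
have tc0 : 0 <= t * c by rewrite mulr_ge0// ltW.
have tg a : `|t * g a| <= t * c by rewrite normrM gtr0_norm// ler_wpM2l// ltW.
have tg4 a : `|t * g a| <= 4^-1 by exact: le_trans (tg a) tc.
have tgb a : - 4^-1 <= t * g a /\ t * g a <= 4^-1 by apply/andP; rewrite -ler_norml.
have h0 a : 0 < 1 + t * g a by have := tgb a; lra.
have q0 a : 0 <= q a by rewrite mulr_ge0// ltW.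
have q1 : \sum_a q a = 1.
  under eq_bigr do rewrite /q mulrDr mulr1 mulrCA.
  by rewrite big_split/= -mulr_sumr gm mulr0 addr0.
have [n0|n_gt0] := posnP n.
  move: nt; rewrite n0 mul0r mulr0.
  have [->|cn0] := eqVneq c 0; last first.
    suff : 0 < (#|I|%:R + 4) * c ^+ 2 * 2 :> R by move=> ?; lra.
    have c_gt0 : 0 < c by rewrite lt_neqAle eq_sym cn0.
    rewrite mulr_gt0// mulr_gt0 ?exprn_gt0//.
  rewrite /wprob/= !mul0r oppr0 expR0 mulr1 => _.
  case: forallP => [_|]/=; first by lra.
  by case=> i; rewrite big_nil !mul0r subrr normr0.
have nR : 0 < n%:R :> R by rewrite ltr0n.
pose l a := ln (1 + t * g a).
have l_abs a : `|l a| <= 2 * t * c.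
  have lu : l a <= t * g a by apply: le_ln1Dx; have := tgb a; lra.
  have ll : - (2 * (t * c)) <= l a.
    rewrite /l -[leLHS]expRK ler_ln ?posrE ?expR_gt0//.
    have x1 : `|- (2 * (t * c))| <= 1.
      by rewrite normrN ger0_norm; lra.
    apply: (le_trans (expR_le_taylor2 x1)).
    rewrite normrN ger0_norm; last by lra.
    have : - (t * c) <= t * g a by have := tg a; rewrite ler_norml => /andP[].
    move: tc tc0; set z := t * c => z4 z0; nra.
  rewrite ler_norml -mulrA ll/= (le_trans lu)// (le_trans (ler_norm _))//.
  by rewrite (le_trans (tg a))// ler_peMl// ler1n.
set KL := \sum_a q a * l a.
have KL_le : KL <= t ^+ 2 * (r2 / 2 + delta).
  apply: (@le_trans _ _ (\sum_a (p a * (t * g a + (t * g a) ^+ 2 / 2 + 6 * (t * c) ^+ 3)))).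
    apply: ler_sum => a _; rewrite /q -mulrA ler_wpM2l//.
    apply: (@le_trans _ _ ((1 + t * g a) * (t * g a - (t * g a) ^+ 2 / 2 + 4 * `|t * g a| ^+ 3))).
      by rewrite ler_wpM2l ?(ltW (h0 a))// ln1D_le_taylor2.
    apply: (@le_trans _ _ (t * g a + (t * g a) ^+ 2 / 2 + 6 * `|t * g a| ^+ 3)).
      have := tgb a; set y := t * g a => -[yl yr].
      have y3 : `|y| ^+ 3 = `|y| * y ^+ 2 by rewrite exprS real_normK ?num_real.
      have yy : `|y| <= 4^-1 by rewrite ler_norml yl yr.
      have ya := normr_ge0 y.
      have yna : - `|y| <= y by have := ler_norm (- y); rewrite normrN; lra.
      rewrite y3 -subr_ge0.
      rewrite (_ : _ - _ = y ^+ 2 * (2 * `|y| - 4 * `|y| * y + y / 2)); last by field.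
      apply: mulr_ge0 => //; nra.
    by rewrite lerD2l ler_wpM2l// lerXn2r.
  under eq_bigr do rewrite !mulrDr [p _ * (t * _)]mulrCA exprMn.
  rewrite !big_split/= -mulr_sumr gm mulr0 add0r -mulr_suml p1 mul1r mulrDr lerD//.
    rewrite /r2 mulr_suml mulr_sumr ler_sum// => a _.
    by rewrite le_eqVlt; apply/orP; left; apply/eqP; field.
  rewrite (_ : 6 * _ = t ^+ 2 * (6 * t * c ^+ 3)); last by ring.
  by rewrite ler_wpM2l// sqr_ge0.
pose good s := [forall i,
    `|\sum_(a <- s) f i a - n%:R * (t * \sum_a p a * (g a * f i a))| <= n%:R * t * delta].
pose bad1 s := [exists i, n%:R * t * delta <=
    `|\sum_(a <- s) f i a - n%:R * (t * \sum_a p a * (g a * f i a))|].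
pose bad2 s := n%:R * t ^+ 2 * delta <= `|\sum_(a <- s) l a - n%:R * KL|.
have qh a b : 0 <= b -> `|a| <= b -> forall x : A, q x * a ^+ 2 <= q x * b ^+ 2.
  move=> b0 ab x; rewrite ler_wpM2l//.
  by rewrite -[leLHS]real_normK ?num_real// lerXn2r ?nnegrE.
have b1 : wprob q n bad1 <= #|I|%:R * (n%:R * c ^+ 2 / (n%:R * t * delta) ^+ 2).
  apply: (@le_trans _ _ (wprob q n (fun s => has (fun i => n%:R * t * delta <=
    `|\sum_(a <- s) f i a - n%:R * (t * \sum_a p a * (g a * f i a))|) (enum I)))).
    apply: le_wprob => // s _ /existsP[i Hi]; apply/hasP; exists i => //.
    by rewrite mem_enum.
  apply: le_trans (wprob_union _ _ _ _) _ => //.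
  rewrite big_enum/=; set z := n%:R * _ / _.
  have -> : #|I|%:R * z = \sum_(i : I) z by rewrite sumr_const mulr_natl.
  apply: ler_sum => i _.
  apply: wprob_chebyshev => //.
  - by rewrite !mulr_gt0.
  - rewrite mulr_sumr -[LHS]subr0 -[X in _ - X](fm i) -sumrB; apply: eq_bigr => a _.
    by rewrite /q; ring.
  - rewrite -[leRHS]mul1r -[X in _ <= X * _]q1 mulr_suml ler_sum// => a _; exact: qh.
have b2 : wprob q n bad2 <= n%:R * (2 * t * c) ^+ 2 / (n%:R * t ^+ 2 * delta) ^+ 2.
  apply: wprob_chebyshev => //; first by rewrite !mulr_gt0 ?exprn_gt0.
  rewrite -[leRHS]mul1r -[X in _ <= X * _]q1 mulr_suml ler_sum// => a _; apply: qh => //.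
  by rewrite -mulrA mulr_ge0.
have b12 : wprob q n (fun s => bad1 s || bad2 s) <= 2^-1.
  apply: (@le_trans _ _ (wprob q n bad1 + wprob q n bad2)).
    rewrite /wprob -wexpD; apply: le_wexp => // s _.
    by case: (bad1 s); case: (bad2 s) => //=; rewrite ?addr0 ?add0r ?lerDl.
  apply: le_trans (lerD b1 b2) _.
  rewrite (_ : _ + _ = (#|I|%:R + 4) * c ^+ 2 / (delta ^+ 2 * (n%:R * t ^+ 2))); last first.
    by field; rewrite ?lt0r_neq0.
  have cc : 0 <= (#|I|%:R + 4) * c ^+ 2 by rewrite mulr_ge0 ?sqr_ge0// addr_ge0.
  rewrite ler_pdivrMr; first by lra.
  by rewrite !mulr_gt0 ?exprn_gt0.
have gd : 2^-1 <= wprob q n (fun s => good s && ~~ bad2 s).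
  apply: (@le_trans _ _ (wprob q n (predC (fun s => bad1 s || bad2 s)))).
    by rewrite wprobC//; lra.
  apply: le_wprob => // s _ /=; rewrite negb_or => /andP[nb1 ->]; rewrite andbT.
  apply/forallP => i; rewrite leNgt; apply/negP => /ltW h; move/negP: nb1; apply.
  by apply/existsP; exists i.
rewrite -(ler_pM2r (expR_gt0 (n%:R * t ^+ 2 * (r2 / 2 + 2 * delta)))).
rewrite -[leLHS]mulrA -expRD addNr expR0 mulr1; apply: (le_trans gd).
rewrite /q /wprob wexp_tilt mulrC -wexpZ; apply: le_wexp => // s sn.
rewrite -/(good s); case: (good s) => /=; last by rewrite mulr0n !mulr0.
rewrite mulr1n; case bs: (bad2 s) => /=; first by rewrite mulr0n mulr0 mulr1 expR_ge0.
rewrite mulr1n !mulr1.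
have -> : \prod_(a <- s) (1 + t * g a) = expR (\sum_(a <- s) l a).
  rewrite expR_sum; apply: eq_bigr => a _.
  by rewrite /l lnK// posrE.
rewrite ler_expR; move: bs; rewrite /bad2 leNgt => /negbFE bs.
have := le_lt_trans (ler_norm _) bs; rewrite ltrBlDr => /ltW /le_trans; apply.
rewrite (_ : n%:R * t ^+ 2 * (r2 / 2 + 2 * delta) =
  n%:R * t ^+ 2 * delta + n%:R * (t ^+ 2 * (r2 / 2 + delta))); last by ring.
by rewrite lerD2l ler_wpM2l// ltW.
Qed.

End words.


(** * Finite-valued independent sequences *)

Section measure_lemmas.
Context d (Omega : measurableType d) (R : realType) (P : probability Omega R).

Lemma measure_union_seq (I : eqType) (r : seq I) (F : I -> set Omega) :
  (forall i, i \in r -> measurable (F i)) ->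
  measurable [set w | exists2 i, i \in r & F i w] /\
  (P [set w | exists2 i, i \in r & F i w] <= \sum_(i <- r) P (F i))%E.
Proof.
elim: r => [|i r IHr] mF.
  rewrite (_ : [set w | _] = set0); first by rewrite big_nil measure0.
  by apply/seteqP; split => // w [].
have [|mr Pr] := IHr; first by move=> j jr; apply: mF; rewrite inE jr orbT.
have mi : measurable (F i) by apply: mF; rewrite mem_head.
rewrite (_ : [set w | _] = F i `|` [set w | exists2 i, i \in r & F i w]); last first.
  apply/seteqP; split => w /=.
    by move=> [j]; rewrite inE => /predU1P[->|jr]; [left|right; exists j].
  by move=> [Fi|[j jr Fj]]; [exists i; rewrite ?mem_head|exists j => //; rewrite inE jr orbT].
split; first exact: measurableU.
by rewrite big_cons (le_trans (measureU2 _ _ _))// leeD2l.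
Qed.

Lemma measure_partition (A : finType) (f : Omega -> A) (E : set Omega) :
  measurable E -> (forall a, measurable (f @^-1` [set a])) ->
  P E = (\sum_a P (E `&` f @^-1` [set a]))%E.
Proof.
move=> mE mf; rewrite -big_enum/=.
have -> : P E = P (E `&` [set w | f w \in enum A]).
  by congr (P _); apply/seteqP; split => w /=; [split=> //; rewrite mem_enum|case].
have : measurable (E `&` [set w | f w \in enum A]).
  rewrite (_ : _ `&` _ = E)//.
  by apply/seteqP; split => w /=; [case|split=> //; rewrite mem_enum].
elim: (enum A) (enum_uniq A) => [|a r IHr] /= => [_ _|/andP[ar ur] mr].
  by rewrite big_nil (_ : _ `&` _ = set0) ?measure0//; apply/seteqP; split => w [].
have Er : E `&` [set w | f w \in r] = (E `&` [set w | f w \in a :: r]) `\` (f @^-1` [set a]).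
  apply/seteqP; split => w /=; rewrite inE => -[].
    by move=> Ew fr; split=> //; [split=> //; rewrite fr orbT|move=> fa; rewrite -fa fr in ar].
  by move=> [Ew /predU1P[fa|fr]] // /(_ fa).
have mEr : measurable (E `&` [set w | f w \in r]) by rewrite Er; exact: measurableD.
rewrite big_cons -IHr// -measureU//; last 2 first.
- exact: measurableI.
- apply/seteqP; split => w //= [[_ fa] [_]]; rewrite fa => h.
  by rewrite h in ar.
congr (P _); rewrite -setIUr; congr (_ `&` _); apply/seteqP; split => w /=.
  by rewrite inE => /predU1P[|]; [left|right].
by rewrite inE; case=> [->|->]; rewrite ?eqxx ?orbT.
Qed.

(** First Borel-Cantelli lemma. *)
Lemma ae_eventually_not (E : nat -> set Omega) (u : nat -> R) (k0 : nat) (M : R) :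
  (forall k, measurable (E k)) -> (forall k, 0 <= u k) ->
  (forall k, (k0 <= k)%N -> (P (E k) <= (u k)%:E)%E) ->
  (forall n, \sum_(k < n) u k <= M) ->
  {ae P, forall w, exists N, forall k, (N <= k)%N -> ~ E k w}.
Proof.
move=> mE u0 Eu uM.
pose F k := if (k0 <= k)%N then E k else set0.
have mF k : measurable (F k) by rewrite /F; case: ifP.
have FE k : (P (F k) <= (u k)%:E)%E.
  by rewrite /F; case: ifPn => [/Eu//|_]; rewrite measure0 lee_fin.
have F0 : P (lim_sup_set F) = 0%E.
  apply: lim_sup_set_cvg0 => //.
  apply: (@le_lt_trans _ _ M%:E); last exact: ltry.
  apply: lime_le; first by apply: is_cvg_nneseries => n _ _; exact: measure_ge0.
  apply: nearW => n; rewrite big_mkord.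
  apply: (@le_trans _ _ (\sum_(k < n) (u k)%:E)%E); first by apply: lee_sum => k _; exact: FE.
  by rewrite sumEFin lee_fin.
exists (lim_sup_set F); split => //.
  by apply: bigcap_measurable => // n _; apply: bigcup_measurable => k _.
move=> w /= nw n _.
have [|] := pselect (exists k, (maxn k0 n <= k)%N /\ E k w).
  move=> [k [kn Ek]]; exists k => /=; first by rewrite (leq_trans _ kn)// leq_maxr.
  by rewrite /F (leq_trans _ kn)// leq_maxl.
move=> nE; exfalso; apply: nw; exists (maxn k0 n) => k kn Ek; apply: nE.
by exists k.
Qed.

(** The intersection of all [E k] is at most as probable as each of them. *)
Lemma ae_exists_of_small (E : nat -> set Omega) (u : nat -> R) :
  (forall k, measurable (E k)) ->
  (forall k, (P (E k) <= (u k)%:E)%E) -> u @ \oo --> 0 ->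
  {ae P, forall w, exists k, ~ E k w}.
Proof.
move=> mE Eu u0; exists (\bigcap_k E k); split; first exact: bigcap_measurable.
  apply/eqP; rewrite -measure_le0.
  have u0' : (fun k => (u k)%:E) @ \oo --> 0%E by apply: cvg_EFin => //; exact: nearW.
  rewrite -(cvg_lim _ u0')//; apply: lime_ge; first by apply/cvg_ex; exists 0%E.
  apply: nearW => k; apply: le_trans (Eu k); apply: le_measure; rewrite ?inE//.
    exact: bigcap_measurable.
  exact: bigcap_inf.
by move=> w /= nw k _; apply: contrapT => nE; apply: nw; exists k.
Qed.

Lemma ae_forall_countable (T : countType) (Q : T -> Omega -> Prop) :
  (forall i, {ae P, forall w, Q i w}) -> {ae P, forall w, forall i, Q i w}.
Proof.
move=> QP.
have QPn (n : nat) : {ae P, forall w,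
    if @choice.unpickle T n is Some i then Q i w else True}.
  by case: (@choice.unpickle T n) => [i|]; [exact: QP|exact: aeW].
have := ae_foralln QPn; apply: filterS => w Qw i.
by have := Qw (choice.pickle i); rewrite choice.pickleK.
Qed.

End measure_lemmas.

Section finite_iid.
Context d (Omega : measurableType d) (R : realType) (P : probability Omega R).
Context {A : finType}.
Implicit Types (xi : nat -> Omega -> A) (p : A -> R).

Definition word xi n (w : Omega) : seq A := mkseq (fun j => xi j w) n.

Arguments word : simpl never.

(** The law of each finite word gives at once the independence and the common
    law of the letters. *)
Record finite_iid xi p : Prop := {
  fi_measurable : forall j a, measurable (xi j @^-1` [set a]) ;
  fi_ge0 : forall a, 0 <= p a ;
  fi_sum1 : \sum_a p a = 1 ;
  fi_law : forall s : seq A,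
    P [set w | word xi (size s) w = s] = (\prod_(a <- s) p a)%:E }.

Lemma size_word xi n w : size (word xi n w) = n.
Proof. exact: size_mkseq. Qed.

Lemma wordS xi n w : word xi n.+1 w = rcons (word xi n w) (xi n w).
Proof. by rewrite /word mkseqS. Qed.

Lemma take_word xi n m w : (n <= m)%N -> take n (word xi m w) = word xi n w.
Proof. by move=> nm; rewrite /word/mkseq -map_take take_iota; move/minn_idPl : nm => ->. Qed.

Lemma sum_word xi (f : A -> R) n w :
  \sum_(a <- word xi n w) f a = \sum_(j < n) f (xi j w).
Proof. by rewrite /word/mkseq big_map -(big_mkord xpredT (fun j => f (xi j w))) /index_iota subn0. Qed.

Lemma sum_drop_word xi (f : A -> R) n m w : (n <= m)%N ->
  \sum_(a <- drop n (word xi m w)) f a =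
  \sum_(j < m) f (xi j w) - \sum_(j < n) f (xi j w).
Proof.
move=> nm; rewrite -!(sum_word xi f) -(take_word xi w nm) -[in X in X - _](cat_take_drop n (word xi m w)).
by rewrite big_cat/= addrAC subrr add0r.
Qed.

Variables (xi : nat -> Omega -> A) (p : A -> R).
Hypothesis iid : finite_iid xi p.

Lemma measurable_word n s : measurable [set w | word xi n w = s].
Proof.
elim: n s => [|n IHn] s.
  have [->|s0] := eqVneq s [::].
    by rewrite (_ : [set w | _] = setT)//; apply/seteqP.
  rewrite (_ : [set w | _] = set0)//; apply/seteqP; split => // w /= h.
  by rewrite -h in s0.
elim/last_ind: s => [|s a _].
  rewrite (_ : [set w | _] = set0)//; apply/seteqP; split => // w.
rewrite (_ : [set w | _] = [set w | word xi n w = s] `&` (xi n @^-1` [set a])).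
  by apply: measurableI => //; exact: fi_measurable iid _ _.
apply/seteqP; split => w /=; first by rewrite wordS => /rcons_inj[-> ->].
by rewrite wordS => -[-> ->].
Qed.

Lemma measurable_wordQ n (Q : pred (seq A)) : measurable [set w | Q (word xi n w)].
Proof.
rewrite (_ : [set w | _] = \bigcup_(s : seq A) ([set w | word xi n w = s /\ Q s])).
  apply: countable_bigcupT_measurable; first exact: countableP.
  move=> s; case Qs : (Q s).
    rewrite (_ : [set w | _] = [set w | word xi n w = s]); first exact: measurable_word.
    by apply/seteqP; split => w //= [].
  by rewrite (_ : [set w | _] = set0)//; apply/seteqP; split => w // [].
by apply/seteqP; split => w /=; [exists (word xi n w)|move=> [s _ /= [->]]].
Qed.

(** The prefix generalizes the induction on the length that identifies the
    probability with the recursion of [wexp]. *)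
Lemma prob_word_prefix n s (Q : pred (seq A)) :
  P ([set w | word xi (size s) w = s] `&` [set w | Q (word xi (size s + n) w)]) =
  ((\prod_(a <- s) p a) * wprob p n (fun s' => Q (s ++ s')))%:E.
Proof.
elim: n s => [|n IHn] s.
  rewrite addn0 /wprob/= cats0; case Qs : (Q s).
    rewrite mulr1 -(fi_law iid); congr (P _); apply/seteqP; split => w //=; first by case.
    by move=> ws; rewrite ws.
  rewrite mulr0 (_ : _ `&` _ = set0) ?measure0//; apply/seteqP; split => w //= [->].
  by rewrite Qs.
rewrite (measure_partition P (f := xi (size s))); last 2 first.
- by apply: measurableI; [exact: measurable_word|exact: measurable_wordQ].
- exact: fi_measurable iid _.
rewrite /wprob/= mulr_sumr -sumEFin; apply: eq_bigr => a _.
rewrite mulrA -big_rcons/= -[_ n _]/(wprob p n (fun s' => Q (s ++ a :: s'))).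
have -> : wprob p n (fun s' => Q (s ++ a :: s')) = wprob p n (fun s' => Q (rcons s a ++ s')).
  by apply: eq_wexp => s' _; rewrite cat_rcons.
rewrite -IHn size_rcons addSnnS; congr (P _).
apply/seteqP; split => w /=; rewrite wordS.
  by move=> [[-> ?] ->].
by move=> [/rcons_inj[-> ->] ?].
Qed.

Lemma prob_word n (Q : pred (seq A)) :
  P [set w | Q (word xi n w)] = (wprob p n Q)%:E.
Proof.
have := prob_word_prefix n [::] Q; rewrite big_nil mul1r/= => <-; congr (P _).
by apply/seteqP; split => w //= [].
Qed.

End finite_iid.


(** * The upper law of the iterated logarithm *)

Section normalization.
Context {R : realType}.
Implicit Types x y : R.

(** The law of the iterated logarithm compares sums of [n] terms with
    [lilr n%:R]; allowing real arguments lets geometric blocks have endpoints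
    that are not integers. *)
Definition lilr x : R := Num.sqrt x * Num.sqrt (2 * ln (ln x)).

Lemma lilr_ge0 x : 0 <= lilr x.
Proof. by rewrite mulr_ge0 ?sqrtr_ge0. Qed.

Lemma ln_mono x y : 0 < x -> x <= y -> ln x <= ln y.
Proof. by move=> x0 xy; rewrite ler_ln ?posrE// (lt_le_trans x0). Qed.

Lemma lilr_mono x y : 1 < x -> x <= y -> lilr x <= lilr y.
Proof.
move=> x1 xy; rewrite ler_pM ?sqrtr_ge0// ler_wsqrtr// ler_wpM2l//.
by rewrite ln_mono// ?ln_gt0// ln_mono// (lt_trans _ x1).
Qed.

Lemma lilr_expR x : 0 <= ln x -> lilr (expR x) ^+ 2 = expR x * (2 * ln x).
Proof.
by move=> x0; rewrite /lilr expRK exprMn !sqr_sqrtr ?expR_ge0// mulr_ge0.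
Qed.

Lemma lilr_gt0 x : expR 1 < x -> 0 < lilr x.
Proof.
move=> ex; have x0 : 0 < x by apply: lt_trans ex; exact: expR_gt0.
rewrite /lilr mulr_gt0 ?sqrtr_gt0// mulr_gt0// ln_gt0//.
by rewrite -(expRK 1) ltr_ln ?posrE ?expR_gt0.
Qed.

Lemma ln_le_self x : 0 <= x -> ln x <= x.
Proof.
rewrite le_eqVlt => /predU1P[<-|x0]; first by rewrite ln0.
by rewrite ltW// ln_sublinear.
Qed.

Lemma expR_ge_sqr x : 0 <= x -> x ^+ 2 / 2 <= expR x.
Proof.
by move=> x0; apply: le_trans (expR_ge1Dxn 1 x0); rewrite lerDr.
Qed.

(** The derivative of [x^-e] is [-e x^-(1+e)]: the series is dominated by a
    telescoping one. *)
Lemma riemann_step (e : R) (k : nat) : 0 < e ->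
  e * expR (- (1 + e) * ln k.+2%:R) <=
  expR (- e * ln k.+1%:R) - expR (- e * ln k.+2%:R).
Proof.
move=> e0; set x : R := k.+2%:R; set y : R := k.+1%:R.
have x0 : 0 < x by rewrite ltr0n.
have y0 : 0 < y by rewrite ltr0n.
have xy : x = y + 1 by rewrite /x /y natr1.
have lxy : x^-1 <= ln x - ln y.
  have -> : ln x - ln y = - ln (1 + - x^-1).
    rewrite (_ : 1 + - x^-1 = y / x); last by rewrite (_ : y = x - 1); [field; rewrite lt0r_neq0|rewrite xy addrK].
    by rewrite ln_div ?posrE// opprB.
  rewrite lerNr; apply: le_ln1Dx; rewrite ltrN2 invf_lt1//.
  by rewrite xy ltrDr.
have -> : - (1 + e) * ln x = - e * ln x - ln x by ring.
rewrite expRD expRN lnK ?posrE// lerBrDr.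
apply: (@le_trans _ _ (expR (- e * ln x) * (1 + e * x^-1))).
  by rewrite le_eqVlt; apply/orP; left; apply/eqP; ring.
apply: (@le_trans _ _ (expR (- e * ln x) * expR (e * (ln x - ln y)))).
  rewrite ler_wpM2l ?expR_ge0//; apply: le_trans (expR_ge1Dx _).
  by rewrite lerD2l ler_wpM2l// ltW.
by rewrite -expRD ler_expR; lra.
Qed.

Lemma riemann_sum_bounded (e D : R) : 0 < e -> 0 < D ->
  exists M, forall n : nat, \sum_(k < n) expR (- (1 + e) * ln (D * k%:R)) <= M.
Proof.
move=> e0 D0; set C := expR (- (1 + e) * ln D).
have uE k : expR (- (1 + e) * ln (D * k.+1%:R)) = C * expR (- (1 + e) * ln k.+1%:R).
  by rewrite lnM ?posrE ?ltr0n// mulrDr expRD.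
exists (1 + C + C / e) => n.
apply: (@le_trans _ _ (\sum_(k < n.+2) expR (- (1 + e) * ln (D * k%:R)))).
  by rewrite -[n.+2]addn2 big_split_ord/= lerDl sumr_ge0// => k _; exact: expR_ge0.
apply: (@le_trans _ _ (1 + C + C / e * (1 - expR (- e * ln n.+1%:R)))); last first.
  by rewrite lerD2l ler_piMr ?divr_ge0 ?expR_ge0 ?(ltW e0)// gerBl expR_ge0.
elim: n => [|n IHn].
  rewrite !big_ord_recr big_ord0/= add0r mulr0 ln0// mulr0 expR0 mulr1.
  by rewrite ln1 mulr0 expR0 subrr mulr0 addr0.
rewrite big_ord_recr/= uE.
apply: (le_trans (lerD IHn (lexx _))); rewrite -!addrA !lerD2l.
have h := riemann_step n e0; have C0 : 0 < C by exact: expR_gt0.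
have h' := ler_wpM2l (ltW (divr_gt0 C0 e0)) h.
have -> : C * expR (- (1 + e) * ln n.+2%:R) = C / e * (e * expR (- (1 + e) * ln n.+2%:R)).
  by field; rewrite lt0r_neq0.
by lra.
Qed.

End normalization.

Section upper_lil.
Context d (Omega : measurableType d) (R : realType) (P : probability Omega R).
Context {A : finType} (xi : nat -> Omega -> A) (p : A -> R).
Hypothesis iid : finite_iid P xi p.

Lemma finite_bounded (f : A -> R) : exists2 c, 0 < c & forall a, `|f a| <= c.
Proof.
exists (1 + \sum_a `|f a|) => [|a]; first by rewrite ltr_wpDr// sumr_ge0.
by rewrite (bigD1 a)//= addrCA lerDl addr_ge0// sumr_ge0.
Qed.

(** The maximal inequality is applied on the blocks [e^(Dk), e^(D(k+1))),
    which are so short that the norming sequence hardly grows on a block. *)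
Lemma upper_lil (f : A -> R) (e : R) : \sum_a p a * f a = 0 -> 0 < e ->
  {ae P, forall w, exists N : nat, forall n, (N <= n)%N ->
    \sum_(j < n) f (xi j w) <= (Num.sqrt (\sum_a p a * f a ^+ 2) + e) * lilr n%:R}.
Proof.
move=> f0 e0; set v := \sum_a _; set sg := Num.sqrt v.
have [c c0 fc] := finite_bounded f.
have v0 : 0 <= v.
  by rewrite sumr_ge0// => a _; rewrite mulr_ge0 ?sqr_ge0// (fi_ge0 iid).
have sg0 : 0 <= sg by exact: sqrtr_ge0.
pose s := sg + e / 2; have s0 : 0 < s by rewrite /s; lra.
pose m := Num.min 1 (e / 2 / s).
have m0 : 0 < m by rewrite lt_min ltr01 !divr_gt0.
have m1 : m <= 1 by rewrite ge_min lexx.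
have sm : s * (1 + m) <= sg + e.
  have : m <= e / 2 / s by rewrite ge_min lexx orbT.
  by rewrite ler_pdivlMr// /s; lra.
pose D := ln (1 + m / 4).
have eD : expR D = 1 + m / 4 by rewrite lnK// posrE; lra.
have D0 : 0 < D by rewrite ln_gt0//; lra.
pose x k : R := D * k%:R.
pose N k := Num.truncn (expR (x k.+1)).
pose l k := s * (1 + m) * lilr (expR (x k)).
pose E k := [set w | hit f (l k) (word xi (N k) w)].
have [M uM] := riemann_sum_bounded m0 D0.
pose eta := m / 8 / c.
have eta0 : 0 < eta by rewrite !divr_gt0.
pose k0 := (Num.truncn ((expR 1 + 4 / (s ^+ 2 * eta ^+ 2)) / D)).+1.
have xk0 k : (k0 <= k)%N -> expR 1 + 4 / (s ^+ 2 * eta ^+ 2) <= x k.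
  move=> kk; rewrite -ler_pdivrMl// mulrC; apply: ltW.
  by apply: (lt_le_trans (truncnS_gt _)); rewrite ler_nat.
have z0 : 0 < 4 / (s ^+ 2 * eta ^+ 2) by apply: divr_gt0 => //; apply: mulr_gt0; exact: exprn_gt0.
have e1 : 1 < expR 1 :> R by rewrite expR_gt1.
have EP k : (k0 <= k)%N -> (P (E k) <= (expR (- (1 + m) * ln (D * k%:R)))%:E)%E.
  move=> kk; rewrite /E (prob_word iid) lee_fin.
  have xk := xk0 k kk; have xk_gt0 : 0 < x k by lra.
  have lx : 1 <= ln (x k) by rewrite -[1]expRK ln_mono ?expR_gt0//; lra.
  pose X := expR (x k); have X0 : 0 < X by exact: expR_gt0.
  pose t := lilr X / (X * s).
  have tt : t ^+ 2 = 2 * ln (x k) / (X * s ^+ 2).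
    rewrite /t expr_div_n lilr_expR -/X; last by lra.
    by field; rewrite !lt0r_neq0.
  have t0 : 0 <= t by rewrite /t divr_ge0 ?lilr_ge0// mulr_ge0// ltW.
  have t_eta : t <= eta.
    rewrite -(@ler_pXn2r _ 2)// ?nnegrE ?(ltW eta0)// tt ler_pdivrMr; last first.
      by rewrite mulr_gt0// exprn_gt0.
    have h1 : 4 <= x k * (s ^+ 2 * eta ^+ 2).
      rewrite -ler_pdivrMr; first by lra.
      by rewrite mulr_gt0 ?exprn_gt0.
    have h2 : x k ^+ 2 / 2 <= X by apply: expR_ge_sqr; exact: ltW.
    have h3 : ln (x k) <= x k by apply: ln_le_self; exact: ltW.
    apply: (@le_trans _ _ (x k / 2 * (x k * (s ^+ 2 * eta ^+ 2)))).
      apply: (@le_trans _ _ (x k / 2 * 4)); first by lra.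
      by rewrite ler_wpM2l// divr_ge0// ltW.
    rewrite (_ : x k / 2 * _ = x k ^+ 2 / 2 * (s ^+ 2 * eta ^+ 2)); last by field.
    rewrite (_ : eta ^+ 2 * _ = X * (s ^+ 2 * eta ^+ 2)); last by ring.
    by rewrite ler_wpM2r// mulr_ge0 ?sqr_ge0.
  have tc : t * c <= m / 8.
    by apply: (le_trans (ler_wpM2r (ltW c0) t_eta)); rewrite /eta divfK// lt0r_neq0.
  have vs : v <= s ^+ 2.
    rewrite -(sqr_sqrtr v0) lerXn2r ?nnegrE ?(ltW s0)// -/sg /s; lra.
  have tc1 : t * c <= 1 by lra.
  apply: (le_trans (hit_bound (fi_ge0 iid) (fi_sum1 iid) (l k) (N k) t0 tc1 fc f0 vs)).
  rewrite ler_expR.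
  have tl : t * l k = 2 * (1 + m) * ln (x k).
    rewrite /l -/X /t.
    rewrite (_ : _ * _ = lilr X ^+ 2 * (1 + m) / X); last by field; rewrite !lt0r_neq0.
    by rewrite lilr_expR -/X; [field; rewrite lt0r_neq0|lra].
  have NX : (N k)%:R <= X * (1 + m / 4).
    rewrite -eD -expRD /N; apply: (@le_trans _ _ (expR (x k.+1))).
      by rewrite truncn_le expR_ge0.
    by rewrite ler_expR /x -natr1; lra.
  rewrite tl tt -/(x k).
  have step : (N k)%:R * (2 * ln (x k) / (X * s ^+ 2) * s ^+ 2 * (1 + 2 * (t * c)) / 2) <=
     ln (x k) * (1 + m).
    have tc0 : 0 <= t * c by rewrite mulr_ge0// ltW.
    have W0 : 0 <= 2 * ln (x k) / X by rewrite divr_ge0 ?(ltW X0)//; lra.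
    rewrite (_ : _ * s ^+ 2 = 2 * ln (x k) / X); last by field; rewrite !lt0r_neq0.
    apply: (@le_trans _ _ (X * (1 + m / 4) * (2 * ln (x k) / X * (1 + m / 4) / 2))).
      apply: ler_pM => //; first by rewrite divr_ge0// mulr_ge0//; lra.
      by rewrite ler_wpM2r// ler_wpM2l//; lra.
    rewrite (_ : X * _ * _ = ln (x k) * (1 + m / 4) ^+ 2); last by field; rewrite !lt0r_neq0.
    rewrite ler_wpM2l//; first by lra.
    nra.
  by move: step; lra.
have := ae_eventually_not (u := fun k => expR (- (1 + m) * ln (D * k%:R)))
   (fun k => measurable_wordQ iid (N k) (hit f (l k))) (fun k => expR_ge0 _) EP uM.
apply: filterS => w [K HK].
pose K' := maxn K k0.
exists (Num.truncn (expR (x K'))).+1 => n nK.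
have n0 : 0 < n%:R :> R by rewrite ltr0n (leq_ltn_trans _ nK).
have nK' : expR (x K') <= n%:R.
  by apply: ltW; apply: (lt_le_trans (truncnS_gt _)); rewrite ler_nat.
pose k := Num.truncn (ln n%:R / D).
have lnn : x K' <= ln n%:R by rewrite -(expRK (x K')) ln_mono ?expR_gt0.
have xK' := xk0 K' (leq_maxr _ _).
have lnn0 : 0 <= ln n%:R / D :> R by rewrite divr_ge0 ?(ltW D0)//; lra.
have /andP[kl kr] := truncn_itv lnn0; rewrite -/k in kl kr.
have Kk : (K' <= k)%N.
  by rewrite truncn_ge_nat// ler_pdivlMr// mulrC.
have xkn : x k <= ln n%:R by move: kl; rewrite ler_pdivlMr// /x mulrC.
have xkn1 : ln n%:R < x k.+1 by move: kr; rewrite ltr_pdivrMr// /x mulrC.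
have := HK k (leq_trans (leq_maxl _ _) Kk); rewrite /mkset/=.
apply: contra_notP => /negP; rewrite -ltNge => Sn.
apply: (@hit_take _ _ _ _ _ n).
rewrite take_word; last first.
  rewrite truncn_ge_nat ?expR_ge0//; apply: ltW.
  by rewrite -[n%:R]lnK ?posrE// ltr_expR.
rewrite sum_word (le_trans _ (ltW Sn))//.
have xk := xk0 k (leq_trans (leq_maxr _ _) Kk).
rewrite /l; apply: ler_pM => //; last 1 first.
- apply: lilr_mono; first by rewrite expR_gt1; lra.
  by rewrite -[n%:R]lnK ?posrE// ler_expR.
- by rewrite mulr_ge0// ?(ltW s0)//; lra.
- exact: lilr_ge0.
Qed.

End upper_lil.


(** * The lower law of the iterated logarithm *)

Section lower_lil.
Context d (Omega : measurableType d) (R : realType) (P : probability Omega R).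
Context {A : finType} (xi : nat -> Omega -> A) (p : A -> R).
Hypothesis iid : finite_iid P xi p.

Section blocks.
Variables (bd : nat -> nat) (good : nat -> pred (seq A)).
Hypothesis bd_le : forall k, (bd k <= bd k.+1)%N.

(** No block from [j] to [j + i - 1] is good. The last block is split off, since
    it is independent of the word that precedes it. *)
Fixpoint none_good (j i : nat) (s : seq A) : bool :=
  if i is i'.+1 then
    none_good j i' (take (bd (j + i')) s) &&
    ~~ good (j + i') (drop (bd (j + i')) s)
  else true.

Lemma wprob_none_good j i :
  wprob p (bd (j + i)) (none_good j i) =
  \prod_(i' < i) (1 - wprob p (bd (j + i').+1 - bd (j + i')) (good (j + i'))).
Proof.
elim: i => [|i IHi]; first by rewrite big_ord0 /wprob (wexp_cst (fi_sum1 iid)).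
rewrite big_ord_recr/= -IHi -(wprobC (fi_sum1 iid)) addnS.
rewrite -{1}(subnKC (bd_le (j + i))).
exact: wprob_block.
Qed.

Lemma none_goodPn j i w : ~~ none_good j i (word xi (bd (j + i)) w) ->
  exists2 k, (j <= k)%N & good k (drop (bd k) (word xi (bd k.+1) w)).
Proof.
elim: i => [//|i IHi] /=; rewrite addnS take_word// negb_and negbK.
by case/orP => [/IHi//|gd]; exists (j + i)%N => //; rewrite leq_addr.
Qed.

End blocks.

(** In the block [[L^k, L^(k+1))], tilting the law by [1 + t g] moves the mean
    of [f i] to [t] times its covariance with [g]; for the right [t] the price
    is [(k+1)^-(1-rho)], which is not summable. *)
Lemma lower_lil (I : finType) (f : I -> A -> R) (g : A -> R) (e : R) :
  (forall i, \sum_a p a * f i a = 0) -> \sum_a p a * g a = 0 ->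
  \sum_a p a * g a ^+ 2 < 1 -> 0 < e ->
  {ae P, forall w, forall N : nat, exists2 n, (N <= n)%N & forall i,
    `|\sum_(j < n) f i (xi j w) - (\sum_a p a * (g a * f i a)) * lilr n%:R|
      <= e * lilr n%:R}.
Proof.
move=> f0 g0; set r2 := \sum_a _ => r21 e0.
have r20 : 0 <= r2.
  by rewrite sumr_ge0// => a _; rewrite mulr_ge0 ?sqr_ge0// (fi_ge0 iid).
have [c [c1 fc gc]] : exists c, [/\ 1 <= c, (forall i a, `|f i a| <= c)
    & (forall a, `|g a| <= c)].
  have [c1 c10 h1] := finite_bounded (fun x : I * A => f x.1 x.2).
  have [c2 c20 h2] := finite_bounded g.
  exists (1 + c1 + c2); split; first by lra.
  - by move=> i a; apply: (le_trans (h1 (i, a))); lra.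
  - by move=> a; apply: (le_trans (h2 a)); lra.
have c0 : 0 < c by lra.
have [rho [rhoE rho0]] : exists rho, rho = (1 - r2) / 8 /\ 0 < rho.
  by exists ((1 - r2) / 8); split=> //; lra.
pose dl := Num.min (e / 2) (rho / 4).
have dl0 : 0 < dl by rewrite lt_min !divr_gt0.
have dle : dl <= e / 2 by rewrite ge_min lexx.
have dlr : dl <= rho / 4 by rewrite ge_min lexx orbT.
pose L := (Num.truncn (rho^-1 + (2 * (c + 1) / e) ^+ 2)).+2.
have LR : rho^-1 + (2 * (c + 1) / e) ^+ 2 + 1 <= L%:R.
  by rewrite /L -[leRHS]natr1 lerD2r ltW// truncnS_gt.
have ri0 : 0 < rho^-1 by rewrite invr_gt0.
have ce0 : 0 <= (2 * (c + 1) / e) ^+ 2 by exact: sqr_ge0.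
have L1 : 1 < L%:R :> R by rewrite ltr1n.
have L0 : 0 < L%:R :> R by lra.
have Lratio : L%:R / (L%:R - 1) <= 1 + rho.
  rewrite ler_pdivrMr; last by lra.
  have : rho^-1 * rho = 1 by rewrite mulVf// lt0r_neq0.
  by nra.
have Lsqrt : 2 * (c + 1) / e <= Num.sqrt L%:R.
  rewrite -(@ler_pXn2r _ 2)// ?nnegrE ?sqrtr_ge0//; last first.
    by rewrite divr_ge0 ?(ltW e0)// mulr_ge0//; lra.
  rewrite sqr_sqrtr; lra.
pose bd k := (L ^ k)%N.
have bd_mono k j : (k <= j)%N -> (bd k <= bd j)%N by move=> kj; rewrite leq_pexp2l.
have bdR k : (bd k)%:R = L%:R ^+ k :> R by rewrite natrX.
have bd0 k : 0 < (bd k)%:R :> R by rewrite bdR exprn_gt0.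
have lnL : 0 < ln L%:R :> R by rewrite ln_gt0.
have lnbd k : ln (bd k)%:R = k%:R * ln L%:R :> R by rewrite bdR lnXn// mulr_natl.
pose b k : R := lilr (bd k.+1)%:R.
pose m k : nat := (bd k.+1 - bd k)%N.
have mR k : (m k)%:R = L%:R ^+ k * (L%:R - 1) :> R.
  by rewrite /m natrB ?bd_mono// !bdR exprS; ring.
have m0 k : 0 < (m k)%:R :> R by rewrite mR mulr_gt0 ?exprn_gt0//; lra.
pose t k := b k / (m k)%:R.
pose gd k s := [forall i, `|\sum_(a <- s) f i a -
    (m k)%:R * (t k * \sum_a p a * (g a * f i a))| <= (m k)%:R * t k * dl].
pose u (k : nat) : R := ln (k.+1%:R * ln L%:R).
have bsq k : (1 : R) < k.+1%:R * ln L%:R -> b k ^+ 2 = (bd k.+1)%:R * (2 * u k).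
  move=> h; rewrite /b /lilr lnbd -/(u k) exprMn sqr_sqrtr; last exact: ltW.
  by rewrite sqr_sqrtr//; apply: mulr_ge0 => //; apply: ln_ge0; exact: ltW.
have mt2 k : (1 : R) < k.+1%:R * ln L%:R -> (m k)%:R * t k ^+ 2 = 2 * u k * (L%:R / (L%:R - 1)).
  move=> h; rewrite /t expr_div_n bsq// bdR exprS mR.
  by field; rewrite !lt0r_neq0 ?exprn_gt0//; lra.
(* all the smallness conditions hold for large [k] *)
have ubig (M : R) : \forall k \near \oo, M <= u k.
  pose K := (Num.truncn (expR M / ln L%:R)).+1.
  exists K => // k /= Kk; rewrite -[leLHS]expRK ln_mono ?expR_gt0//.
  rewrite -ler_pdivrMr// ltW// (lt_le_trans (truncnS_gt _))// ler_nat.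
  exact: leq_trans Kk _.
have kbig : \forall k \near \oo, (1 : R) < k.+1%:R * ln L%:R.
  near=> k; have : 1 <= u k by near: k; exact: ubig.
  rewrite /u ltNge; apply: contraTN => /ln_le0; lra.
have tsmall (M : R) : 0 < M -> \forall k \near \oo, t k <= M.
  move=> M0; near=> k.
  have k1 : (1 : R) < k.+1%:R * ln L%:R by near: k.
  have b0 : 0 <= b k by exact: lilr_ge0.
  have uk : 1 <= u k by near: k; exact: ubig.
  rewrite -(@ler_pXn2r _ 2)// ?nnegrE ?(ltW M0) ?divr_ge0 ?(ltW (m0 k))//.
  rewrite -(ler_pM2l (m0 k)) mt2//.
  apply: (@le_trans _ _ (2 * (u k) * (1 + rho))).
    by rewrite ler_wpM2l//; lra.
  (* [u k] is at most [k.+1 * ln L], and [m k] at least [k.+1 ^ 2 (ln L)^2 / (2 L)] *)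
  pose y : R := k.+1%:R * ln L%:R.
  have uy : u k <= y by apply: ln_le_self; rewrite mulr_ge0// ltW.
  have my : y ^+ 2 / 2 / L%:R * (L%:R - 1) <= (m k)%:R.
    rewrite mR ler_wpM2r//; first by lra.
    rewrite ler_pdivrMr// -exprSr -bdR -[leRHS]lnK ?posrE// lnbd.
    by apply: expR_ge_sqr; rewrite mulr_ge0// ltW.
  apply: (@le_trans _ _ (y ^+ 2 / 2 / L%:R * (L%:R - 1) * M ^+ 2)); last first.
    by rewrite ler_wpM2r// sqr_ge0.
  pose Z := 4 * (1 + rho) * L%:R / (L%:R - 1) / M ^+ 2.
  have Zy : Z <= y.
    apply: (le_trans _ uy); near: k; exact: ubig.
  have yy : Z * y <= y ^+ 2 by rewrite expr2 ler_wpM2r//; rewrite /y; lra.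
  have q0 : 0 < (L%:R - 1) * M ^+ 2 / 2 / L%:R by rewrite !divr_gt0// mulr_gt0 ?exprn_gt0//; lra.
  have := ler_wpM2r (ltW q0) yy.
  rewrite (_ : Z * y * _ = 2 * y * (1 + rho)); last first.
    by rewrite /Z; field; rewrite !lt0r_neq0//; lra.
  rewrite (_ : y ^+ 2 * ((L%:R - 1) * M ^+ 2 / 2 / L%:R) = y ^+ 2 / 2 / L%:R * (L%:R - 1) * M ^+ 2); last by field; rewrite lt0r_neq0.
  apply: le_trans; rewrite ler_wpM2r//; lra.
have [K0 gdP] : exists K0, forall k, (K0 <= k)%N ->
    (1 : R) < k.+1%:R * ln L%:R /\
    2^-1 * expR (- (1 - rho) * u k) <= wprob p (m k) (gd k).
  have [K0 _ H0] : \forall k \near \oo, [/\ (1 : R) < k.+1%:R * ln L%:R, 1 <= u k,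
      t k <= 4^-1 / c, t k <= dl / (6 * c ^+ 3) &
      2 * ((#|I|%:R + 4) * c ^+ 2 * 2) / dl ^+ 2 <= u k].
    near=> k; split; [by near: k|by near: k; exact: ubig| | |by near: k; exact: ubig].
    - by near: k; apply: tsmall; rewrite divr_gt0.
    - by near: k; apply: tsmall; rewrite divr_gt0// mulr_gt0// exprn_gt0.
  exists K0 => k /H0[k1 u1 t1 t2 ub]; split=> //.
  have b0 : 0 < b k.
    rewrite lt_def lilr_ge0 andbT -sqrf_eq0 bsq//; apply: lt0r_neq0.
    by apply: mulr_gt0 => //; lra.
  have t0 : 0 < t k by rewrite divr_gt0.
  have Lr1 : 1 <= L%:R / (L%:R - 1) :> R by rewrite ler_pdivlMr; lra.
  apply: le_trans (@tilt_lower _ _ p I f g c (t k) dl (m k) (fi_ge0 iid) (fi_sum1 iid)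
    fc gc f0 g0 dl0 t0 _ _ _).
  - rewrite ler_pM2l// ler_expR mt2// -/r2.
    have : 2 * u k * (L%:R / (L%:R - 1)) * (r2 / 2 + 2 * dl) <= (1 - rho) * u k.
      apply: (@le_trans _ _ (2 * u k * (1 + rho) * (r2 / 2 + 2 * dl))).
        by rewrite ler_wpM2r//; [lra|rewrite ler_wpM2l//; lra].
      rewrite (_ : 2 * u k * _ * _ = (1 + rho) * (r2 + 4 * dl) * u k); last by field.
      rewrite ler_wpM2r//; first by lra.
      have r2E : r2 = 1 - 8 * rho by rewrite rhoE; field.
      by rewrite r2E; nra.
    by lra.
  - by move: t1; rewrite ler_pdivlMr.
  - by move: t2; rewrite ler_pdivlMr ?mulr_gt0 ?exprn_gt0//; lra.
  - move: ub; rewrite ler_pdivrMr ?exprn_gt0// => ub; apply: (le_trans ub).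
    rewrite mulrC ler_wpM2l ?sqr_ge0// mt2//.
    rewrite -[leLHS]mulr1 ler_pM//; lra.
(* almost surely some block after any given one is good *)
have ioblock K : {ae P, forall w, exists2 k, (K <= k)%N &
    gd k (drop (bd k) (word xi (bd k.+1) w))}.
  pose J j := (j.+1 + (K + K0))%N.
  pose E j := [set w | none_good bd gd (J j) (J j) (word xi (bd (J j + J j)) w)].
  pose q j : R := 2^-1 * expR (- (1 - rho) * ln ((2 * (J j)%:R) * ln L%:R)).
  have J0 j : 0 < (J j)%:R :> R by rewrite ltr0n.
  have q0 j : 0 < q j by rewrite mulr_gt0 ?expR_gt0.
  have EP j : (P (E j) <= (expR (- ((J j)%:R * q j)))%:E)%E.
    rewrite /E (prob_word iid) lee_fin (wprob_none_good _ (fun k => bd_mono k _ (leqnSn k))).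
    have -> : expR (- ((J j)%:R * q j)) = \prod_(i < J j) expR (- q j).
      by rewrite prodr_const card_ord -mulrN expRM_natl.
    apply: ler_prod => i _.
    have k0 : (K0 <= J j + i)%N by rewrite /J addnAC addnA leq_addl.
    have [k1 kq] := gdP _ k0.
    rewrite subr_ge0; apply/andP; split.
      rewrite -[leRHS](wexp_cst (fi_sum1 iid) (m (J j + i)%N)).
      by apply: (le_wexp (fi_ge0 iid)) => s _; case: (gd _ _).
    apply: (@le_trans _ _ (1 + - q j)); last exact: expR_ge1Dx.
    rewrite lerD2l lerN2; apply: le_trans kq.
    rewrite ler_pM2l// ler_expR !mulNr lerN2 ler_wpM2l//; first by lra.
    rewrite ln_mono//; first by lra.
    rewrite ler_wpM2r ?(ltW lnL)// -natrM ler_nat mul2n -addnn -addnS leq_add2l.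
    exact: ltn_ord.
  have lim0 : (fun j => expR (- ((J j)%:R * q j))) @ \oo --> (0 : R).
    apply/cvgrPdist_le => eps eps0.
    pose C : R := 4 * ln L%:R / eps.
    have C0 : 0 < C by rewrite !divr_gt0// mulr_gt0.
    have [N1 _ HN1] : \forall j \near \oo, ln C / rho <= ln (2 * (J j)%:R * ln L%:R).
      exists (Num.truncn (expR (ln C / rho) / ln L%:R)) => // j /= Nj.
      rewrite -[leLHS]expRK ln_mono ?expR_gt0// -ler_pdivrMr// ltW//.
      rewrite (lt_le_trans (truncnS_gt _))// -natrM ler_nat mul2n -addnn /J.
      by apply: (leq_trans (n := j.+1)); rewrite // -addnA leq_addr.
    exists N1 => // j /= /HN1; rewrite ler_pdivrMr// => hj.
    rewrite sub0r normrN gtr0_norm ?expR_gt0//.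
    set y := 2 * (J j)%:R * ln L%:R in hj *.
    have y0 : 0 < y by rewrite /y !mulr_gt0.
    have JQ : eps^-1 <= (J j)%:R * q j.
      rewrite /q -/y (_ : - (1 - rho) * ln y = rho * ln y - ln y); last by ring.
      rewrite expRB lnK ?posrE//.
      rewrite (_ : _ * _ = expR (rho * ln y) / (4 * ln L%:R)); last first.
        by rewrite /y; field; rewrite !lt0r_neq0.
      rewrite ler_pdivlMr ?mulr_gt0// mulrC -/C.
      by rewrite -[leLHS]lnK ?posrE// ler_expR mulrC.
    rewrite expRN -[leRHS]invrK lef_pV2 ?posrE ?expR_gt0 ?invr_gt0//.
    by apply: (le_trans JQ); apply: le_trans (expR_ge1Dx _); rewrite lerDr.
  have := ae_exists_of_small (fun j => measurable_wordQ iid _ _) EP lim0.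
  apply: filterS => w [j /negP nE].
  have [k Jk gk] := none_goodPn (fun k => bd_mono k _ (leqnSn k)) nE; exists k => //; apply: leq_trans Jk.
  by rewrite /J addnCA leq_addr.
have up i : {ae P, forall w, exists N : nat, forall n, (N <= n)%N ->
    `|\sum_(j < n) f i (xi j w)| <= (c + 1) * lilr n%:R}.
  have sq : Num.sqrt (\sum_a p a * f i a ^+ 2) <= c.
    rewrite -[leRHS](ger0_norm (ltW c0)) -sqrtr_sqr ler_wsqrtr// -[leRHS]mul1r.
    rewrite -(fi_sum1 iid) mulr_suml ler_sum// => a _; rewrite ler_wpM2l ?(fi_ge0 iid)//.
    by rewrite -[leLHS]real_normK ?num_real// lerXn2r ?nnegrE// ltW.
  have fN0 : \sum_a p a * (- f i a) = 0.
    by under eq_bigr do rewrite mulrN; rewrite sumrN f0 oppr0.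
  have := upper_lil iid fN0 ltr01; have := upper_lil iid (f0 i) ltr01.
  apply: filterS2 => w [N1 H1] [N2 H2]; exists (maxn N1 N2) => n.
  rewrite geq_max => /andP[/H1 h1 /H2 h2]; rewrite ler_norml lerNl; apply/andP; split.
    rewrite sumrN in h2; apply: (le_trans h2).
    rewrite ler_wpM2r ?lilr_ge0// lerD2r.
    by under eq_bigr do rewrite sqrrN.
  by apply: (le_trans h1); rewrite ler_wpM2r ?lilr_ge0// lerD2r.
have io := ae_foralln ioblock.
have upI : {ae P, forall w, forall i, exists N : nat, forall n, (N <= n)%N ->
    `|\sum_(j < n) f i (xi j w)| <= (c + 1) * lilr n%:R}.
  exact: ae_forall_countable.
move: io upI; apply: filterS2 => w io upw N.
have [N1 HN1] : exists N1 : nat, forall n, (N1 <= n)%N -> forall i,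
    `|\sum_(j < n) f i (xi j w)| <= (c + 1) * lilr n%:R.
  have /choice[F HF] := upw.
  exists (\max_i F i) => n Fn i; apply: HF; apply: leq_trans Fn.
  exact: leq_bigmax.
have [k Kk gk] := io (maxn (maxn N N1) K0).
have kN : (N <= k)%N by rewrite (leq_trans _ Kk)// -maxnA leq_maxl.
have kN1 : (N1 <= k)%N by apply: leq_trans Kk; rewrite !leq_max leqnn orbT.
have kK0 : (K0 <= k)%N by rewrite (leq_trans _ Kk)// leq_maxr.
have [k1 _] := gdP k kK0.
have kbd j : (j <= bd j)%N by rewrite ltnW// ltn_expl.
exists (bd k.+1); first by rewrite (leq_trans kN)// (leq_trans _ (kbd _)).
move=> i; have /forallP/(_ i) := gk.
rewrite sum_drop_word ?bd_mono//.
have mt : (m k)%:R * t k = b k by rewrite /t mulrC divfK// lt0r_neq0.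
rewrite mulrA mt -/(b k) => hk.
have hS := HN1 (bd k) (leq_trans kN1 (kbd _)) i.
have hb : (c + 1) * lilr (bd k)%:R <= e / 2 * b k.
  have hs : Num.sqrt L%:R * lilr (bd k)%:R <= b k.
    rewrite /b /lilr mulrA -sqrtrM ?(ltW L0)// -[bd k.+1]/(L ^ k.+1)%N expnS natrM.
    rewrite ler_wpM2l ?sqrtr_ge0// ler_wsqrtr// ler_wpM2l//.
    have [lk0|lk0] := leP (ln (bd k)%:R : R) 0.
      rewrite (ln0 lk0) ln_ge0// -natrM -expnS -/(bd k.+1) lnbd; lra.
    rewrite ln_mono// ln_mono// -natrM -expnS -/(bd k.+1) ler_nat bd_mono//.
  apply: (@le_trans _ _ (e / 2 * (2 * (c + 1) / e) * lilr (bd k)%:R)).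
    by rewrite le_eqVlt; apply/orP; left; apply/eqP; field; rewrite lt0r_neq0.
  rewrite -mulrA ler_wpM2l ?divr_ge0 ?(ltW e0)//; apply: le_trans hs.
  by rewrite ler_wpM2r ?lilr_ge0.
set S1 := \sum_(j < bd k.+1) _ in hk *; set S0 := \sum_(j < bd k) _ in hk hS *.
suff : `|S1 - (\sum_a p a * (g a * f i a)) * b k| <= e * b k by [].
set cv := \sum_a _ in hk *.
rewrite (_ : S1 - _ = (S1 - S0 - b k * cv) + S0); last by ring.
rewrite (le_trans (ler_normD _ _))// [e in leRHS](splitr e) mulrDl lerD//.
  by apply: (le_trans hk); rewrite mulrC ler_wpM2r ?lilr_ge0.
exact: le_trans hb.
Unshelve. all: by end_near. Qed.

End lower_lil.


(** * Finitely many coordinates of independent processes *)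

Section fbm_coordinates.
Context d (Omega : measurableType d) (R : realType) (P : probability Omega R).
Variable B : nat -> R -> {RV P >-> R}.
Hypothesis B_iid : iid_processes B.

Section family.
Variables (n : nat) (t : 'I_n -> R) (D : 'I_n -> set R).
Hypotheses (t_ge0 : forall i, 0 <= t i) (mD : forall i, measurable (D i)).

Definition pattern (j : nat) (w : Omega) : {ffun 'I_n -> bool} :=
  [ffun i => `[< D i (B j (t i) w) >]].

Definition pattern_law (a : {ffun 'I_n -> bool}) : R :=
  fine (P (pattern 0 @^-1` [set a])).

Let side (a : {ffun 'I_n -> bool}) i : set R := if a i then D i else ~` D i.

Let pattern_bigcap j a :
  pattern j @^-1` [set a] = \bigcap_i (B j (t i) @^-1` side a i).
Proof.
apply/seteqP; split => w /=.
  by move=> <- i _; rewrite /side /= ffunE; case: asboolP.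
move=> h; apply/ffunP => i; rewrite ffunE; have := h i I.
by rewrite /side /=; case: (a i) => Di; apply/asboolP.
Qed.

Let measurable_side a i : measurable (side a i).
Proof. by rewrite /side; case: (a i) => //; exact: measurableC. Qed.

Lemma measurable_pattern j a : measurable (pattern j @^-1` [set a]).
Proof.
rewrite pattern_bigcap; apply: fin_bigcap_measurable => // i _.
by rewrite -[_ @^-1` _]setTI; exact: measurable_funPT.
Qed.

Lemma pattern_sigma_algebra j a :
  process_sigma_algebra (B j) (pattern j @^-1` [set a]).
Proof.
pose G := [set B j t @^-1` A | t in `[0, +oo[ & A in measurable].
suff : measurable (pattern j @^-1` [set a] : set (g_sigma_algebraType G)) by [].
rewrite pattern_bigcap; apply: fin_bigcap_measurable => // i _.
apply: sub_sigma_algebra; exists (t i); first by rewrite /= in_itv/= t_ge0.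
by exists (side a i).
Qed.

Lemma pattern_prob j a : P (pattern j @^-1` [set a]) = (pattern_law a)%:E.
Proof.
rewrite /pattern_law fineK ?fin_num_measure//; last exact: measurable_pattern.
by rewrite !pattern_bigcap; case: B_iid => _; exact.
Qed.

(** A pattern is an event of the sigma-algebra of its process, so that the
    independence of the processes applies; the law of a word of patterns is then
    a product. *)
Lemma pattern_iid : finite_iid P pattern pattern_law.
Proof.
split.
- exact: measurable_pattern.
- by move=> a; rewrite fine_ge0.
- apply: EFin_inj; rewrite -sumEFin -(@probability_setT _ _ _ P).
  rewrite (measure_partition P (f := pattern 0) measurableT (measurable_pattern 0)).
  by apply: eq_bigr => a _; rewrite setTI pattern_prob.
- move=> s; case: B_iid => indep _.
  pose E j := pattern j @^-1` [set nth [ffun=> false] s j].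
  have := indep [fset k in iota 0 (size s)]%fset E (fun j _ => pattern_sigma_algebra _).
  rewrite (_ : \bigcap_(j in _) E j = [set w | word pattern (size s) w = s]); last first.
    apply/seteqP; split => w /=.
      move=> h; apply: (@eq_from_nth _ [ffun=> false]); first by rewrite size_word.
      move=> i; rewrite size_word => iz; rewrite nth_mkseq//.
      by have := h i; apply; rewrite /= !inE mem_iota.
    move=> ws j /=; rewrite !inE mem_iota add0n => /andP[_ js].
    by rewrite /E/= -[in RHS]ws nth_mkseq.
  move=> ->.
  rewrite (perm_big (iota 0 (size s))); last first.
    apply: uniq_perm; rewrite ?fset_uniq ?iota_uniq// => j.
    by rewrite !inE.
  rewrite -[in RHS](mkseq_nth [ffun=> false] s) /mkseq big_map -prodEFin.
  by apply: eq_bigr => j _; rewrite -(pattern_prob j).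
Qed.

Lemma pattern_law_sum (Q : pred {ffun 'I_n -> bool}) :
  (\sum_(a | Q a) pattern_law a)%:E = P [set w | Q (pattern 0 w)].
Proof.
rewrite (measure_partition P (f := pattern 0)); last 2 first.
- have := measurable_wordQ pattern_iid 1 (fun s => if s is a :: _ then Q a else false).
  by congr measurable.
- exact: measurable_pattern.
rewrite -sumEFin big_mkcond/=; apply: eq_bigr => a _.
case Qa : (Q a).
  rewrite -(pattern_prob 0); congr (P _); apply/seteqP; split => w /=; last by case.
  by move=> wa; rewrite wa.
by rewrite (_ : _ `&` _ = set0) ?measure0//; apply/seteqP; split => w //= [+ wa]; rewrite wa Qa.
Qed.

End family.

End fbm_coordinates.


(** * Gaussian variables *)

Section level_sets.
Context d (Omega : measurableType d) (R : realType).

Lemma measurable_gt_set (f : Omega -> R) (c : R) :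
  measurable_fun [set: Omega] f -> measurable [set w | c < f w].
Proof.
move=> mf; have := mf measurableT _ (measurable_itv `]c, +oo[).
by rewrite setTI; congr measurable; apply/seteqP; split => w; rewrite /= in_itv/= andbT.
Qed.

Lemma measurable_ge_set (f : Omega -> R) (c : R) :
  measurable_fun [set: Omega] f -> measurable [set w | c <= f w].
Proof.
move=> mf; have := mf measurableT _ (measurable_itv `[c, +oo[).
by rewrite setTI; congr measurable; apply/seteqP; split => w; rewrite /= in_itv/= andbT.
Qed.

End level_sets.

Section second_moments.
Context d (Omega : measurableType d) (R : realType) (P : probability Omega R).
Implicit Types X Y : {RV P >-> R}.

Definition square_integrable X := exists v : R, expectation P (fun w => X w * X w) = v%:E.

Lemma square_integrable_Lfun1 X : square_integrable X ->
  (fun w => X w * X w) \in Lfun P 1.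
Proof.
move=> [v Ev]; apply/Lfun1_integrable/integrableP; split.
  by apply/measurable_EFinP; exact: measurable_funM.
rewrite (_ : (\int[P]_x _)%E = expectation P (fun w => X w * X w)).
  by rewrite Ev ltry.
rewrite unlock; apply: eq_integral => w _ /=.
by rewrite ger0_norm// -expr2 sqr_ge0.
Qed.

Lemma prod_Lfun1 X Y : square_integrable X -> square_integrable Y ->
  (fun w => X w * Y w) \in Lfun P 1.
Proof.
move=> /square_integrable_Lfun1 X2 /square_integrable_Lfun1 Y2.
apply/Lfun1_integrable.
have XY : P.-integrable setT (EFin \o ((fun w => X w * X w) \+ (fun w => Y w * Y w))).
  by apply/Lfun1_integrable; rewrite rpredD.
apply: le_integrable XY => //=.
  by apply/measurable_EFinP; exact: measurable_funM.
move=> w _; rewrite lee_fin [leRHS]ger0_norm; last by rewrite addr_ge0// -expr2 sqr_ge0.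
rewrite ler_norml; apply/andP; split; have := sqr_ge0 (X w + Y w); have := sqr_ge0 (X w - Y w); nra.
Qed.

Lemma RV_Lfun1 X : square_integrable X -> (X : Omega -> R) \in Lfun P 1.
Proof.
move=> X2; have c2 : square_integrable (cst 1 : {RV P >-> R}).
  exists 1; rewrite (_ : (fun w => _) = cst 1); first by rewrite expectation_cst.
  by apply/funext => w /=; rewrite mulr1.
have := prod_Lfun1 X2 c2.
rewrite (_ : (fun w => _) = (X : Omega -> R))//.
by apply/funext => w /=; rewrite mulr1.
Qed.

Lemma expectation_sqrB X Y (a b c : R) :
  expectation P (fun w => X w * X w) = a%:E -> expectation P (fun w => X w * Y w) = b%:E ->
  expectation P (fun w => Y w * Y w) = c%:E ->
  expectation P (fun w => (X w - Y w) * (X w - Y w)) = (a - 2 * b + c)%:E.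
Proof.
move=> XX XY YY.
have X2 : square_integrable X by exists a.
have Y2 : square_integrable Y by exists c.
have XY1 := prod_Lfun1 X2 Y2; have XX1 := square_integrable_Lfun1 X2.
have YY1 := square_integrable_Lfun1 Y2.
rewrite (_ : (fun w => _) = ((fun w => X w * X w) \- ((fun w => X w * Y w) \+ (fun w => X w * Y w)))
   \+ (fun w => Y w * Y w)); last by apply/funext => w /=; ring.
rewrite expectationD//; last by rewrite rpredB// rpredD.
rewrite expectationB//; last by rewrite rpredD.
rewrite expectationD// XX XY YY -!EFinD; congr (_%:E).
by rewrite EFinN || ring.
Qed.

Lemma chebyshev_RV X (v a : R) : expectation P (fun w => X w * X w) = v%:E -> 0 < a ->
  (P [set w | (a <= `|X w|)%R] <= (v / a ^+ 2)%R%:E)%E.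
Proof.
move=> Ev a0; have mf : measurable_fun [set: R] (@GRing.exp R ^~ 2%N) by [].
have := @markov _ _ _ P X (@GRing.exp R ^~ 2%N) a a0 mf.
have h1 : forall r : R, 0 <= r -> 0 <= r ^+ 2 by move=> r _; exact: sqr_ge0.
have h2 : {in Num.nneg &, {homo (fun x : R => x ^+ 2) : x y / x <= y}}.
  by move=> x y; rewrite !nnegrE => x0 y0; rewrite ler_sqr.
move=> /(_ h1 h2).
rewrite (_ : expectation P (_) = v%:E); last first.
  by rewrite -Ev; congr expectation; apply/funext => w /=; rewrite real_normK ?num_real// expr2.
rewrite muleC -lee_pdivlMr ?exprn_gt0// -EFinM => h; exact: le_trans h.
Qed.

End second_moments.

Section normal_tails.
Context {R : realType}.
Local Notation mu := (@lebesgue_measure R).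

(** Doubling the variance keeps one half of the exponent for the density, and
    leaves the other half as a tail factor. *)
Lemma normal_pdf_widen (m s a x : R) : 0 < s -> a <= `|x - m| -> 0 <= a ->
  normal_pdf m s x <=
  Num.sqrt 2 * expR (- (a ^+ 2 / (4 * s ^+ 2))) * normal_pdf m (Num.sqrt 2 * s) x.
Proof.
move=> s0 ax a0; have r0 : 0 < Num.sqrt 2 :> R by rewrite sqrtr_gt0.
have rr : Num.sqrt 2 ^+ 2 = 2 :> R by rewrite sqr_sqrtr.
rewrite !normal_pdfE ?mulf_neq0 ?lt0r_neq0//.
have -> : normal_peak s = Num.sqrt 2 * normal_peak (Num.sqrt 2 * s).
  rewrite /normal_peak exprMn rr.
  rewrite (_ : 2 * s ^+ 2 * pi *+ 2 = 2 * (s ^+ 2 * pi *+ 2)); last by ring.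
  by rewrite sqrtrM// invfM mulrA mulfV ?mul1r// lt0r_neq0.
rewrite -!mulrA ler_wpM2l ?(ltW r0)// mulrCA ler_wpM2l ?normal_peak_ge0//.
rewrite /normal_fun -expRD ler_expR exprMn rr.
have s20 : 0 < s ^+ 2 by rewrite exprn_gt0.
have xa : a ^+ 2 <= (x - m) ^+ 2.
  by rewrite -[leRHS]real_normK ?num_real// lerXn2r ?nnegrE.
rewrite -subr_ge0 (_ : _ - _ = ((x - m) ^+ 2 - a ^+ 2) / (4 * s ^+ 2)); last first.
  by field; rewrite !lt0r_neq0.
by rewrite divr_ge0 ?subr_ge0// mulr_ge0// ltW.
Qed.

Lemma normal_prob_tail (m s a : R) (A : set R) : 0 < s -> 0 <= a -> measurable A ->
  (forall x, A x -> a <= `|x - m|) ->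
  (normal_prob m s A <= (Num.sqrt 2 * expR (- (a ^+ 2 / (4 * s ^+ 2))))%:E)%E.
Proof.
move=> s0 a0 mA Aa; set c := (X in X%:E).
have c0 : 0 <= c by rewrite mulr_ge0 ?sqrtr_ge0 ?expR_ge0.
apply: (@le_trans _ _ (c%:E * normal_prob m (Num.sqrt 2 * s) A)%E); last first.
  rewrite -[leRHS]mule1 lee_wpmul2l ?lee_fin//; exact: probability_le1.
rewrite /normal_prob -ge0_integralZl_EFin//=; last 2 first.
- by move=> x _; rewrite lee_fin normal_pdf_ge0.
- by apply/measurable_EFinP/measurable_funTS; exact: measurable_normal_pdf.
apply: ge0_le_integral => //=.
- by move=> x _; rewrite lee_fin normal_pdf_ge0.
- by apply/measurable_EFinP/measurable_funTS; exact: measurable_normal_pdf.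
- apply: measurable_funeM; apply/measurable_EFinP/measurable_funTS.
  exact: measurable_normal_pdf.
- by move=> x Ax; rewrite -EFinM lee_fin normal_pdf_widen// Aa.
Qed.

Lemma normal_prob_itv (m s a b : R) : 0 < s -> a <= b ->
  (normal_prob m s `[a, b] <= ((b - a) / (2 * s))%:E)%E.
Proof.
move=> s0 ab; rewrite /normal_prob.
have peak : normal_peak s <= (2 * s)^-1.
  rewrite /normal_peak lef_pV2 ?posrE ?mulr_gt0// ?sqrtr_gt0; last first.
    by rewrite pmulrn_lgt0// mulr_gt0 ?exprn_gt0 ?pi_gt0.
  rewrite -[leLHS](@ger0_norm _ (2 * s)) ?mulr_ge0 ?(ltW s0)// -sqrtr_sqr ler_wsqrtr//.
  have := pi_ge2 R; rewrite exprMn => p2.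
  have s20 : 0 < s ^+ 2 by rewrite exprn_gt0.
  by nra.
apply: (@le_trans _ _ (\int[mu]_(x in `[a, b]) ((2 * s)^-1)%:E)%E).
  apply: ge0_le_integral => //=.
  - by move=> x _; rewrite lee_fin normal_pdf_ge0.
  - by apply/measurable_EFinP/measurable_funTS; exact: measurable_normal_pdf.
  - move=> x _; rewrite lee_fin; apply: le_trans peak; apply: normal_pdf_ub.
    exact: lt0r_neq0.
rewrite integral_cst//= lebesgue_measure_itv/= lte_fin.
have [ab'|ba] := ltP a b; first by rewrite -EFinB -EFinM lee_fin mulrC.
by rewrite mule0 lee_fin divr_ge0 ?subr_ge0// mulr_ge0// ltW.
Qed.

End normal_tails.

Section gaussian_bounds.
Context d (Omega : measurableType d) (R : realType) (P : probability Omega R).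
Variables (Y : {RV P >-> R}) (v : R).
Hypotheses (gY : is_gaussian P Y) (v0 : 0 < v).
Hypothesis (EY : expectation P Y = 0%E).
Hypothesis (EYY : expectation P (fun w => Y w * Y w) = v%:E).

Lemma RV_preimage_measurable (A : set R) : measurable A -> measurable (Y @^-1` A).
Proof. by move=> mA; rewrite -[_ @^-1` _]setTI; exact: measurable_funPT. Qed.

Lemma second_moment_center (m : R) :
  expectation P (fun w => (Y w - m) * (Y w - m)) = (v + m ^+ 2)%:E.
Proof.
have Y1 : (Y : Omega -> R) \in Lfun P 1 by apply: RV_Lfun1; exists v.
rewrite (@expectation_sqrB _ _ _ P Y (cst m) v 0 (m ^+ 2))//.
- by congr (_%:E); ring.
- rewrite (_ : (fun w => _) = m \o* (Y : Omega -> R)); last by apply/funext.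
  by rewrite expectationZl// EY mule0.
- by rewrite -[RHS](expectation_cst P); congr expectation; apply/funext => w /=; rewrite expr2.
Qed.

Let law (m s : R) := forall A : set R, measurable A ->
    P (Y @^-1` A) = if s == 0 then \d_m A else normal_prob m s A.

Lemma gaussian_nondegenerate (m s : R) : 0 <= s -> law m s -> 0 < s.
Proof.
rewrite le_eqVlt => /predU1P[<-|//] h; exfalso.
have Pm : P (Y @^-1` [set m]) = 1%E.
  by rewrite h// eqxx diracE mem_set.
have aeY : {ae P, forall w, setT w -> ((Y w - m) * (Y w - m))%:E = 0%:E :> \bar R}.
  exists (Y @^-1` (~` [set m])); split.
  - by apply: RV_preimage_measurable; exact: measurableC.
  - by rewrite -preimage_setC probability_setC ?Pm ?subee//; exact: RV_preimage_measurable.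
  - by move=> w /= nw Yw; apply: nw => _; rewrite Yw subrr mul0r.
have := second_moment_center m; rewrite unlock.
rewrite (ae_eq_integral (cst 0%E) _ _ _ _ aeY)//; last first.
  by apply/measurable_EFinP; apply: measurable_funM => //; apply: measurable_funB => //.
rewrite integral0 => -[] /esym/eqP; rewrite gt_eqF//.
by rewrite ltr_pwDl// sqr_ge0.
Qed.

(** The second moment about [m] is the integral of a tail, which is dominated by
    the exponential tail of [normal_prob_tail]. *)
Lemma gaussian_scale_lower (m s : R) : 0 < s -> law m s -> v <= 8 * s ^+ 2.
Proof.
move=> s0 h.
pose Z : {RV P >-> R} := ((Y \- cst m) ^+ 2).
have ZE w : Z w = (Y w - m) * (Y w - m) by [].
have Z0 w : 0 <= Z w by rewrite ZE -expr2 sqr_ge0.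
have EZ : expectation P Z = (v + m ^+ 2)%:E.
  by rewrite -second_moment_center; congr expectation; apply/funext.
have rate0 : 0 < (4 * s ^+ 2)^-1 by rewrite invr_gt0 mulr_gt0// exprn_gt0.
have h4 : 0 < 4 * s ^+ 2 by rewrite mulr_gt0// exprn_gt0.
suff : (expectation P Z <= (Num.sqrt 2 * (4 * s ^+ 2))%:E)%E.
  rewrite EZ lee_fin => vs; apply: (le_trans _ (le_trans vs _)); first by rewrite lerDl sqr_ge0.
  have : Num.sqrt 2 <= 2 :> R.
    rewrite -[leRHS]ger0_norm// -sqrtr_sqr ler_wsqrtr//; lra.
  by move=> r2; nra.
rewrite ge0_expectation_ccdf//.
apply: (@le_trans _ _ (\int[lebesgue_measure]_(r in `[0%R, +oo[)
   ((Num.sqrt 2 * (4 * s ^+ 2))%:E * (exponential_pdf (4 * s ^+ 2)^-1 r)%:E))%E).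
  apply: ge0_le_integral => //=.
  - by apply: measurable_funTS; exact: ccdf_measurable.
  - apply: measurable_funTS; apply: measurable_funeM; apply/measurable_EFinP.
    exact: measurable_exponential_pdf.
  - move=> r; rewrite in_itv/= andbT => r0.
    rewrite exponential_pdfE// -EFinM.
    rewrite [X in (_ <= X%:E)%E](_ : _ = Num.sqrt 2 * expR (- (Num.sqrt r ^+ 2 / (4 * s ^+ 2)))); last first.
      rewrite sqr_sqrtr// mulNr [_^-1 * r]mulrC; set E := expR _.
      by field; rewrite lt0r_neq0.
    rewrite /ccdf /distribution /pushforward.
    have hZ w : (Z w \in `]r, +oo[) = (Num.sqrt r < `|Y w - m|).
      rewrite in_itv ZE /= andbT -expr2 -(real_normK (num_real _)).
      by rewrite -{1}(sqr_sqrtr r0) ltr_pXn2r// ?nnegrE ?sqrtr_ge0.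
    rewrite (_ : Z @^-1` _ = Y @^-1` [set y | Num.sqrt r < `|y - m|]); last first.
      apply/seteqP; split => w h1.
        by have : Z w \in `]r, +oo[ := h1; rewrite hZ.
      by suff : Z w \in `]r, +oo[ by []; rewrite hZ.
    have mA : measurable [set y : R | Num.sqrt r < `|y - m|].
      apply: measurable_gt_set; apply: measurableT_comp => //.
      exact: measurable_funB.
    rewrite h// gt_eqF//; apply: normal_prob_tail => //.
    by move=> y /= /ltW.
rewrite ge0_integralZl_EFin//=; last 3 first.
- by move=> r _; rewrite lee_fin exponential_pdf_ge0// ltW.
- by apply/measurable_EFinP/measurable_funTS; exact: measurable_exponential_pdf.
- by rewrite mulr_ge0 ?sqrtr_ge0// ltW.
rewrite -[leRHS]mule1 lee_wpmul2l//; first by rewrite lee_fin mulr_ge0 ?sqrtr_ge0// ltW.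
rewrite -(integral_exponential_pdf rate0); apply: ge0_subset_integral => //=.
- by apply/measurable_EFinP; exact: measurable_exponential_pdf.
- by move=> r _; rewrite lee_fin exponential_pdf_ge0// ltW.
Qed.

(** A density bound and a Gaussian tail with constants that depend only on the
    variance. The location is controlled by Chebyshev, not computed. *)
Lemma gaussian_itv (a b : R) : a <= b ->
  (P (Y @^-1` `[a, b]) <= (2 * (b - a) / Num.sqrt v)%:E)%E.
Proof.
move=> ab; have [m [s [s0 h]]] := gY.
have s_gt0 := gaussian_nondegenerate s0 h.
have vs := gaussian_scale_lower s_gt0 h.
rewrite h// gt_eqF//; apply: (le_trans (normal_prob_itv m s_gt0 ab)).
rewrite lee_fin (_ : 2 * (b - a) / _ = (b - a) * (2 / Num.sqrt v)); last by ring.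
rewrite ler_wpM2l ?subr_ge0//.
have sv : 0 < Num.sqrt v by rewrite sqrtr_gt0.
rewrite ler_pdivlMr// mulrC ler_pdivrMr ?mulr_gt0//.
have -> : 2 * (2 * s) = Num.sqrt ((4 * s) ^+ 2).
  by rewrite sqrtr_sqr ger0_norm; [ring|rewrite mulr_ge0// ltW].
rewrite ler_wsqrtr//; have := sqr_ge0 s; lra.
Qed.

Lemma gaussian_tail (a : R) : 0 <= a ->
  (P [set w | (a <= `|Y w|)%R] <= (30 ^+ 2 * expR (- (a ^+ 2 / (30 ^+ 2 * v))))%:E)%E.
Proof.
move=> a0; have [m [s [s0 h]]] := gY.
have s_gt0 := gaussian_nondegenerate s0 h.
set r := Num.sqrt v; have r0 : 0 < r by rewrite sqrtr_gt0.
have rv : r ^+ 2 = v by rewrite sqr_sqrtr// ltW.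
have r20 : 0 < 2 * r by rewrite mulr_gt0.
have mabs (b : R) : measurable [set w | b <= `|Y w|].
  by apply: measurable_ge_set; exact: measurableT_comp.
have c1 : (P [set w | (2 * r <= `|Y w|)%R] <= (4^-1)%:E)%E.
  apply: (le_trans (chebyshev_RV EYY r20)).
  by rewrite lee_fin exprMn rv le_eqVlt; apply/orP; left; apply/eqP; field; rewrite lt0r_neq0.
have mI : measurable (Y @^-1` `[- (2 * r), 2 * r]) by exact: RV_preimage_measurable.
have big : ((3 / 4)%:E <= P (Y @^-1` `[(- (2 * r))%R, (2 * r)%R]))%E.
  have : (1 <= P (Y @^-1` `[(- (2 * r))%R, (2 * r)%R]) + (4^-1)%:E)%E.
    apply: le_trans (leeD2l _ c1); rewrite -(@probability_setT _ _ _ P).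
    apply: le_trans (measureU2 _ _ _) => //; apply: le_measure; rewrite ?inE//.
      exact: measurableU.
    move=> w _ /=; rewrite in_itv/= -ler_norml.
    by have [|/ltW] := leP `|Y w| (2 * r); [left|right].
  rewrite -(@fineK _ (P (Y @^-1` _))) ?fin_num_measure// -EFinD !lee_fin; lra.
have sr : s <= 3 * r.
  move: (big); rewrite h// gt_eqF// => big'.
  have r2 : - (2 * r) <= 2 * r by lra.
  have := le_trans big' (normal_prob_itv m s_gt0 r2).
  by rewrite lee_fin ler_pdivlMr ?mulr_gt0//; lra.
have Atail (b : R) : 0 <= b ->
    (P (Y @^-1` [set y | (b <= `|y - m|)%R]) <= (Num.sqrt 2 * expR (- (b ^+ 2 / (4 * s ^+ 2))))%:E)%E.
  move=> b0.
  have mA : measurable [set y : R | b <= `|y - m|].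
    apply: measurable_ge_set; apply: measurableT_comp => //.
      exact: measurable_funB.
  by rewrite h// gt_eqF//; exact: normal_prob_tail.
have sq2 : Num.sqrt 2 <= 3 / 2 :> R.
  rewrite -[leRHS]ger0_norm; last by lra.
  by rewrite -sqrtr_sqr ler_wsqrtr//; lra.
have mr : `|m| <= 14 * r.
  rewrite leNgt; apply/negP => mbig.
  have : (P (Y @^-1` `[(- (2 * r))%R, (2 * r)%R]) <= (2^-1)%:E)%E.
    apply: (@le_trans _ _ (P (Y @^-1` [set y | (4 * s <= `|y - m|)%R]))).
      have mA : measurable [set y : R | 4 * s <= `|y - m|].
        apply: measurable_ge_set; apply: measurableT_comp => //.
      exact: measurable_funB.
      apply: le_measure; rewrite ?inE; [exact: RV_preimage_measurable|exact: RV_preimage_measurable|].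
      move=> w /=; rewrite in_itv/= -ler_norml => Yw.
      by have := ler_normB (Y w) (Y w - m); rewrite opprB addrCA subrr addr0; lra.
    apply: (le_trans (Atail (4 * s) _)); first by rewrite mulr_ge0.
    rewrite lee_fin.
    have -> : (4 * s) ^+ 2 / (4 * s ^+ 2) = 4 by field; rewrite lt0r_neq0.
    have e4 : expR (- 4) <= 5^-1 :> R.
      by rewrite expRN lef_pV2 ?posrE ?expR_gt0//; apply: le_trans (expR_ge1Dx _); lra.
    have := expR_ge0 (- 4 : R); have : 0 <= Num.sqrt 2 :> R by rewrite sqrtr_ge0.
    by nra.
  move=> /(le_trans big); rewrite lee_fin; lra.
have [ar|ar] := leP a (28 * r).
  apply: (@le_trans _ _ 1%E); first exact: probability_le1.
  rewrite lee_fin; set K : R := 30 ^+ 2.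
  have K0 : 0 < K by rewrite /K exprn_gt0.
  apply: (@le_trans _ _ (K * (1 + - (a ^+ 2 / (K * v))))); last first.
    by rewrite ler_wpM2l ?(ltW K0)// expR_ge1Dx.
  rewrite (_ : K * _ = K - a ^+ 2 / v); last by field; rewrite !lt0r_neq0.
  have av : a ^+ 2 / v <= 28 ^+ 2.
    rewrite ler_pdivrMr// -rv -exprMn lerXn2r// nnegrE.
    by rewrite mulr_ge0// ltW.
  by rewrite /K; lra.
have a2 : 0 <= a / 2 by lra.
apply: (@le_trans _ _ (P (Y @^-1` [set y | (a / 2 <= `|y - m|)%R]))).
  apply: le_measure; rewrite ?inE//.
    apply: RV_preimage_measurable; apply: measurable_ge_set; apply: measurableT_comp => //.
      exact: measurable_funB.
  move=> w /= aY; have := ler_normD (Y w - m) m; rewrite subrK; lra.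
apply: (le_trans (Atail _ a2)); rewrite lee_fin ler_pM ?sqrtr_ge0 ?expR_ge0//.
  by lra.
have s2 : s ^+ 2 <= 9 * r ^+ 2.
  by rewrite (_ : 9 * r ^+ 2 = (3 * r) ^+ 2); [rewrite lerXn2r ?nnegrE// ltW// mulr_gt0|ring].
have r2 : 0 < r ^+ 2 by rewrite exprn_gt0.
have ss : 0 < s ^+ 2 by rewrite exprn_gt0.
rewrite ler_expR lerN2 -rv (_ : (a / 2) ^+ 2 / (4 * s ^+ 2) = a ^+ 2 / (16 * s ^+ 2)); last first.
  by field; rewrite lt0r_neq0.
rewrite ler_wpM2l ?sqr_ge0// lef_pV2 ?posrE ?mulr_gt0 ?exprn_gt0//.
by lra.
Qed.

End gaussian_bounds.


(** * Fractional Brownian motion: marginals, increments and moduli of continuity *)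

Section fbm_moments.
Context d (Omega : measurableType d) (R : realType) (P : probability Omega R).
Variables (H : R) (X : R -> {RV P >-> R}).
Hypotheses (H_gt0 : 0 < H) (fbm : is_continuous_fbm H X).

Lemma powR_sqr (x : R) : 0 <= x -> x `^ (2 * H) = (x `^ H) ^+ 2.
Proof. by move=> x0; rewrite mulrC powRrM -powR_mulrn ?powR_ge0. Qed.

Lemma fbm_sqr (t : R) : 0 <= t ->
  expectation P (fun w => X t w * X t w) = (t `^ (2 * H))%:E.
Proof.
move=> t0; rewrite (fbm_cov fbm t0 t0) subrr normr0 powR0; last by rewrite mulf_neq0// lt0r_neq0.
by rewrite ger0_norm//; congr (_%:E); field.
Qed.

Lemma fbm_increment_sqr (s t : R) : 0 <= s -> 0 <= t ->
  expectation P (fun w => (X t w - X s w) * (X t w - X s w)) = (`|t - s| `^ (2 * H))%:E.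
Proof.
move=> s0 t0.
rewrite (expectation_sqrB (fbm_sqr t0) (fbm_cov fbm t0 s0) (fbm_sqr s0)).
by rewrite !(ger0_norm t0) !(ger0_norm s0); congr (_%:E); field.
Qed.

Lemma fbm_increment_mean (s t : R) : 0 <= s -> 0 <= t ->
  expectation P (X t \- X s) = 0%E.
Proof.
move=> s0 t0; rewrite expectationB.
- by rewrite !(fbm_mean fbm)// sube0.
- by apply: RV_Lfun1; eexists; exact: fbm_sqr.
- by apply: RV_Lfun1; eexists; exact: fbm_sqr.
Qed.

Lemma fbm_increment_gaussian (s t : R) : 0 <= s -> 0 <= t ->
  is_gaussian P (X t \- X s).
Proof.
move=> s0 t0.
have := @fbm_gaussian _ _ _ _ _ _ fbm 2 (fun i => if i == ord0 then t else s)
  (fun i => if i == ord0 then 1 else -1).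
have -> : (fun w => \sum_(i < 2) (if i == ord0 then 1 else -1) *
     X (if i == ord0 then t else s) w) = (X t \- X s).
  by apply/funext => w; rewrite !big_ord_recl big_ord0/= mul1r addr0 mulN1r.
by apply=> i; case: ifP.
Qed.

Lemma fbm_increment_tail (s t a : R) : 0 <= s -> 0 <= t -> s != t -> 0 <= a ->
  (P [set w | (a <= `|X t w - X s w|)%R] <=
    (30 ^+ 2 * expR (- (a ^+ 2 / (30 ^+ 2 * `|t - s| `^ (2 * H)))))%:E)%E.
Proof.
move=> s0 t0 st a0.
have v0 : 0 < `|t - s| `^ (2 * H) by rewrite powR_gt0// normr_gt0 subr_eq0 eq_sym.
exact: (@gaussian_tail _ _ _ P (X t \- X s) _ (fbm_increment_gaussian s0 t0) v0
  (fbm_increment_mean s0 t0) (fbm_increment_sqr s0 t0) a a0).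
Qed.

Lemma fbm_increment_chebyshev (s t a : R) : 0 <= s -> 0 <= t -> 0 < a ->
  (P [set w | (a <= `|X t w - X s w|)%R] <= (`|t - s| `^ (2 * H) / a ^+ 2)%:E)%E.
Proof.
move=> s0 t0 a0.
exact: (@chebyshev_RV _ _ _ P (X t \- X s) _ a (fbm_increment_sqr s0 t0) a0).
Qed.

Lemma fbm_chebyshev (t a : R) : 0 <= t -> 0 < a ->
  (P [set w | (a <= `|X t w|)%R] <= (t `^ (2 * H) / a ^+ 2)%:E)%E.
Proof. by move=> t0 a0; exact: (chebyshev_RV (fbm_sqr t0) a0). Qed.

Lemma fbm_itv (t a b : R) : 0 < t -> a <= b ->
  (P [set w | (a <= X t w <= b)%R] <= (2 * (b - a) / t `^ H)%:E)%E.
Proof.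
move=> t0 ab; have v0 : 0 < t `^ (2 * H) by rewrite powR_gt0.
have := @gaussian_itv _ _ _ P (X t) _ _ v0 (fbm_mean fbm (ltW t0)) (fbm_sqr (ltW t0)) a b ab.
rewrite powR_sqr ?(ltW t0)// sqrtr_sqr ger0_norm ?powR_ge0//.
rewrite (_ : X t @^-1` _ = [set w | (a <= X t w <= b)%R]); last first.
  by apply/seteqP; split => w; rewrite /= in_itv.
apply.
have := @fbm_gaussian _ _ _ _ _ _ fbm 1 (fun=> t) (fun=> 1).
have -> : (fun w => \sum_(i < 1) 1 * X t w) = X t.
  by apply/funext => w; rewrite big_ord1 mul1r.
by apply=> i; exact: ltW.
Qed.

End fbm_moments.

Section dyadic_regularity.
Context d (Omega : measurableType d) (R : realType) (P : probability Omega R).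
Variables (H T : R) (B : nat -> R -> {RV P >-> R}).
Hypotheses (H_gt0 : 0 < H) (T_gt0 : 0 < T)
  (fbm : forall j, is_continuous_fbm H (B j)).

Definition dyad (l i : nat) : R := i%:R / 2 ^+ l.
(** [bt ^+ 4] is the Hoelder factor [2 ^ - H] of one dyadic level. *)
Definition bt : R := expR (- (H / 4 * ln 2)).
Definition horizon : nat := (Num.truncn T).+1.

Lemma bt_gt0 : 0 < bt. Proof. exact: expR_gt0. Qed.

Lemma bt_lt1 : bt < 1.
Proof. by rewrite /bt expR_lt1 oppr_lt0 mulr_gt0 ?divr_gt0// ln_gt0// ltr1n. Qed.

Lemma pow2_powR (l : nat) : ((2 ^+ l)^-1 : R) `^ (2 * H) = bt ^+ (8 * l).
Proof.
rewrite /bt -expRM_natl /powR invr_eq0 expf_eq0 pnatr_eq0 andbF.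
congr expR; rewrite lnV ?posrE ?exprn_gt0// lnXn// -mulr_natl natrM.
by field.
Qed.

Lemma dyad_ge0 l i : 0 <= dyad l i.
Proof. by rewrite divr_ge0 ?exprn_ge0. Qed.

Lemma dyad_step l i : dyad l i.+1 - dyad l i = (2 ^+ l)^-1.
Proof. by rewrite /dyad -mulrBl -natr1 addrAC subrr add0r mul1r. Qed.

(** Kolmogorov's criterion: the increments over dyadic intervals of length
    [2 ^ -l] are eventually smaller than [bt ^ (2 l)], simultaneously for the
    first [2 ^ l] processes. *)
Lemma ae_dyadic_increments :
  {ae P, forall w, exists l0 : nat, forall l j i, (l0 <= l)%N -> (j < 2 ^ l)%N ->
    (i < horizon * 2 ^ l)%N ->
    `|B j (dyad l i.+1) w - B j (dyad l i) w| < bt ^+ (2 * l)}.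
Proof.
pose E l := [set w | exists2 ji, ji \in allpairs pair (iota 0 (2 ^ l)) (iota 0 (horizon * 2 ^ l)) &
  bt ^+ (2 * l) <= `|B ji.1 (dyad l ji.2.+1) w - B ji.1 (dyad l ji.2) w|].
pose c : R := 30 ^+ 2.
have c0 : 0 < c by rewrite exprn_gt0.
(* [exp (- y) <= k! / y ^ k], with [k] so large that [2 ^ (H k) >= 8] *)
pose k := (Num.truncn (3 / H)).+1.
have kH : 3 <= k%:R * H.
  by rewrite -ler_pdivrMr// ltW// truncnS_gt.
have btk : bt ^+ (4 * k) <= 8^-1.
  rewrite /bt -expRM_natl -[leRHS]lnK ?posrE// ler_expR lnV ?posrE//.
  rewrite (_ : 8 = 2 ^+ 3 :> R); last by rewrite -natrX.
  rewrite lnXn// mulrN lerN2 natrM -[ln 2 *+ 3]mulr_natl.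
  have -> : 4 * k%:R * (H / 4 * ln 2) = k%:R * H * ln 2 :> R by field.
  by rewrite ler_wpM2r// ln_ge0// ler1n.
pose C : R := horizon%:R * c * (k`!%:R * c ^+ k).
have C0 : 0 <= C by rewrite !mulr_ge0 ?exprn_ge0 ?(ltW c0).
have mE1 l ji : measurable [set w | bt ^+ (2 * l) <=
    `|B ji.1 (dyad l ji.2.+1) w - B ji.1 (dyad l ji.2) w|].
  by apply: measurable_ge_set; apply: measurableT_comp => //; exact: measurable_funB.
have mE l : measurable (E l).
  exact: (measure_union_seq P (fun ji _ => mE1 l ji)).1.
have E1P l ji : (P [set w | (bt ^+ (2 * l) <=
    `|B ji.1 (dyad l ji.2.+1) w - B ji.1 (dyad l ji.2) w|)%R] <=
    (c * (k`!%:R * c ^+ k * 8^-1 ^+ l))%:E)%E.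
  have ne : dyad l ji.2 != dyad l ji.2.+1.
    by rewrite eq_sym -subr_eq0 dyad_step invr_eq0 expf_eq0 pnatr_eq0 andbF.
  apply: (le_trans (fbm_increment_tail H_gt0 (fbm ji.1) (dyad_ge0 _ _) (dyad_ge0 _ _) ne _)).
    by rewrite exprn_ge0// ltW// bt_gt0.
  rewrite dyad_step ger0_norm ?invr_ge0 ?exprn_ge0// pow2_powR lee_fin ler_wpM2l ?(ltW c0)//.
  set y := _ / _.
  have yE : y = (bt ^+ (4 * l))^-1 / c.
    rewrite /y -/c -exprM (_ : 8 * l = 4 * l + 2 * l * 2)%N; last by lia.
    by rewrite exprD; field; rewrite !expf_neq0 ?lt0r_neq0 ?bt_gt0.
  have y0 : 0 < y by rewrite yE divr_gt0 ?invr_gt0 ?exprn_gt0 ?bt_gt0.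
  have yk : expR (- y) <= k`!%:R / y ^+ k.
    rewrite expRN -[leRHS]invrK lef_pV2 ?posrE ?expR_gt0 ?invr_gt0 ?divr_gt0 ?exprn_gt0 ?ltr0n ?fact_gt0//.
    rewrite invf_div; apply: le_trans (expR_ge1Dxn (Num.truncn (3 / H)) (ltW y0)).
    by rewrite -/k lerDr.
  apply: (le_trans yk).
  have -> : k`!%:R / y ^+ k = k`!%:R * c ^+ k * (bt ^+ (4 * l)) ^+ k.
    rewrite yE; set z := bt ^+ (4 * l).
    by rewrite expr_div_n exprVn invf_div invrK mulrA.
  rewrite ler_wpM2l ?mulr_ge0 ?exprn_ge0 ?(ltW c0)//.
  rewrite -exprM mulnAC exprM lerXn2r ?nnegrE ?exprn_ge0 ?invr_ge0//.
  by rewrite ltW// bt_gt0.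
have EP l : (P (E l) <= (C * 2^-1 ^+ l)%:E)%E.
  apply: (le_trans (measure_union_seq P (fun ji _ => mE1 l ji)).2).
  apply: (@le_trans _ _ (\sum_(ji <- allpairs pair (iota 0 (2 ^ l)) (iota 0 (horizon * 2 ^ l)))
    (c * (k`!%:R * c ^+ k * 8^-1 ^+ l))%:E)%E); first exact: lee_sum.
  rewrite sumEFin lee_fin big_const_seq count_predT iter_addr_0 size_allpairs !size_iota.
  rewrite -[leLHS]mulr_natl [X in X%:R * _]mulnC natrM natrM natrX /C.
  rewrite le_eqVlt; apply/orP; left; apply/eqP.
  rewrite (_ : 8^-1 = 2^-1 ^+ 3 :> R); last by rewrite exprVn -natrX.
  rewrite -exprM (_ : 3 * l = l + l + l)%N; last by lia.
  rewrite !exprD !exprVn; field; rewrite expf_neq0//.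
have uM n : \sum_(l < n) C * 2^-1 ^+ l <= C * 2.
  rewrite -mulr_sumr ler_wpM2l//.
  suff -> : \sum_(l < n) 2^-1 ^+ l = 2 - 2 * 2^-1 ^+ n :> R.
    by rewrite gerBl mulr_ge0 ?exprn_ge0.
  elim: n => [|n IHn]; first by rewrite big_ord0 expr0; ring.
  by rewrite big_ord_recr/= IHn exprS; field.
have := ae_eventually_not (k0 := 0) mE (fun l => mulr_ge0 C0 (exprn_ge0 l _)) (fun l _ => EP l) uM.
have half0 : 0 <= 2^-1 :> R by [].
move=> /(_ half0); apply: filterS => w [l0 Hl0]; exists l0 => l j i ll0 jl il.
rewrite ltNge; apply/negP => hle; apply: (Hl0 l ll0); exists (j, i) => //=.
by apply: allpairs_f; rewrite mem_iota.
Qed.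

Definition tfloor (l : nat) (t : R) : R := dyad l (Num.truncn (t * 2 ^+ l)).

Lemma tfloor_itv l t : 0 <= t -> tfloor l t <= t < tfloor l t + (2 ^+ l)^-1.
Proof.
move=> t0; have p0 : 0 < 2 ^+ l :> R by rewrite exprn_gt0.
have /andP[h1 h2] := truncn_itv (mulr_ge0 t0 (ltW p0)).
rewrite /tfloor /dyad ler_pdivrMr// h1/=.
rewrite (_ : _ / _ + _ = (Num.truncn (t * 2 ^+ l)).+1%:R / 2 ^+ l).
  by rewrite ltr_pdivlMr.
by rewrite -[(Num.truncn _).+1%:R]natr1 mulrDl mul1r.
Qed.

Lemma tfloor_ge0 l t : 0 <= tfloor l t.
Proof. exact: dyad_ge0. Qed.

(** The telescoping constant of the chaining along dyadic levels. *)
Definition btC : R := (1 - bt ^+ 2)^-1.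

Lemma bt2_lt1 : bt ^+ 2 < 1.
Proof. by rewrite exprn_ilt1// ?ltW ?bt_gt0 ?bt_lt1. Qed.

Lemma btC_gt0 : 0 < btC.
Proof. by rewrite invr_gt0 subr_gt0 bt2_lt1. Qed.

(** The dyadic increments are summed over all finer levels; continuity of the
    path replaces the limit of the dyadic approximations by [t]. *)
Lemma tfloor_oscillation (w : Omega) (l0 L j : nat) (t : R) :
  (forall l j i, (l0 <= l)%N -> (j < 2 ^ l)%N -> (i < horizon * 2 ^ l)%N ->
    `|B j (dyad l i.+1) w - B j (dyad l i) w| < bt ^+ (2 * l)) ->
  (l0 <= L)%N -> (j < 2 ^ L)%N -> 0 <= t <= T ->
  `|B j t w - B j (tfloor L t) w| <= btC * bt ^+ (2 * L).
Proof.
move=> hinc lL jL /andP[t0 tT].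
have step l : (L <= l)%N ->
    `|B j (tfloor l.+1 t) w - B j (tfloor l t) w| <= bt ^+ (2 * l.+1).
  move=> Ll; rewrite /tfloor; set q := Num.truncn (t * 2 ^+ l).
  have p0 : 0 < 2 ^+ l :> R by rewrite exprn_gt0.
  have /andP[q1 q2] := truncn_itv (mulr_ge0 t0 (ltW p0)); rewrite -/q in q1 q2.
  have qM : (q < horizon * 2 ^ l)%N.
    rewrite -(ltr_nat R) natrM natrX (le_lt_trans q1)// ltr_pM2r//.
    by rewrite (le_lt_trans tT)// truncnS_gt.
  have dE : dyad l q = dyad l.+1 (2 * q).
    rewrite /dyad exprS natrM; field.
    by rewrite lt0r_neq0.
  have : Num.truncn (t * 2 ^+ l.+1) = (2 * q)%N \/ Num.truncn (t * 2 ^+ l.+1) = (2 * q).+1.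
    have [h|h] := ltP (t * 2 ^+ l.+1) (2 * q).+1%:R; [left|right]; apply: truncn_def.
      rewrite h andbT natrM exprS mulrCA ler_pM2l//.
    rewrite h/= exprS mulrCA (_ : (2 * q).+2 = 2 * q.+1)%N; last by rewrite mulnS.
    by rewrite natrM ltr_pM2l.
  rewrite dE => -[->|->].
    by rewrite subrr normr0 exprn_ge0// ltW// bt_gt0.
  apply/ltW/hinc; first exact: leq_trans (leqW Ll).
    by rewrite (leq_trans jL)// leq_pexp2l// leqW.
  by rewrite expnS mulnCA ltn_pmul2l.
have tel n : `|B j (tfloor (L + n) t) w - B j (tfloor L t) w| <=
    btC * bt ^+ (2 * L) * (1 - bt ^+ (2 * n)).
  elim: n => [|n IHn]; first by rewrite addn0 muln0 expr0 !subrr normr0 mulr0.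
  rewrite addnS (_ : _ - _ = (B j (tfloor (L + n).+1 t) w - B j (tfloor (L + n) t) w)
     + (B j (tfloor (L + n) t) w - B j (tfloor L t) w)); last by ring.
  apply: (le_trans (ler_normD _ _)); apply: (le_trans (lerD (step _ (leq_addr _ _)) IHn)).
  have b1 : 1 - bt ^+ 2 != 0 by rewrite lt0r_neq0// subr_gt0 bt2_lt1.
  apply: (@le_trans _ _ (bt ^+ (2 * L + 2 * n) + btC * bt ^+ (2 * L) * (1 - bt ^+ (2 * n)))).
    rewrite lerD2r ler_wiXn2l ?(ltW bt_gt0) ?(ltW bt_lt1)//; lia.
  rewrite le_eqVlt; apply/orP; left; apply/eqP.
  rewrite /btC (_ : 2 * n.+1 = 2 * n + 2)%N; last by lia.
  by rewrite !exprD; field.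
have cv : (fun n => tfloor (L + n) t) @ \oo --> t.
  apply/cvgrPdist_le => e e0.
  near=> n.
  have := tfloor_itv (L + n) t0 => /andP[h1 h2].
  rewrite ger0_norm ?subr_ge0//.
  have : (2 ^+ (L + n))^-1 <= e.
    have n1 : (Num.truncn e^-1 <= n)%N by near: n; exact: nbhs_infty_ge.
    rewrite -[leRHS]invrK lef_pV2 ?posrE ?exprn_gt0 ?invr_gt0//.
    apply: (@le_trans _ _ n.+1%:R).
      by rewrite ltW// (lt_le_trans (truncnS_gt _))// ler_nat ltnS.
    rewrite -natrX ler_nat; apply: (leq_trans (ltn_expl n (ltnSn 1))).
    by rewrite leq_pexp2l// leq_addl.
  lra.
have cont : (fun n => B j (tfloor (L + n) t) w) @ \oo --> B j t w.
  have /subspace_continuousP/(_ t) h := @fbm_continuous _ _ _ _ _ _ (fbm j) w.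
  apply: (cvg_comp (fun n => tfloor (L + n) t) (fun s => B j s w) _ (h _)).
    move=> S hS.
    have : \forall n \near \oo, `[0, +oo[%classic (tfloor (L + n) t) -> S (tfloor (L + n) t).
      exact: cv _ hS.
    apply: filterS => n; apply.
    by rewrite /= in_itv/= andbT; exact: tfloor_ge0.
  by rewrite /= in_itv/= t0.
have cont2 : (fun n => `|B j (tfloor (L + n) t) w - B j (tfloor L t) w|) @ \oo -->
    `|B j t w - B j (tfloor L t) w|.
  by apply: cvg_norm; apply: cvgB => //; exact: cvg_cst.
rewrite -(cvg_lim _ cont2)//; apply: limr_le; first by apply/cvg_ex; eexists; exact: cont2.
apply: nearW => n; apply: (le_trans (tel n)).
rewrite ler_piMr ?mulr_ge0 ?exprn_ge0 ?(ltW btC_gt0) ?(ltW bt_gt0)//.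
by rewrite gerBl exprn_ge0// ltW// bt_gt0.
Unshelve. all: by end_near. Qed.

End dyadic_regularity.


(** * Chaining *)

Section asymptotics.
Context {R : realType}.

Lemma poly_geometric_small (g C : R) (m : nat) : 0 < g < 1 -> 0 <= C ->
  \forall l \near \oo, C * l.+1%:R ^+ m * g ^+ l <= 1.
Proof.
move=> /andP[g0 g1] C0.
pose a := - ln g; have a0 : 0 < a by rewrite oppr_gt0 ln_lt0// g0.
have gE l : g ^+ l = expR a * expR (- (a * l.+1%:R)).
  rewrite -expRD -[g in LHS]lnK ?posrE// -expRM_natl /a -natr1; congr expR; ring.
pose M := C * expR a * (m.+1)`!%:R / a ^+ m.+1.
have M0 : 0 <= M by rewrite divr_ge0 ?exprn_ge0 ?(ltW a0)// !mulr_ge0// expR_ge0.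
exists (Num.truncn M) => // l /= Ml.
have Ml' : M <= l.+1%:R.
  by rewrite ltW// (lt_le_trans (truncnS_gt _))// ler_nat.
have l0 : 0 < l.+1%:R :> R by rewrite ltr0n.
have y0 : 0 < a * l.+1%:R by rewrite mulr_gt0.
have h : (a * l.+1%:R) ^+ m.+1 / (m.+1)`!%:R <= expR (a * l.+1%:R).
  by apply: le_trans (expR_ge1Dxn m (ltW y0)); rewrite lerDr.
rewrite gE mulrA [expR (- (a * _))]expRN ler_pdivrMr ?expR_gt0// mul1r; apply: le_trans h.
rewrite ler_pdivlMr ?ltr0n ?fact_gt0// exprMn.
rewrite (_ : _ * _ * _ * _ = M * a ^+ m.+1 * l.+1%:R ^+ m); last first.
  by rewrite /M divfK ?expf_neq0 ?lt0r_neq0//; ring.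
rewrite [M * _]mulrC -mulrA ler_wpM2l ?exprn_ge0 ?(ltW a0)//.
by rewrite exprS ler_wpM2r// exprn_ge0// ltW.
Qed.

Lemma sum_inv_sqr_le2 (L n : nat) :
  \sum_(L <= l < n) ((l.+1%:R ^+ 2)^-1 : R) <= 2.
Proof.
apply: (@le_trans _ _ (\sum_(0 <= l < n) ((l.+1%:R ^+ 2)^-1 : R))).
  have [Ln|nL] := leqP L n; last by rewrite (big_geq (ltnW nL)) sumr_ge0.
  by rewrite (@big_cat_nat _ _ _ L 0 n)//= lerDr sumr_ge0.
case: n => [|n]; first by rewrite big_geq.
apply: (@le_trans _ _ (2 - n.+1%:R^-1)); last by rewrite gerBl.
elim: n => [|n IHn]; first by rewrite big_nat1 expr1n invr1; lra.
rewrite big_nat_recr//=; apply: (le_trans (lerD IHn (lexx _))).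
set x : R := n.+1%:R; have x0 : 0 < x by rewrite ltr0n.
have -> : n.+2%:R = x + 1 :> R by rewrite /x natr1.
have x1 : 0 < x + 1 by lra.
have h : ((x + 1) ^+ 2)^-1 <= (x * (x + 1))^-1.
  rewrite lef_pV2 ?posrE ?exprn_gt0 ?mulr_gt0//.
  by rewrite expr2 ler_wpM2r ?(ltW x1)//; lra.
have e : (x * (x + 1))^-1 = x^-1 - (x + 1)^-1 by field; rewrite !lt0r_neq0.
by move: h; rewrite e; move: (x^-1) ((x + 1)^-1) (_ ^- 2) => a b c; lra.
Qed.

End asymptotics.

Section chaining.
Context d (Omega : measurableType d) (R : realType) (P : probability Omega R).
Context {S : Type}.
Variables (phi : nat -> S -> Omega -> R) (K : S -> S -> R) (W : R).

(** The finite-dimensional projections of the summands are functions of an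
    i.i.d. sequence of letters; [K] is their covariance. *)
Definition finite_dimensional := forall n (pt : 'I_n -> S),
  exists (A : finType) (xi : nat -> Omega -> A) (p : A -> R) (f : 'I_n -> A -> R),
  [/\ finite_iid P xi p,
      forall j i w, phi j (pt i) w = f i (xi j w),
      forall i a, `|f i a| <= W,
      forall i, \sum_a p a * f i a = 0 &
      forall i k, \sum_a p a * (f i a * f k a) = K (pt i) (pt k)].

Hypothesis fd : finite_dimensional.
Hypothesis W_gt0 : 0 < W.

Definition psum n q w := \sum_(j < n) phi j q w.
(** The expected square of the difference of the summands at [q] and [r]. *)
Definition rho2 q r := K q q - 2 * K q r + K r r.

Lemma cov_sym q r : K q r = K r q.
Proof.
have [A [xi [p [f [_ _ _ _ cov]]]]] := fd (fun i : 'I_2 => if i == ord0 then q else r).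
have := cov ord0 ord_max; rewrite /= => <-.
have := cov ord_max ord0; rewrite /= => <-.
by apply: eq_bigr => a _; rewrite [f _ a * _]mulrC.
Qed.

Lemma cov_psd n (pt : 'I_n -> S) (c : 'I_n -> R) :
  0 <= \sum_i \sum_k c i * c k * K (pt i) (pt k).
Proof.
have [A [xi [p [f [iid _ _ _ cov]]]]] := fd pt.
have -> : \sum_i \sum_k c i * c k * K (pt i) (pt k) =
    \sum_a p a * (\sum_i c i * f i a) ^+ 2.
  under [RHS]eq_bigr => a _.
    rewrite expr2 big_distrlr/= mulr_sumr.
    under eq_bigr do rewrite mulr_sumr.
    over.
  rewrite [RHS]exchange_big/=; apply: eq_bigr => i _.
  rewrite [RHS]exchange_big/=; apply: eq_bigr => k _.
  by rewrite -cov mulr_sumr; apply: eq_bigr => a _; ring.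
by rewrite sumr_ge0// => a _; rewrite mulr_ge0 ?sqr_ge0// (fi_ge0 iid).
Qed.

(** Positivity of the covariance on the combination of weights [2], [-1] and
    [-1], by the parallelogram law. *)
Lemma rho2_triangle q r s : rho2 r s <= 2 * rho2 q r + 2 * rho2 q s.
Proof.
have := cov_psd (fun i : 'I_3 => if i == ord0 then q else if i == 1 then r else s)
  (fun i : 'I_3 => if i == ord0 then 2 else -1).
rewrite !big_ord_recl !big_ord0 /= /rho2.
rewrite !(cov_sym r q) !(cov_sym s q) !(cov_sym s r); lra.
Qed.

(** The maximal inequality for both signs. The event [E] does not depend on the
    exponential parameter [t], which is chosen when the links are added up. *)
Lemma link_bound (q r : S) (l : R) (N : nat) : exists E : set Omega,
  [/\ measurable E,
      forall w n, (n <= N)%N -> l <= `|psum n q w - psum n r w| -> E w &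
      forall v t, rho2 q r <= v -> 0 <= t -> t * (2 * W) <= 1 ->
        (P E <= (2 * expR (- (t * l) + N%:R * (t ^+ 2 * v * 3 / 2)))%:E)%E].
Proof.
have [A [xi [p [f [iid phiE fW f0 cov]]]]] :=
  fd (fun i : 'I_2 => if i == ord0 then q else r).
pose g a := f ord0 a - f ord_max a.
have gW a : `|g a| <= 2 * W.
  apply: (le_trans (ler_normB _ _)); have := fW ord0 a; have := fW ord_max a; lra.
have g0 : \sum_a p a * g a = 0.
  by under eq_bigr do rewrite /g mulrBr; rewrite sumrB !f0 subrr.
have g2 : \sum_a p a * g a ^+ 2 = rho2 q r.
  rewrite /rho2; have := cov ord0 ord_max; have := cov ord0 ord0; have := cov ord_max ord_max.
  move=> /= <- <- <-; rewrite mulr_sumr -sumrB -big_split/=.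
  by apply: eq_bigr => a _; rewrite /g; ring.
have ng0 : \sum_a p a * - g a = 0.
  by under eq_bigr do rewrite mulrN; rewrite sumrN g0 oppr0.
pose E1 := [set w | hit g l (word xi N w)].
pose E2 := [set w | hit (fun a => - g a) l (word xi N w)].
have mE1 : measurable E1 by exact: (measurable_wordQ iid).
have mE2 : measurable E2 by exact: (measurable_wordQ iid).
have psumE n w : psum n q w - psum n r w = \sum_(j < n) g (xi j w).
  rewrite -sumrB; apply: eq_bigr => j _; rewrite /g.
  by rewrite -(phiE j ord0 w) -(phiE j ord_max w).
exists (E1 `|` E2); split; first exact: measurableU.
  move=> w n nN; rewrite psumE ler_normr => /orP[h|h]; [left|right];
    apply: (@hit_take _ _ _ _ _ n); rewrite take_word// sum_word//.
  by rewrite sumrN.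
move=> v t qv t0 tW.
have PU : (P (E1 `|` E2) <= P E1 + P E2)%E by exact: measureU2.
apply: (le_trans PU).
have -> : P E1 = (wprob p N (hit g l))%:E by exact: (prob_word iid).
have -> : P E2 = (wprob p N (hit (fun a => - g a) l))%:E by exact: (prob_word iid).
rewrite -EFinD lee_fin mulr_natl mulr2n.
have tw0 : 0 <= t * (2 * W) by rewrite !mulr_ge0// ltW.
have v0 : 0 <= v.
  apply: le_trans qv; rewrite -g2 sumr_ge0// => a _.
  by rewrite mulr_ge0 ?sqr_ge0// (fi_ge0 iid).
have expo : - (t * l) + N%:R * (t ^+ 2 * v * (1 + 2 * (t * (2 * W))) / 2) <=
    - (t * l) + N%:R * (t ^+ 2 * v * 3 / 2).
  rewrite lerD2l ler_wpM2l// ler_pM2r ?invr_gt0// ler_wpM2l ?mulr_ge0 ?sqr_ge0//; lra.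
apply: lerD.
- apply: (le_trans (hit_bound (fi_ge0 iid) (fi_sum1 iid) l N t0 tW gW g0 _)); last by rewrite ler_expR; exact: expo.
  by rewrite g2.
- apply: (le_trans (hit_bound (fi_ge0 iid) (fi_sum1 iid) l N t0 tW _ ng0 _)); last by rewrite ler_expR; exact: expo.
    by move=> a; rewrite normrN.
  by under eq_bigr do rewrite sqrrN; rewrite g2.
Qed.

(** The points [net l] are exponentially many in [l], and geometrically close
    to all points. On the range [n <= 2 ^ k] the net of level [A0 * k] is so
    fine that the partial sums at a point and at the net differ by order [k]
    only, which is negligible. *)
Variables (pi : nat -> S -> S) (card : nat -> nat) (net : forall l, 'I_(card l) -> S).
Variables (c0 C1 C2 g : R) (A0 l1 : nat).
Hypotheses (c0_ge0 : 0 <= c0) (C1_ge0 : 0 <= C1) (C2_ge0 : 0 <= C2) (g01 : 0 < g < 1).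
Hypothesis A0_gt0 : (0 < A0)%N.
Hypothesis pi_net : forall l q, exists i, pi l q = @net l i.
Hypothesis card_net : forall l, (card l)%:R <= expR (c0 * l.+1%:R).
Hypothesis rho2_net : forall l q, (l1 <= l)%N -> rho2 q (pi l q) <= C1 * g ^+ l.
Hypothesis fine_net : {ae P, forall w, exists k0, forall k, (k0 <= k)%N ->
  forall n q, (n <= 2 ^ k)%N ->
  `|psum n q w - psum n (pi (A0 * k) q) w| <= C2 * k.+1%:R}.

(** Chaining: the increments between consecutive levels [l] and [l + 1] are at
    most [eta / (l + 1) ^ 2] on the scale of the iterated logarithm. The
    exponential moment is taken at [(l + 1) ^ 4] times the natural scale: the
    geometric decay of the variances absorbs this polynomial factor. *)
Lemma chain_increments (eta : R) : 0 < eta -> exists L0, forall L, (L0 <= L)%N ->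
  {ae P, forall w, exists k0, forall k, (k0 <= k)%N -> forall n q, (n <= 2 ^ k)%N ->
    `|psum n (pi (A0 * k) q) w - psum n (pi L q) w| <=
    2 * eta * Num.sqrt (2 ^+ k * ln k%:R)}.
Proof.
move=> eta0; have /andP[g0 g1] := g01.
have [La _ HLa] : \forall l \near \oo, (6 * C1) * l.+1%:R ^+ 8 * g ^+ l <= 1.
  by apply: poly_geometric_small => //; rewrite mulr_ge0.
pose Lb := (Num.truncn ((3 * c0 + 4) / eta)).+1.
have HLb l : (Lb <= l)%N -> 3 + (3 * c0 + 1) * l.+1%:R <= eta * l.+1%:R ^+ 2.
  move=> Ll; have h : (3 * c0 + 4) <= eta * l.+1%:R.
    rewrite [eta * _]mulrC -ler_pdivrMr// ltW// (lt_le_trans (truncnS_gt _))// ler_nat.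
    exact: leq_trans Ll _.
  have x1 : 1 <= l.+1%:R :> R by rewrite ler1n.
  by rewrite expr2 mulrA; set x := l.+1%:R in h x1 *; nra.
have g4 : 0 < (2^-1 : R) < 1 by apply/andP; split; lra.
have [ka _ Hka] : \forall k \near \oo,
    ((A0.+1%:R ^+ 8) * (2 * W) ^+ 2) * k.+1%:R ^+ 9 * 2^-1 ^+ k <= 1.
  by apply: poly_geometric_small => //; rewrite mulr_ge0 ?exprn_ge0// mulr_ge0// ltW.
exists (maxn (maxn La Lb) l1) => L; rewrite !geq_max => /andP[/andP[LaL LbL] l1L].
pose sc k : R := Num.sqrt (2 ^+ k * ln k%:R).
pose lam k l : R := eta / l.+1%:R ^+ 2 * sc k.
have [F HF] := choice (fun x : S * S * R * nat => link_bound x.1.1.1 x.1.1.2 x.1.2 x.2).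
pose G k l (ij : 'I_(card l.+1) * 'I_(card l)) : set Omega :=
   if rho2 (net ij.1) (net ij.2) <= 4 * C1 * g ^+ l
   then F (net ij.1, net ij.2, lam k l, 2 ^ k)%N else set0.
pose Ek k l := [set w | exists2 ij : 'I_(card l.+1) * 'I_(card l),
  ij \in enum {: 'I_(card l.+1) * 'I_(card l)} &
  (G k l ij) w].
pose E k := [set w | exists2 l, l \in iota L (A0 * k - L) & Ek k l w].
have mF k l (ij : 'I_(card l.+1) * 'I_(card l)) : measurable
  (G k l ij).
  by rewrite /G; case: ifP => // _; have [] := HF (net ij.1, net ij.2, lam k l, 2 ^ k)%N.
have mEk k l : measurable (Ek k l).
  exact: (measure_union_seq P (fun ij _ => mF k l ij)).1.
have mE k : measurable (E k) := (measure_union_seq P (fun l _ => mEk k l)).1.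
pose k0 := maxn ka 4.
have lnk k : (k0 <= k)%N -> 1 <= ln k%:R :> R.
  rewrite geq_max => /andP[_ k3]; rewrite -[leLHS]expRK ln_mono ?expR_gt0//.
  apply: (@le_trans _ _ 4); last by rewrite (ler_nat R 4).
  have x1 : `|2^-1 : R| <= 1 by rewrite ger0_norm//; lra.
  have := expR_le_taylor2 x1; rewrite ger0_norm// => h.
  have -> : expR 1 = expR 2^-1 ^+ 2 :> R by rewrite -expRM_natl mulfV.
  have := expR_ge0 (2^-1 : R); nra.
have step k l : (k0 <= k)%N -> (L <= l)%N -> (l < A0 * k)%N ->
    (P (Ek k l) <= (2 * expR (- 2 * ln k%:R) * 2^-1 ^+ l.+1)%:E)%E.
  move=> kk Ll lA; have lk := lnk k kk.
  have kka : (ka <= k)%N by rewrite (leq_trans _ kk)// leq_maxl.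
  apply: (le_trans (measure_union_seq P (fun ij _ => mF k l ij)).2).
  pose t : R := l.+1%:R ^+ 4 * Num.sqrt (ln k%:R / 2 ^+ k).
  have t0 : 0 <= t by rewrite mulr_ge0 ?sqrtr_ge0 ?exprn_ge0.
  have lnk0 : 0 <= ln k%:R / 2 ^+ k :> R by rewrite divr_ge0 ?exprn_ge0//; lra.
  have t2 : t ^+ 2 = l.+1%:R ^+ 8 * (ln k%:R / 2 ^+ k).
    by rewrite exprMn sqr_sqrtr// -exprM.
  have tW : t * (2 * W) <= 1.
    have W2 : 0 <= 2 * W by rewrite mulr_ge0// ltW.
    rewrite -(@expr_le1 _ 2)//; last exact: mulr_ge0.
    rewrite exprMn t2.
    apply: le_trans (Hka k kka); rewrite exprVn.
    rewrite [leLHS](_ : _ = l.+1%:R ^+ 8 * ln k%:R * ((2 * W) ^+ 2 / 2 ^+ k)); last by ring.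
    rewrite [leRHS](_ : _ = A0.+1%:R ^+ 8 * k.+1%:R ^+ 9 * ((2 * W) ^+ 2 / 2 ^+ k)); last by ring.
    rewrite ler_wpM2r ?divr_ge0 ?exprn_ge0//.
    rewrite [k.+1%:R ^+ 9]exprSr mulrA -exprMn ler_pM ?exprn_ge0//; first by lra.
      rewrite lerXn2r ?nnegrE ?mulr_ge0// -natrM ler_nat.
      by rewrite mulSn mulnS; move: lA; clear; lia.
    apply: (le_trans (ln_le_self _)) => //; by rewrite ler_nat.
  have tl : t * lam k l = eta * l.+1%:R ^+ 2 * ln k%:R.
    rewrite /t /lam /sc.
    have x0 : l.+1%:R != 0 :> R by rewrite pnatr_eq0.
    have -> : l.+1%:R ^+ 4 * Num.sqrt (ln k%:R / 2 ^+ k) * (eta / l.+1%:R ^+ 2 * Num.sqrt (2 ^+ k * ln k%:R)) =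
      eta * l.+1%:R ^+ 2 * (Num.sqrt (ln k%:R / 2 ^+ k) * Num.sqrt (2 ^+ k * ln k%:R)) :> R.
      by move: x0; set x := l.+1%:R => x0; field.
    congr (_ * _); rewrite -sqrtrM// (_ : _ / _ * (_ * _) = ln k%:R ^+ 2); last first.
      by field; rewrite expf_neq0.
    by rewrite sqrtr_sqr ger0_norm//; lra.
  have v1 : (2 ^ k)%:R * (t ^+ 2 * (4 * C1 * g ^+ l) * 3 / 2) <= ln k%:R.
    rewrite t2 natrX.
    rewrite (_ : _ * _ = ln k%:R * (6 * C1 * l.+1%:R ^+ 8 * g ^+ l)); last first.
      by field; rewrite expf_neq0.
    by rewrite ler_piMr ?(HLa l)//; [lra|exact: leq_trans Ll].
  have one (ij : 'I_(card l.+1) * 'I_(card l)) : (P (G k l ij) <=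
      (2 * expR (- (2 + (3 * c0 + 1) * l.+1%:R) * ln k%:R))%:E)%E.
    rewrite /G; case: ifPn => [rh|_]; last by rewrite measure0 lee_fin mulr_ge0 ?expR_ge0.
    have [_ _ /(_ _ t rh t0 tW)] := HF (net ij.1, net ij.2, lam k l, 2 ^ k)%N.
    move=> /le_trans; apply; rewrite lee_fin ler_pM2l// ler_expR /= tl.
    apply: (le_trans (lerD (lexx _) v1)).
    rewrite (_ : - _ + _ = - (eta * l.+1%:R ^+ 2 - 1) * ln k%:R); last by ring.
    rewrite ler_wpM2r//; first by lra.
    by have := HLb l (leq_trans LbL Ll); lra.
  apply: (@le_trans _ _ (\sum_(ij <- enum {: 'I_(card l.+1) * 'I_(card l)})
     (2 * expR (- (2 + (3 * c0 + 1) * l.+1%:R) * ln k%:R))%:E)%E); first by apply: lee_sum => ij _; exact: one.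
  rewrite sumEFin lee_fin big_const_seq count_predT iter_addr_0 -cardE card_prod !card_ord.
  rewrite -[leLHS]mulr_natl natrM mulrCA -[leRHS]mulrA ler_pM2l//.
  have cc : (card l.+1)%:R * (card l)%:R <= expR (3 * c0 * l.+1%:R).
    apply: (le_trans (ler_pM _ _ (card_net _) (card_net _))) => //.
    rewrite -expRD ler_expR -[l.+2%:R]natr1.
    have x1 : 1 <= l.+1%:R :> R by rewrite ler1n.
    have h : 0 <= c0 * (l.+1%:R - 1) by rewrite mulr_ge0// subr_ge0.
    by move: h; set x := l.+1%:R; lra.
  rewrite (_ : - (2 + _) * _ = - 2 * ln k%:R + - ((3 * c0 + 1) * l.+1%:R * ln k%:R)); last by ring.
  rewrite expRD mulrCA ler_pM2l ?expR_gt0//.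
  apply: (@le_trans _ _ (expR (3 * c0 * l.+1%:R) * expR (- ((3 * c0 + 1) * l.+1%:R)))).
    rewrite ler_pM ?expR_ge0 ?mulr_ge0// ler_expR lerN2 ler_peMr//.
    by rewrite mulr_ge0// addr_ge0// mulr_ge0.
  rewrite -expRD (_ : _ + - _ = - l.+1%:R); last by ring.
  rewrite expRN -[l.+1%:R]mulr1 expRM_natl -exprVn lerXn2r ?nnegrE ?invr_ge0 ?expR_ge0//.
  by rewrite lef_pV2 ?posrE ?expR_gt0//; apply: le_trans (expR_ge1Dx _); lra.
have EP k : (k0 <= k)%N -> (P (E k) <= (2 * expR (- (1 + 1) * ln (1 * k%:R)))%:E)%E.
  move=> kk; apply: (le_trans (measure_union_seq P (fun l _ => mEk k l)).2).
  apply: (@le_trans _ _ (\sum_(l <- iota L (A0 * k - L))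
     (2 * expR (- 2 * ln k%:R) * 2^-1 ^+ l.+1)%:E)%E).
    rewrite !big_seq; apply: lee_sum => l; rewrite mem_iota => /andP[Ll lA].
    by apply: step => //; move: Ll lA; clear; lia.
  rewrite sumEFin lee_fin mul1r -mulr_sumr ler_piMr ?mulr_ge0 ?expR_ge0//.
  have half : forall n m, \sum_(l <- iota m n) (2^-1 : R) ^+ l.+1 <= 2^-1 ^+ m.
    elim=> [|n' IH] m; first by rewrite big_nil exprn_ge0.
    rewrite /= big_cons; apply: (le_trans (lerD (lexx _) (IH _))).
    by rewrite exprS; lra.
  by apply: (le_trans (half _ _)); rewrite exprn_ile1//; lra.
have [M uM] := riemann_sum_bounded ltr01 (ltr01 : 0 < 1 :> R).
have uM' n : \sum_(k < n) 2 * expR (- (1 + 1) * ln (1 * k%:R)) <= 2 * M.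
  by rewrite -mulr_sumr ler_pM2l.
have u0 k : 0 <= 2 * expR (- (1 + 1) * ln (1 * k%:R)) :> R by rewrite mulr_ge0 ?expR_ge0.
have := ae_eventually_not mE u0 EP uM'.
apply: filterS => w [k1 Hk1]; exists (maxn (maxn k0 k1) L) => k.
rewrite !geq_max => /andP[/andP[kk0 kk1] kL] n q nk.
have nE := Hk1 k kk1.
have inc l : (L <= l)%N -> (l < A0 * k)%N ->
    `|psum n (pi l.+1 q) w - psum n (pi l q) w| <= lam k l.
  move=> Ll lA; rewrite leNgt; apply/negP => /ltW hl; apply: nE.
  exists l; first by rewrite mem_iota; move: Ll lA; clear; lia.
  have [i1 e1] := pi_net l.+1 q; have [i2 e2] := pi_net l q.
  exists (i1, i2); first by rewrite mem_enum.
  rewrite /= /G ifT; last first.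
    rewrite -e1 -e2; apply: (le_trans (rho2_triangle q _ _)).
    have ll1 : (l1 <= l)%N := leq_trans l1L Ll.
    apply: (le_trans (lerD (ler_wpM2l _ (rho2_net q (leqW ll1))) (ler_wpM2l _ (rho2_net q ll1)))) => //.
    have : g ^+ l.+1 <= g ^+ l by rewrite ler_wiXn2l// ?ltW.
    by move=> gl; have := ler_wpM2l C1_ge0 gl; lra.
  have [_ + _] := HF (net i1, net i2, lam k l, 2 ^ k)%N.
  by apply; [exact: nk|rewrite /= -e1 -e2].
have LA : (L <= A0 * k)%N by rewrite (leq_trans kL)// leq_pmull.
have tel m : (L + m <= A0 * k)%N -> `|psum n (pi (L + m) q) w - psum n (pi L q) w| <=
    \sum_(L <= l < L + m) lam k l.
  elim: m => [|m IHm] Lm; first by rewrite addn0 subrr normr0 big_geq.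
  rewrite addnS big_nat_recr ?leq_addr//= addrC.
  rewrite (_ : _ - _ = (psum n (pi (L + m).+1 q) w - psum n (pi (L + m) q) w)
    + (psum n (pi (L + m) q) w - psum n (pi L q) w)); last by ring.
  apply: (le_trans (ler_normD _ _)); apply: lerD.
    by apply: inc; [rewrite leq_addr|rewrite -addnS].
  by apply: IHm; rewrite (leq_trans _ Lm)// leq_add2l.
have := tel (A0 * k - L)%N; rewrite subnKC// => /(_ (leqnn _))/le_trans; apply.
rewrite /lam -mulr_suml -mulr_sumr -/(sc k) ler_wpM2r ?sqrtr_ge0//.
rewrite mulrC ler_pM2r//.
exact: sum_inv_sqr_le2.
Qed.

End chaining.


(** * Asymptotic equicontinuity of the normalized sums *)

Section lil_consequences.
Context d (Omega : measurableType d) (R : realType) (P : probability Omega R).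
Context {S : Type}.
Variables (phi : nat -> S -> Omega -> R) (K : S -> S -> R) (W : R).
Hypothesis fd : finite_dimensional P phi K W.
Hypothesis W_gt0 : 0 < W.
Local Notation psum := (psum phi).

(** A linear combination of finitely many coordinates is again a function of one
    sequence of letters, whose variance is the quadratic form of [K]. *)
Lemma upper_lil_fd n (pt : 'I_n -> S) (c : 'I_n -> R) (e : R) : 0 < e ->
  {ae P, forall w, exists N : nat, forall m, (N <= m)%N ->
    \sum_i c i * psum m (pt i) w <=
    (Num.sqrt (\sum_i \sum_k c i * c k * K (pt i) (pt k)) + e) * lilr m%:R}.
Proof.
move=> e0; have [A [xi [p [f [iid phiE fW f0 cov]]]]] := fd pt.
pose g a := \sum_i c i * f i a.
have g0 : \sum_a p a * g a = 0.
  under eq_bigr do rewrite mulr_sumr.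
  rewrite exchange_big/= big1// => i _.
  by under eq_bigr do rewrite mulrCA; rewrite -mulr_sumr f0 mulr0.
have g2 : \sum_a p a * g a ^+ 2 = \sum_i \sum_k c i * c k * K (pt i) (pt k).
  under eq_bigr => a _.
    rewrite expr2 big_distrlr/= mulr_sumr.
    under eq_bigr do rewrite mulr_sumr.
    over.
  rewrite exchange_big/=; apply: eq_bigr => i _.
  rewrite exchange_big/=; apply: eq_bigr => k _.
  by rewrite -cov mulr_sumr; apply: eq_bigr => a _; ring.
have := upper_lil iid g0 e0; rewrite g2; apply: filterS => w [N HN].
exists N => m /HN; rewrite (_ : \sum_(j < m) g (xi j w) = \sum_i c i * psum m (pt i) w)//.
rewrite exchange_big/=; apply: eq_bigr => i _; rewrite -mulr_sumr; congr (_ * _).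
by apply: eq_bigr => j _; rewrite phiE.
Qed.

(** The direction of the tilt is the combination of the coordinates with the
    coefficients [c]; its covariances with the coordinates are the limits. *)
Lemma lower_lil_fd n (pt : 'I_n -> S) (c : 'I_n -> R) (e : R) : 0 < e ->
  \sum_i \sum_k c i * c k * K (pt i) (pt k) < 1 ->
  {ae P, forall w, forall N : nat, exists2 m, (N <= m)%N & forall i,
    `|psum m (pt i) w - (\sum_k c k * K (pt k) (pt i)) * lilr m%:R| <= e * lilr m%:R}.
Proof.
move=> e0 c1; have [A [xi [p [f [iid phiE fW f0 cov]]]]] := fd pt.
pose g a := \sum_i c i * f i a.
have g0 : \sum_a p a * g a = 0.
  under eq_bigr do rewrite mulr_sumr.
  rewrite exchange_big/= big1// => i _.
  by under eq_bigr do rewrite mulrCA; rewrite -mulr_sumr f0 mulr0.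
have g2 : \sum_a p a * g a ^+ 2 < 1.
  rewrite (_ : \sum_a _ = \sum_i \sum_k c i * c k * K (pt i) (pt k))//.
  under eq_bigr => a _.
    rewrite expr2 big_distrlr/= mulr_sumr.
    under eq_bigr do rewrite mulr_sumr.
    over.
  rewrite exchange_big/=; apply: eq_bigr => i _.
  rewrite exchange_big/=; apply: eq_bigr => k _.
  by rewrite -cov mulr_sumr; apply: eq_bigr => a _; ring.
have := lower_lil iid f0 g0 g2 e0; apply: filterS => w Hw N.
have [m Nm Hm] := Hw N; exists m => // i; have := Hm i.
rewrite (_ : \sum_a p a * (g a * f i a) = \sum_k c k * K (pt k) (pt i)); last first.
  under eq_bigr do rewrite /g mulr_suml mulr_sumr.
  rewrite exchange_big/=; apply: eq_bigr => k _; rewrite -cov mulr_sumr.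
  by apply: eq_bigr => a _; ring.
rewrite (_ : \sum_(j < m) _ = psum m (pt i) w)//.
by apply: eq_bigr => j _; rewrite phiE.
Qed.

Variables (pi : nat -> S -> S) (card : nat -> nat) (net : forall l, 'I_(card l) -> S).
Variables (c0 C1 C2 g : R) (A0 l1 : nat).
Hypotheses (c0_ge0 : 0 <= c0) (C1_ge0 : 0 <= C1) (C2_ge0 : 0 <= C2) (g01 : 0 < g < 1).
Hypothesis A0_gt0 : (0 < A0)%N.
Hypothesis pi_net : forall l q, exists i, pi l q = @net l i.
Hypothesis card_net : forall l, (card l)%:R <= expR (c0 * l.+1%:R).
Hypothesis rho2_net : forall l q, (l1 <= l)%N -> rho2 K q (pi l q) <= C1 * g ^+ l.
Hypothesis fine_net : {ae P, forall w, exists k0, forall k, (k0 <= k)%N ->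
  forall n q, (n <= 2 ^ k)%N ->
  `|psum n q w - psum n (pi (A0 * k) q) w| <= C2 * k.+1%:R}.

Lemma ln2_ge_half : 2^-1 <= ln 2 :> R.
Proof.
rewrite -[leLHS]expRK ln_mono ?expR_gt0//.
have x1 : `|2^-1 : R| <= 1 by rewrite ger0_norm//; lra.
have := expR_le_taylor2 x1; rewrite ger0_norm//; lra.
Qed.

Lemma lilr_dyadic (k n : nat) : (6 <= k)%N -> (2 ^ k.-1 < n)%N ->
  Num.sqrt (2 ^+ k * ln k%:R) <= 2 * lilr n%:R :> R.
Proof.
move=> k6 kn; have k6R : 6 <= k%:R :> R by rewrite (ler_nat R 6).
have k1E : k.-1%:R = k%:R - 1 :> R.
  by rewrite -[in RHS](@prednK k) ?(leq_trans _ k6)// -[in RHS]natr1 addrK.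
have y0 : 1 < k.-1%:R * ln 2 :> R.
  rewrite k1E; have := ln2_ge_half; nra.
have x1 : 1 < (2 ^ k.-1)%:R :> R.
  by rewrite (ltr_nat R 1) -{1}(expn0 2) ltn_exp2l//; case: k k6 {kn k6R k1E y0} => [|[]].
apply: (@le_trans _ _ (2 * lilr (2 ^ k.-1)%:R)); last first.
  by rewrite ler_pM2l// lilr_mono// ler_nat ltnW.
rewrite /lilr -sqrtrM// natrX lnXn// -[ln 2 *+ _]mulr_natl.
rewrite [leRHS](_ : _ = Num.sqrt (2 ^+ 2 * (2 ^+ k.-1 * (2 * ln (k.-1%:R * ln 2))))).
  2: by rewrite [RHS]sqrtrM ?sqr_ge0// sqrtr_sqr ger0_norm.
rewrite ler_wsqrtr//.
rewrite (_ : 2 ^+ 2 * (_ * _) = 2 ^+ k * (4 * ln (k.-1%:R * ln 2))); last first.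
  have -> : 2 ^+ k = 2 * 2 ^+ k.-1 :> R by rewrite -exprS prednK// (leq_trans _ k6).
  by move: (ln _) (2 ^+ k.-1 : R) => a z; ring.
rewrite ler_wpM2l ?exprn_ge0//.
apply: (@le_trans _ _ (2 * ln (k.-1%:R * ln 2))); last first.
  by have : 0 <= ln (k.-1%:R * ln 2) :> R; [rewrite ln_ge0// ltW|lra].
rewrite mulr_natl -lnXn; last by lra.
rewrite ln_mono//; first by lra.
rewrite exprMn k1E.
have l2 : 4^-1 <= ln 2 ^+ 2 :> R by have := ln2_ge_half; nra.
by nra.
Qed.

(** For [n] up to [2 ^ k], chaining leads from the net of level [L] to that of
    level [A0 * k], and from there the error is of order [k]; both are small
    against [lilr n] if [n] is larger than [2 ^ k.-1]. *)
Lemma lil_equicontinuity (e : R) : 0 < e -> exists L0, forall L, (L0 <= L)%N ->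
  {ae P, forall w, exists N : nat, forall n, (N <= n)%N -> forall q,
    `|psum n q w - psum n (pi L q) w| <= e * lilr n%:R}.
Proof.
move=> e0; have eta0 : 0 < e / 8 by rewrite divr_gt0.
have [L0 HL0] := chain_increments fd W_gt0 c0_ge0 C1_ge0 g01 A0_gt0 pi_net card_net rho2_net eta0.
exists L0 => L /HL0 chain; move: chain fine_net; apply: filterS2 => w [k1 H1] [k2 H2].
have g4 : 0 < (2^-1 : R) < 1 by apply/andP; split; lra.
have [ka _ Hka] : \forall k \near \oo, (16 * C2 ^+ 2 / e ^+ 2) * k.+1%:R ^+ 2 * 2^-1 ^+ k <= 1 :> R.
  by apply: poly_geometric_small => //; apply: divr_ge0; rewrite ?sqr_ge0//; apply: mulr_ge0; rewrite ?sqr_ge0.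
pose k0 := maxn (maxn k1 k2) (maxn ka 6).
exists (2 ^ k0).+1 => n nk q.
have n1 : (1 < n)%N by rewrite (leq_trans _ nk)// ltnS expn_gt0.
pose k := up_log 2 n.
have /andP[kl kr] := up_log_bounds (ltnSn 1) n1; rewrite -/k in kl kr.
have kk : (k0 <= k)%N.
  by rewrite -(leq_exp2l (m := 2))// (leq_trans _ kr)// ltnW// (leq_trans _ nk).
move: (kk); rewrite !geq_max => /andP[/andP[kk1 kk2] /andP[kka kk6]].
have sc := lilr_dyadic kk6 kl; set s := Num.sqrt _ in sc.
have b1 := H1 k kk1 n q kr; have b2 := H2 k kk2 n q kr; rewrite -/s in b1.
have lk1 : 1 <= ln k%:R :> R.
  rewrite -[leLHS]expRK ln_mono ?expR_gt0//.
  apply: (@le_trans _ _ 6); last by rewrite (ler_nat R 6).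
  have x1 : `|2^-1 : R| <= 1 by rewrite ger0_norm//; lra.
  have := expR_le_taylor2 x1; rewrite ger0_norm// => h.
  have -> : expR 1 = expR 2^-1 ^+ 2 :> R by rewrite -expRM_natl mulfV.
  have := expR_ge0 (2^-1 : R); nra.
have b3 : C2 * k.+1%:R <= e / 4 * s.
  rewrite -(@ler_pXn2r _ 2)// ?nnegrE ?mulr_ge0 ?sqrtr_ge0 ?divr_ge0 ?(ltW e0)//.
  have s2 : s ^+ 2 = 2 ^+ k * ln k%:R.
    by rewrite sqr_sqrtr// mulr_ge0 ?exprn_ge0//; lra.
  rewrite [leRHS]exprMn s2 exprMn.
  have h := Hka k kka; rewrite exprVn ler_pdivrMr ?exprn_gt0// mul1r in h.
  have e2 : 0 < e ^+ 2 by rewrite exprn_gt0.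
  rewrite mulrAC ler_pdivrMr// in h.
  apply: (@le_trans _ _ (e ^+ 2 / 16 * 2 ^+ k)).
    by move: h; move: (e ^+ 2) (2 ^+ k : R) (k.+1%:R ^+ 2) (C2 ^+ 2) => a b c f; lra.
  rewrite (_ : (e / 4) ^+ 2 * _ = e ^+ 2 / 16 * 2 ^+ k * ln k%:R); last by field.
  by rewrite ler_peMr// mulr_ge0 ?exprn_ge0// divr_ge0// ltW.
rewrite (_ : _ - _ = (psum n q w - psum n (pi (A0 * k) q) w) +
  (psum n (pi (A0 * k) q) w - psum n (pi L q) w)); last by ring.
apply: (le_trans (ler_normD _ _)); apply: (le_trans (lerD b2 b1)).
apply: (le_trans (lerD b3 (lexx _))).
have := ler_wpM2l (ltW eta0) sc; lra.
Qed.

End lil_consequences.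


(** * The reproducing kernel Hilbert space and its unit ball *)

Section additive_functions.
Context {R : realType}.

(** A polarized form is additive by the parallelogram law; its homogeneity
    follows from local boundedness. *)
Lemma additive_bounded_linear (A : R -> R) (M : R) :
  (forall x y, A (x + y) = A x + A y) ->
  (forall x, `|x| <= 1 -> `|A x| <= M) -> forall x, A x = x * A 1.
Proof.
move=> AD AM.
have A0 : A 0 = 0 by have := AD 0 0; rewrite addr0; lra.
have AN x : A (- x) = - A x by have := AD x (- x); rewrite subrr A0; lra.
pose D x := A x - x * A 1.
have DD x y : D (x + y) = D x + D y by rewrite /D AD; ring.
have Dn n x : D (n%:R * x) = n%:R * D x.
  elim: n => [|n IHn]; first by rewrite !mul0r /D A0; ring.
  by rewrite -natr1 !mulrDl !mul1r DD IHn.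
have D1 : D 1 = 0 by rewrite /D; ring.
have Db x : 0 <= x -> `|D x| <= M + `|A 1|.
  move=> x0; have /andP[h1 h2] := truncn_itv x0.
  set n := Num.truncn x in h1 h2.
  have -> : D x = D (x - n%:R).
    by rewrite -[x in LHS](subrK n%:R) DD -[n%:R in X in _ + X]mulr1 Dn D1; ring.
  have xn : `|x - n%:R| <= 1.
    by rewrite ger0_norm ?subr_ge0//; move: h2; rewrite -natr1; lra.
  apply: (le_trans (ler_normB _ _)); apply: lerD; first exact: AM.
  by rewrite normrM ler_piMl.
have Dpos x : 0 <= x -> D x = 0.
  move=> x0; apply/eqP; rewrite -normr_le0 leNgt; apply/negP => Dx.
  pose n := (Num.truncn ((M + `|A 1|) / `|D x|)).+1.
  have nx : 0 <= n%:R * x by rewrite mulr_ge0.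
  have := Db _ nx; rewrite Dn normrM normr_nat leNgt => /negP; apply.
  by rewrite -ltr_pdivrMr// truncnS_gt.
move=> x; have [x0|x0] := leP 0 x; first by have := Dpos x x0; rewrite /D; lra.
have xN : 0 <= - x by lra.
by have := Dpos _ xN; rewrite /D AN; lra.
Qed.

End additive_functions.

Section moore_aronszajn.
Context {S : Type} {R : realType}.
Variable K : S -> S -> R.
Hypothesis K_sym : forall p q, K p q = K q p.
Hypothesis K_psd : forall n (pt : 'I_n -> S) (c : 'I_n -> R),
  0 <= \sum_i \sum_k c i * c k * K (pt i) (pt k).
Implicit Types (a b : seq (R * S)) (f g h : S -> R).

(** A list of weighted points stands for the finite combination of
    evaluations, or of kernel functions, with these weights. *)
Definition ev a f : R := \sum_(x <- a) x.1 * f x.2.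
Definition bf a b : R := \sum_(x <- a) \sum_(y <- b) x.1 * y.1 * K x.2 y.2.
Definition cscale (s : R) a := [seq (s * x.1, x.2) | x <- a].

Lemma ev_cat a b f : ev (a ++ b) f = ev a f + ev b f.
Proof. exact: big_cat. Qed.

Lemma ev_scale s a f : ev (cscale s a) f = s * ev a f.
Proof. by rewrite /ev big_map mulr_sumr; apply: eq_bigr => x _; rewrite mulrA. Qed.

Lemma evD a f g : ev a (f + g) = ev a f + ev a g.
Proof. by rewrite /ev -big_split/=; apply: eq_bigr => x _; rewrite mulrDr. Qed.

Lemma evZ a (s : R) f : ev a (s *: f) = s * ev a f.
Proof. by rewrite /ev mulr_sumr; apply: eq_bigr => x _ /=; rewrite mulrCA. Qed.

Lemma evB a f g : ev a (f - g) = ev a f - ev a g.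
Proof. by rewrite evD -scaleN1r evZ mulN1r. Qed.

Lemma ev1 s p f : ev [:: (s, p)] f = s * f p.
Proof. by rewrite /ev big_seq1. Qed.

Lemma ev_nil f : ev [::] f = 0.
Proof. by rewrite /ev big_nil. Qed.

Lemma bf_sym a b : bf a b = bf b a.
Proof.
rewrite /bf exchange_big; apply: eq_bigr => y _; apply: eq_bigr => x _.
by rewrite K_sym [x.1 * _]mulrC.
Qed.

Lemma bf_catl a b e : bf (a ++ b) e = bf a e + bf b e.
Proof. exact: big_cat. Qed.

Lemma bf_catr a b e : bf e (a ++ b) = bf e a + bf e b.
Proof. by rewrite !(bf_sym e) bf_catl. Qed.

Lemma bf_scalel s a b : bf (cscale s a) b = s * bf a b.
Proof.
rewrite /bf big_map mulr_sumr; apply: eq_bigr => x _.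
by rewrite mulr_sumr; apply: eq_bigr => y _ /=; rewrite !mulrA.
Qed.

Lemma bf_scaler s a b : bf a (cscale s b) = s * bf a b.
Proof. by rewrite bf_sym bf_scalel bf_sym. Qed.

Lemma bf_ev a p s : bf a [:: (s, p)] = s * ev a (K p).
Proof.
rewrite /bf /ev mulr_sumr; apply: eq_bigr => x _.
by rewrite big_seq1 /= [K p _]K_sym; ring.
Qed.

Lemma bf1 s t p q : bf [:: (s, p)] [:: (t, q)] = s * t * K p q.
Proof. by rewrite /bf !big_seq1. Qed.

Lemma bf_nil : bf [::] [::] = 0.
Proof. by rewrite /bf big_nil. Qed.

Lemma bf_ge0 a : 0 <= bf a a.
Proof.
case: a => [|x0 a]; first by rewrite bf_nil.
have := K_psd (fun i : 'I_(size (x0 :: a)) => (nth x0 (x0 :: a) i).2)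
  (fun i => (nth x0 (x0 :: a) i).1).
congr (0 <= _); rewrite /bf (big_nth x0) big_mkord; apply: eq_bigr => i _.
by rewrite (big_nth x0) big_mkord.
Qed.

(** The squared norm in the reproducing kernel Hilbert space is the Legendre
    transform of the squared norm on combinations of kernel functions. *)
Definition val2 f a : R := 2 * ev a f - bf a a.
Definition nsq_le f (C : R) := forall a, val2 f a <= C.
Definition rk_space : set (S -> R) := [set f | exists C, nsq_le f C].
Definition nsq f : R := sup (range (val2 f)).

Lemma nsq_ub f : rk_space f -> nsq_le f (nsq f).
Proof.
move=> [C fC] a; apply: ub_le_sup; last by exists a.
by exists C => _ [b _ <-].
Qed.

Lemma nsq_lub f C : nsq_le f C -> nsq f <= C.
Proof.
move=> fC; apply: ge_sup; first by exists (val2 f [::]), [::].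
by move=> _ [b _ <-].
Qed.

Lemma nsq_le_ge0 f C : nsq_le f C -> 0 <= C.
Proof. by move=> /(_ [::]); rewrite /val2 ev_nil bf_nil; lra. Qed.

Lemma nsq_ge0 f : rk_space f -> 0 <= nsq f.
Proof. by move=> /nsq_ub /nsq_le_ge0. Qed.

Lemma nsq_leZ (s C : R) f : nsq_le f C -> nsq_le (s *: f) (s ^+ 2 * C).
Proof.
move=> fC a; have [->|s0] := eqVneq s 0.
  by rewrite /val2 evZ !mul0r mulr0 expr0n mul0r; have := bf_ge0 a; lra.
have := ler_wpM2l (sqr_ge0 s) (fC (cscale s^-1 a)); apply: le_trans.
rewrite /val2 evZ ev_scale bf_scalel bf_scaler le_eqVlt; apply/orP; left; apply/eqP.
by field.
Qed.

Lemma nsq_leD C1 C2 f g : nsq_le f C1 -> nsq_le g C2 ->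
  nsq_le (f + g) (2 * C1 + 2 * C2).
Proof.
move=> fC gC a; have h1 := fC (cscale 2^-1 a); have h2 := gC (cscale 2^-1 a).
move: h1 h2; rewrite /val2 !ev_scale evD !bf_scalel !bf_scaler; lra.
Qed.

Lemma rk_space_lin (s : R) f g : rk_space f -> rk_space g -> rk_space (s *: f + g).
Proof.
move=> [C1 fC] [C2 gC]; eexists; apply: nsq_leD gC; exact: nsq_leZ fC.
Qed.

Lemma rk_spaceD f g : rk_space f -> rk_space g -> rk_space (f + g).
Proof. by move=> Hf Hg; rewrite -[f]scale1r; exact: rk_space_lin. Qed.

Lemma rk_space0 : rk_space 0.
Proof.
exists 0 => a; rewrite /val2 (_ : ev a 0 = 0); first by have := bf_ge0 a; lra.
by rewrite /ev big1// => x _; rewrite mulr0.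
Qed.

Lemma rk_spaceZ (s : R) f : rk_space f -> rk_space (s *: f).
Proof. by move=> Hf; rewrite -[X in rk_space X]addr0; apply: rk_space_lin rk_space0. Qed.

Lemma rk_spaceB f g : rk_space f -> rk_space g -> rk_space (f - g).
Proof. by move=> Hf Hg; rewrite -scaleN1r; apply: rk_spaceD Hf (rk_spaceZ _ Hg). Qed.

Lemma nsqZ (s : R) f : rk_space f -> nsq (s *: f) = s ^+ 2 * nsq f.
Proof.
move=> Hf; apply/eqP; rewrite eq_le; apply/andP; split.
  by apply: nsq_lub; apply: nsq_leZ; exact: nsq_ub.
have [->|s0] := eqVneq s 0.
  by rewrite expr0n mul0r; apply: nsq_ge0; exact: rk_spaceZ.
have := nsq_lub (nsq_leZ s^-1 (nsq_ub (rk_spaceZ s Hf))).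
rewrite scalerA mulVf// scale1r exprVn => h.
have s2 : 0 < s ^+ 2 by rewrite lt_def sqrf_eq0 s0 sqr_ge0.
by have := ler_wpM2l (ltW s2) h; rewrite mulrA mulfV ?lt0r_neq0// mul1r.
Qed.

Lemma nsqN f : rk_space f -> nsq (- f) = nsq f.
Proof. by move=> Hf; rewrite -scaleN1r nsqZ// sqrrN expr1n mul1r. Qed.

(** The parallelogram law holds because [(a, b) |-> (a + b, a - b)] is a
    bijection of pairs of combinations. *)
Lemma parallelogram f g : rk_space f -> rk_space g ->
  nsq (f + g) + nsq (f - g) = 2 * nsq f + 2 * nsq g.
Proof.
move=> Hf Hg.
have HD := rk_spaceD Hf Hg; have HB := rk_spaceB Hf Hg.
apply/eqP; rewrite eq_le; apply/andP; split.
  rewrite -lerBrDr; apply: nsq_lub => a; rewrite lerBrDl -lerBrDr; apply: nsq_lub => b.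
  have := nsq_ub Hf (cscale 2^-1 (a ++ b)); have := nsq_ub Hg (cscale 2^-1 (a ++ cscale (-1) b)).
  rewrite /val2 !evB !evD !(ev_scale, ev_cat) !(bf_scalel, bf_scaler, bf_catl, bf_catr).
  rewrite (bf_sym b a); lra.
suff : nsq f <= (nsq (f + g) + nsq (f - g) - 2 * nsq g) / 2 by lra.
apply: nsq_lub => a.
suff : nsq g <= (nsq (f + g) + nsq (f - g) - 2 * val2 f a) / 2 by lra.
apply: nsq_lub => b.
have := nsq_ub HD (a ++ b); have := nsq_ub HB (a ++ cscale (-1) b).
rewrite /val2 !evB !evD !(ev_scale, ev_cat) !(bf_scalel, bf_scaler, bf_catl, bf_catr).
rewrite (bf_sym b a); lra.
Qed.

Definition rk_ip f g : R := (nsq (f + g) - nsq (f - g)) / 4.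

Lemma nsq0 : nsq 0 = 0.
Proof. by rewrite -(scale0r (0 : S -> R)) nsqZ ?expr0n ?mul0r//; exact: rk_space0. Qed.

Lemma rk_ipff f : rk_space f -> rk_ip f f = nsq f.
Proof.
move=> Hf; rewrite /rk_ip subrr nsq0 subr0 -mulr2n -scaler_nat nsqZ//.
by field.
Qed.

Lemma rk_ipC f g : rk_space f -> rk_space g -> rk_ip f g = rk_ip g f.
Proof.
by move=> Hf Hg; rewrite /rk_ip [g + f]addrC -(nsqN (rk_spaceB Hg Hf)) opprB.
Qed.

(** Additivity of the form polarized from a parallelogram law, after Jordan
    and von Neumann. *)
Lemma rk_ipDl f g h : rk_space f -> rk_space g -> rk_space h ->
  rk_ip (f + g) h = rk_ip f h + rk_ip g h.
Proof.
have two f' g' h' : rk_space f' -> rk_space g' -> rk_space h' ->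
    rk_ip f' h' + rk_ip g' h' = rk_ip (f' + g') (2 *: h') / 2.
  move=> Hf Hg Hh.
  have p1 := parallelogram (rk_spaceD Hf Hh) (rk_spaceD Hg Hh).
  have p2 := parallelogram (rk_spaceB Hf Hh) (rk_spaceB Hg Hh).
  rewrite /rk_ip.
  have e1 : f' + h' + (g' + h') = f' + g' + 2 *: h' by rewrite addrACA -mulr2n -scaler_nat.
  have e2 : f' - h' + (g' - h') = f' + g' - 2 *: h'.
    by rewrite addrACA -opprD -mulr2n -scaler_nat.
  have e3 : f' + h' - (g' + h') = f' - g' by rewrite opprD addrACA subrr addr0.
  have e4 : f' - h' - (g' - h') = f' - g' by rewrite opprB addrA subrK.
  by move: p1 p2; rewrite e1 e2 e3 e4; lra.
move=> Hf Hg Hh; have HD := rk_spaceD Hf Hg.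
rewrite two// -[f + g in LHS]addr0.
have z : rk_ip 0 h = 0 by rewrite /rk_ip add0r sub0r nsqN// subrr mul0r.
have := two (f + g) 0 h HD rk_space0 Hh; rewrite z addr0 => <-.
by rewrite addr0.
Qed.

Lemma rk_ipZl (s : R) f h : rk_space f -> rk_space h ->
  rk_ip (s *: f) h = s * rk_ip f h.
Proof.
move=> Hf Hh; rewrite -[in RHS](scale1r f).
apply: (@additive_bounded_linear _ (fun s => rk_ip (s *: f) h) (nsq f + nsq h)).
  by move=> x y; rewrite scalerDl rk_ipDl//; exact: rk_spaceZ.
move=> x x1; have Hx := rk_spaceZ x Hf.
have pl := parallelogram Hx Hh; rewrite nsqZ// in pl.
have n1 := nsq_ge0 (rk_spaceD Hx Hh); have n2 := nsq_ge0 (rk_spaceB Hx Hh).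
have n3 := nsq_ge0 Hf; have n4 := nsq_ge0 Hh.
have x2 : x ^+ 2 <= 1 by rewrite -(real_normK (num_real x)) exprn_ile1.
have : x ^+ 2 * nsq f <= nsq f by rewrite ler_piMl.
by rewrite /rk_ip ler_norml; move=> h1; apply/andP; split; lra.
Qed.

Lemma ev_sqr_le f C a s : nsq_le f C -> 2 * s * ev a f <= C + s ^+ 2 * bf a a.
Proof.
by move=> /(_ (cscale s a)); rewrite /val2 ev_scale bf_scalel bf_scaler; lra.
Qed.

Lemma pointwise_le f p (e : R) : 0 < e -> nsq_le f (e ^+ 2) ->
  `|f p| <= e * (1 + K p p).
Proof.
move=> e0 fe.
have h1 := ev_sqr_le [:: (1, p)] e fe; have h2 := ev_sqr_le [:: (1, p)] (- e) fe.
rewrite ev1 bf1 in h1 h2.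
have K0 : 0 <= K p p by have := bf_ge0 [:: (1, p)]; rewrite bf1; lra.
rewrite ler_norml; apply/andP; split; rewrite -(ler_pM2l e0); nra.
Qed.

Lemma rk_ip_eq0 f : rk_space f -> rk_ip f f = 0 -> f = 0.
Proof.
move=> Hf; rewrite rk_ipff// => f0; apply/funext => p.
apply/eqP; rewrite -normr_le0; apply/ler_addgt0Pr => e e0; rewrite add0r.
have K0 : 0 <= K p p by have := bf_ge0 [:: (1, p)]; rewrite bf1; lra.
have e1 : 0 < e / (1 + K p p) by rewrite divr_gt0//; lra.
have fe : nsq_le f ((e / (1 + K p p)) ^+ 2).
  by move=> a; apply: (le_trans (nsq_ub Hf a)); rewrite f0 sqr_ge0.
by apply: (le_trans (pointwise_le p e1 fe)); rewrite divfK// lt0r_neq0//; lra.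
Qed.

Lemma rk_space_kernel p : rk_space (K p).
Proof.
exists (K p p) => a; have := bf_ge0 (a ++ [:: (-1, p)]).
rewrite !bf_catl !bf_catr (bf_sym _ a) bf_ev bf1 /val2; lra.
Qed.

(** Translation of [f] by [s K p] corresponds to translation of the combination
    by [s] times the evaluation at [p] in the Legendre transform. *)
Lemma nsq_addK f p s : rk_space f ->
  nsq (f + s *: K p) = nsq f + 2 * s * f p + s ^+ 2 * K p p.
Proof.
move=> Hf; have Hs := rk_spaceD Hf (rk_spaceZ s (rk_space_kernel p)).
apply/eqP; rewrite eq_le; apply/andP; split.
  apply: nsq_lub => a; have := nsq_ub Hf (a ++ [:: (- s, p)]).
  rewrite /val2 evD evZ ev_cat ev1 !bf_catl !bf_catr (bf_sym _ a) bf_ev bf1; lra.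
suff : nsq f <= nsq (f + s *: K p) - 2 * s * f p - s ^+ 2 * K p p by lra.
apply: nsq_lub => a; have := nsq_ub Hs (a ++ [:: (s, p)]).
rewrite /val2 evD evZ !ev_cat !ev1 !bf_catl !bf_catr (bf_sym _ a) bf_ev bf1; lra.
Qed.

Lemma rk_reproducing f p : rk_space f -> f p = rk_ip f (K p).
Proof.
move=> Hf; have h1 := nsq_addK p 1 Hf; have h2 := nsq_addK p (-1) Hf.
by rewrite scale1r in h1; rewrite scaleN1r in h2; rewrite /rk_ip h1 h2; field.
Qed.

(** A Cauchy sequence converges pointwise, and the bounds [nsq_le], which are
    pointwise conditions, pass to the limit. *)
Lemma rk_complete (u : nat -> S -> R) : (forall n, rk_space (u n)) ->
  (forall e : R, 0 < e -> exists N, forall m n, (N <= m)%N -> (N <= n)%N ->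
      Num.sqrt (rk_ip (u m - u n) (u m - u n)) < e) ->
  exists2 f, rk_space f &
      (fun n => Num.sqrt (rk_ip (u n - f) (u n - f))) @ \oo --> (0 : R).
Proof.
move=> Hu cu.
have cu' e : 0 < e -> exists N, forall m n, (N <= m)%N -> (N <= n)%N ->
    nsq_le (u m - u n) (e ^+ 2).
  move=> e0; have [N HN] := cu e e0; exists N => m n Nm Nn a.
  have Hmn := rk_spaceB (Hu m) (Hu n).
  apply: (le_trans (nsq_ub Hmn a)); have := ltW (HN m n Nm Nn).
  rewrite rk_ipff// => h; rewrite -(sqr_sqrtr (nsq_ge0 Hmn)).
  by rewrite lerXn2r ?nnegrE ?sqrtr_ge0 ?(ltW e0).
have cvp p : cvgn (fun n => u n p).
  apply: cauchy_cvg; apply/cauchy_exP => e e0.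
  have K0 : 0 <= K p p by have := bf_ge0 [:: (1, p)]; rewrite bf1; lra.
  have e1 : 0 < e / 2 / (1 + K p p) by rewrite !divr_gt0//; lra.
  have [N HN] := cu' _ e1; exists (u N p); exists N => // n /= Nn.
  rewrite /ball/= .
  have := pointwise_le p e1 (HN N n (leqnn _) Nn).
  rewrite divfK ?lt0r_neq0//; last by lra.
  by move=> h; apply: (le_lt_trans h); lra.
pose f p := limn (fun n => u n p).
have fl p : (fun n => u n p) @ \oo --> f p by exact: cvp.
have evl a n : (fun m => val2 (u n - u m) a) @ \oo --> val2 (u n - f) a.
  apply: cvgB; last exact: cvg_cst.
  apply: cvgM; first exact: cvg_cst.
  rewrite /ev; elim: a => [|x a IHa].
    by under eq_fun do rewrite big_nil; rewrite big_nil; exact: cvg_cst.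
  under eq_fun do rewrite big_cons; rewrite big_cons; apply: cvgD => //.
  apply: cvgM; first exact: cvg_cst.
  by apply: cvgB; [exact: cvg_cst|exact: fl].
have near_f e : 0 < e -> exists N, forall n, (N <= n)%N -> nsq_le (u n - f) (e ^+ 2).
  move=> e0; have [N HN] := cu' e e0; exists N => n Nn a.
  rewrite -(cvg_lim _ (evl a n))//; apply: limr_le; first by apply/cvg_ex; eexists; exact: evl.
  by exists N => // m /= Nm; exact: HN.
have Hf : rk_space f.
  have [N HN] := near_f 1 ltr01.
  have -> : f = u N - (u N - f) by rewrite subKr.
  by apply: rk_spaceB => //; eexists; exact: HN.
exists f => //; apply/cvgrPdist_le => e e0.
have [N HN] := near_f e e0; exists N => // n /= Nn.
have Hn := rk_spaceB (Hu n) Hf.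
rewrite sub0r normrN ger0_norm ?sqrtr_ge0// rk_ipff//.
by rewrite -[leRHS](ger0_norm (ltW e0)) -sqrtr_sqr ler_wsqrtr// nsq_lub//; exact: HN.
Qed.

Lemma moore_aronszajn : is_rkhs K rk_space rk_ip.
Proof.
split; last by move=> f p; exact: rk_reproducing.
  split.
  - exact: rk_space0.
  - exact: rk_space_lin.
  - exact: rk_ipC.
  - by move=> s f g h Hf Hg Hh; rewrite rk_ipDl ?rk_ipZl//; exact: rk_spaceZ.
  - by move=> f Hf; rewrite rk_ipff//; exact: nsq_ge0.
  - exact: rk_ip_eq0.
  - exact: rk_complete.
exact: rk_space_kernel.
Qed.

(** In any representation, positivity of the norm of the difference of [f] and a
    combination of kernel functions bounds the values of [f]; conversely, the
    space of Moore and Aronszajn contains all [f] with such bounds. *)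
Lemma rkhs_unit_ball_nsq f : rkhs_unit_ball K f <-> nsq_le f 1.
Proof.
split; last first.
  move=> f1; exists rk_space, rk_ip; split; first exact: moore_aronszajn.
    by exists 1.
  have Hf : rk_space f by exists 1.
  by rewrite rk_ipff// -[leRHS]sqrtr1 ler_wsqrtr//; exact: nsq_lub.
move=> [H [ip [[hil ker rep] Hf f1]]] a.
pose k := \sum_(x <- a) x.1 *: K x.2.
have Hk : H k.
  rewrite /k; elim: a {k} => [|x a IHa]; first by rewrite big_nil; exact: hilbert0 hil.
  by rewrite big_cons; apply: (hilbert_lin hil).
have ipk g : H g -> ip k g = ev a g.
  move=> Hg; rewrite /k /ev.
  have : H (\sum_(x <- a) x.1 *: K x.2) by [].
  elim: a {k Hk} => [|x a IHa] _.
    rewrite !big_nil; have := hilbert_ipP hil (-1) (hilbert0 hil) (hilbert0 hil) Hg.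
    by rewrite scaleN1r oppr0 addr0 mulN1r addNr.
  have Ha : H (\sum_(x <- a) x.1 *: K x.2).
    elim: (a) => [|y b IHb]; first by rewrite big_nil; exact: hilbert0 hil.
    by rewrite big_cons; apply: (hilbert_lin hil).
  rewrite !big_cons (hilbert_ipP hil)// IHa//.
  by rewrite (hilbert_ipC hil) -?rep.
have kE p : k p = ev a (K p).
  rewrite /k /ev fct_sumE; apply: eq_bigr => x _.
  by rewrite K_sym.
have kk : ip k k = bf a a.
  rewrite ipk// /bf /ev; apply: eq_bigr => x _; rewrite kE /ev mulr_sumr.
  by apply: eq_bigr => y _; rewrite mulrA.
have Hfk : H ((-1) *: k + f) by exact: (hilbert_lin hil).
have := hilbert_ip_ge0 hil Hfk.
rewrite (hilbert_ipP hil)// (hilbert_ipC hil Hk)// (hilbert_ipC hil Hf)// !(hilbert_ipP hil)//.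
rewrite (hilbert_ipC hil Hf Hk) kk ipk// /val2.
have : ip f f <= 1.
  have f0 := hilbert_ip_ge0 hil Hf.
  by rewrite -(sqr_sqrtr f0) -(expr1n _ 2) lerXn2r ?nnegrE ?sqrtr_ge0.
lra.
Qed.

End moore_aronszajn.


(** * Finite-dimensional duality, and compactness of sequences of bounded functions *)

Section finite_duality.
Context {S : Type} {R : realType}.
Variable K : S -> S -> R.
Hypothesis K_sym : forall p q, K p q = K q p.
Hypothesis K_psd : forall n (pt : 'I_n -> S) (c : 'I_n -> R),
  0 <= \sum_i \sum_k c i * c k * K (pt i) (pt k).

Definition quad n (pt : 'I_n -> S) (c : 'I_n -> R) : R :=
  \sum_i \sum_k c i * c k * K (pt i) (pt k).

Lemma nsq_le_fd n (pt : 'I_n -> S) (c : 'I_n -> R) (f : S -> R) (C : R) :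
  nsq_le K f C -> 2 * \sum_i c i * f (pt i) - quad pt c <= C.
Proof.
move=> /(_ [seq (c i, pt i) | i <- enum 'I_n]); rewrite /val2 /ev /bf /quad.
rewrite big_map big_enum; under [X in _ - X <= _]eq_bigr do rewrite big_map big_enum.
by rewrite big_map big_enum.
Qed.

Lemma fd_nsq_le (f : S -> R) (C : R) :
  (forall n (pt : 'I_n -> S) (c : 'I_n -> R), 2 * \sum_i c i * f (pt i) - quad pt c <= C) ->
  nsq_le K f C.
Proof.
move=> h a; case: a => [|x0 a].
  have := h 0%N (fun i => match i with Ordinal _ h => False_rect _ (notF h) end) (fun=> 0).
  by rewrite /val2 ev_nil bf_nil /quad !big_ord0.
set s := x0 :: a.
have := h (size s) (fun i => (nth x0 s i).2) (fun i => (nth x0 s i).1).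
congr (_ <= _); rewrite /val2 /ev /bf /quad (big_nth x0) big_mkord; congr (_ - _).
rewrite (big_nth x0) big_mkord; apply: eq_bigr => i _.
by rewrite (big_nth x0) big_mkord.
Qed.

(** In finite dimensions, a functional bounded by the kernel norm is given by a
    vector of the unit ball: it annihilates the kernel of the symmetric matrix
    of [K], hence lies in its row space. Shrinking it makes the inequality strict. *)
Lemma finite_duality n (pt : 'I_n -> S) (f : S -> R) (e : R) :
  nsq_le K f 1 -> 0 < e -> exists2 c : 'I_n -> R, quad pt c < 1 &
  forall i, `|\sum_k c k * K (pt k) (pt i) - f (pt i)| <= e.
Proof.
move=> f1 e0.
pose M := \matrix_(i < n, j < n) K (pt i) (pt j).
pose h := \row_(i < n) f (pt i).
have hM : (h <= M)%MS.
  rewrite submxE; apply/eqP/rowP => j; rewrite [RHS]mxE.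
  pose z i := cokermx M i j.
  have Mz i : \sum_k M i k * z k = 0.
    by have /matrixP/(_ i j) := mulmx_coker M; rewrite !mxE.
  have qz : quad pt z = 0.
    rewrite /quad big1// => i _; transitivity (z i * \sum_k M i k * z k).
      by rewrite mulr_sumr; apply: eq_bigr => k _; rewrite mxE; ring.
    by rewrite Mz mulr0.
  have hz : (h *m cokermx M) 0 j = \sum_i z i * f (pt i).
    by rewrite mxE; apply: eq_bigr => i _; rewrite mxE mulrC.
  rewrite hz; set E := \sum_i _.
  have sE s : 2 * s * E <= 1.
    have := nsq_le_fd pt (fun i => s * z i) f1.
    have -> : quad pt (fun i => s * z i) = s ^+ 2 * quad pt z.
      rewrite /quad mulr_sumr; apply: eq_bigr => i _.
      by rewrite mulr_sumr; apply: eq_bigr => k _; ring.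
    rewrite qz mulr0 subr0.
    have -> : \sum_i s * z i * f (pt i) = s * E.
      by rewrite /E mulr_sumr; apply: eq_bigr => i _; rewrite mulrA.
    by rewrite mulrA.
  apply/eqP; apply: contraT => E0.
  have := sE E^-1; rewrite -mulrA mulVf// mulr1; lra.
have [D hD] := submxP hM.
pose c i := D 0 i.
have cK i : \sum_k c k * K (pt k) (pt i) = f (pt i).
  have /rowP/(_ i) := hD; rewrite !mxE => ->.
  by apply: eq_bigr => k _; rewrite mxE.
have qc : quad pt c = \sum_i c i * f (pt i).
  apply: eq_bigr => i _; rewrite -cK mulr_sumr; apply: eq_bigr => k _.
  by rewrite K_sym mulrA.
have q1 : quad pt c <= 1 by have := nsq_le_fd pt c f1; rewrite -qc; lra.
have q0 : 0 <= quad pt c by exact: K_psd.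
pose F := \sum_i `|f (pt i)|.
have F0 : 0 <= F by exact: sumr_ge0.
have fF i : `|f (pt i)| <= F by rewrite /F (bigD1 i)//= lerDl sumr_ge0.
pose dl := e / (e + 1 + F).
have s0 : 0 < e + 1 + F by lra.
have dl0 : 0 < dl by rewrite divr_gt0.
have dl1 : dl < 1 by rewrite ltr_pdivrMr//; lra.
have dlF : dl * F <= e by rewrite /dl mulrAC ler_pdivrMr//; nra.
exists (fun k => (1 - dl) * c k).
  have -> : quad pt (fun k => (1 - dl) * c k) = (1 - dl) ^+ 2 * quad pt c.
    rewrite /quad mulr_sumr; apply: eq_bigr => i _.
    by rewrite mulr_sumr; apply: eq_bigr => k _; ring.
  have : (1 - dl) ^+ 2 < 1 by rewrite exprn_ilt1//; lra.
  by move: ((1 - dl) ^+ 2) (sqr_ge0 (1 - dl)) => x x0 x1; nra.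
move=> i.
have -> : \sum_k (1 - dl) * c k * K (pt k) (pt i) = (1 - dl) * f (pt i).
  by rewrite -cK mulr_sumr; apply: eq_bigr => k _; rewrite mulrA.
rewrite (_ : _ - _ = - (dl * f (pt i))); last by ring.
rewrite normrN normrM gtr0_norm//; apply: le_trans dlF.
by rewrite ler_pM2l.
Qed.

Lemma quad_rat_approx n (pt : 'I_n -> S) (c : 'I_n -> R) (e : R) : 0 < e ->
  exists2 r : {ffun 'I_n -> rat}, (forall i, `|ratr (r i) - c i| <= e) &
    `|quad pt (fun i => ratr (r i)) - quad pt c| <= e.
Proof.
move=> e0; pose C := \sum_i `|c i|; have C0 : 0 <= C by exact: sumr_ge0.
pose Q := \sum_i \sum_k `|K (pt i) (pt k)|.
have Q0 : 0 <= Q by rewrite sumr_ge0// => i _; exact: sumr_ge0.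
pose s := e / (1 + e + (2 * C + 1) * Q).
have den0 : 0 < 1 + e + (2 * C + 1) * Q.
  by have : 0 <= (2 * C + 1) * Q by [rewrite mulr_ge0//; lra]; lra.
have s0 : 0 < s by rewrite divr_gt0.
have den1 : 0 <= (2 * C + 1) * Q by rewrite mulr_ge0//; lra.
have s1 : s <= 1 by rewrite /s ler_pdivrMr//; lra.
have se : s <= e by rewrite /s ler_pdivrMr// ler_peMr ?(ltW e0)//; lra.
have sQ : (2 * C + 1) * s * Q <= e.
  rewrite mulrAC /s mulrA ler_pdivrMr//.
  by move: den1; set D := (2 * C + 1) * Q => D0; nra.
have ap i : exists r : rat, `|ratr r - c i| <= s.
  have [r] := @rat_in_itvoo R (c i - s) (c i + s) ltac:(lra).
  rewrite in_itv/= => /andP[h1 h2]; exists r; rewrite ler_norml; apply/andP; split; lra.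
have [r0 hr0] := choice ap.
exists [ffun i => r0 i] => [i|]; first by rewrite ffunE (le_trans (hr0 i)).
have hr i : `|ratr ([ffun i => r0 i] i) - c i| <= s by rewrite ffunE.
move: ([ffun i => r0 i]) hr => r hr.
rewrite /quad -sumrB; apply: le_trans sQ; apply: (le_trans (ler_norm_sum _ _ _)).
rewrite /Q mulr_sumr; apply: ler_sum => i _.
rewrite -sumrB mulr_sumr; apply: (le_trans (ler_norm_sum _ _ _)); apply: ler_sum => k _.
rewrite -mulrBl normrM ler_wpM2r//.
have cC j : `|c j| <= C by rewrite /C (bigD1 j)//= lerDl sumr_ge0.
rewrite (_ : _ - _ = (ratr (r i) - c i) * (ratr (r k) - c k) + c i * (ratr (r k) - c k)
  + (ratr (r i) - c i) * c k); last by ring.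
apply: (le_trans (ler_normD _ _)); apply: (le_trans (lerD (ler_normD _ _) (lexx _))).
rewrite !normrM.
have a1 := hr i; have a2 := hr k; have a3 := cC i; have a4 := cC k.
have b1 : `|ratr (r i) - c i| * `|ratr (r k) - c k| <= s * s by exact: ler_pM.
have b2 : `|c i| * `|ratr (r k) - c k| <= C * s by exact: ler_pM.
have b3 : `|ratr (r i) - c i| * `|c k| <= s * C by exact: ler_pM.
have b4 : s * s <= s by rewrite ler_piMr// ltW.
lra.
Qed.

End finite_duality.

Lemma dist_via2 (R : realDomainType) (a b c d r s t : R) :
  `|a - c| <= r -> `|c - d| <= s -> `|b - d| <= t -> `|a - b| <= r + s + t.
Proof.
move=> h1 h2 h3; rewrite (_ : a - b = (a - c) + (c - d) - (b - d)); last by ring.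
by apply: (le_trans (ler_normB _ _)); apply: lerD => //; apply: (le_trans (ler_normD _ _)); exact: lerD.
Qed.

Section ell_infty_topology.
Context {S : Type} {R : realType}.
Implicit Types g h : ell_infty S R.

Lemma ell_dist_le g h (e : R) : 0 <= e -> (forall q, `|g q - h q| <= e) -> `|g - h| <= e.
Proof. by move=> e0 gh; apply: ell_norm_le. Qed.

Lemma ell_dist_ge g h q : `|g q - h q| <= `|g - h|.
Proof. exact: (ell_norm_ub (g - h) q). Qed.

Lemma bounded_mem (f : S -> R) (M : R) : (forall q, `|f q| <= M) -> f \in @bounded_pred S R.
Proof. by move=> fM; apply/bounded_predP; exists M. Qed.

Lemma ell_closureP (A : set (ell_infty S R)) h (e : R) : closure A h -> 0 < e ->
  exists2 g, A g & `|h - g| <= e.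
Proof.
move=> Ah e0; have [g [Ag]] := Ah _ (nbhsx_ballx h e e0).
by rewrite -ball_normE/= => /ltW hg; exists g.
Qed.

(** A sequence that is asymptotically determined, uniformly, by finitely many
    coordinates is relatively compact. *)
Lemma ell_precompact (X : nat -> ell_infty S R) (n0 : nat) (M : R)
    (pi : nat -> S -> S) (card : nat -> nat) (net : forall l, 'I_(card l) -> S) :
  (forall n q, `|X n q| <= M) ->
  (forall l q, exists i, pi l q = @net l i) ->
  (forall m : nat, exists L N, forall n, (N <= n)%N -> forall q,
     `|X n q - X n (pi L q)| <= m.+1%:R^-1) ->
  precompact [set X n | n in [set n | (n0 <= n)%N]].
Proof.
move=> XM pi_net osc; rewrite precompactE compact_ultra => F FU FA.
set A := [set X n | n in _] in FA *.
have FP : ProperFilter F by exact: ultra_proper.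
have clF h : F --> h -> closure A h.
  by move=> Fh; apply: closed_closure => U /Fh FU'; exact: filter_ex (filterI FA FU').
have clM h q : closure A h -> `|h q| <= M.
  move=> Ah; apply/ler_addgt0Pr => e e0.
  have [g [n _ <-] hg] := ell_closureP Ah e0.
  have := ell_dist_ge h (X n) q; have := XM n q.
  have := ler_normD (h q - X n q) (X n q); rewrite subrK; lra.
(* The equicontinuity of the tails extends to the closure of the sequence except
   possibly at the finitely many terms before the tail: either the ultrafilter
   charges finitely many terms, or it is equicontinuous at every scale. *)
have [[m [L [N [oN nF]]]]|allF] := pselect (exists m L N, (forall n, (N <= n)%N -> forall q,
     `|X n q - X n (pi L q)| <= m.+1%:R^-1) /\
     ~ F [set h : ell_infty S R | forall q, `|h q - h (pi L q)| <= m.+1%:R^-1]).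
  have FC : F [set X n | n in `I_N].
    have [//|h1] := in_ultra_setVsetC [set X n | n in `I_N] FU.
    have [//|h2] := in_ultra_setVsetC [set h : ell_infty S R | forall q, `|h q - h (pi L q)| <= m.+1%:R^-1] FU.
    have [h [[Ah h1h] h2h]] := filter_ex (filterI (filterI FA h1) h2).
    exfalso; apply: h2h => q; apply/ler_addgt0Pr => e e0.
    have fin_pos : exists2 e1 : R, 0 < e1 & forall n, (n < N)%N -> e1 <= `|h - X n|.
      elim: (N) h1h => [|k IHk] h1h; first by exists 1.
      have [|e1 e10 he1] := IHk; first by move=> [n nk hn]; apply: h1h; exists n => //; exact: ltnW.
      have d0 : 0 < `|h - X k|.
        rewrite normr_gt0 subr_eq0; apply/eqP => hk; apply: h1h; exists k => //.
        by rewrite /= ltnSn.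
      exists (Num.min e1 `|h - X k|); first by rewrite lt_min e10.
      move=> n; rewrite ltnS leq_eqVlt => /predU1P[->|/he1 h3]; first by rewrite ge_min lexx orbT.
      by rewrite ge_min h3.
    have [e1 e10 he1] := fin_pos.
    pose e2 := Num.min (e1 / 2) (e / 2).
    have e20 : 0 < e2 by rewrite lt_min !divr_gt0.
    have [g [n _ <-] hg] := ell_closureP Ah e20.
    have nN : (N <= n)%N.
      rewrite leqNgt; apply/negP => /he1; apply/negP; rewrite -ltNge.
      apply: (le_lt_trans hg); apply: (@le_lt_trans _ _ (e1 / 2)); first by rewrite ge_min lexx.
      by rewrite ltr_pdivrMr//; lra.
    have e2e : e2 <= e / 2 by rewrite ge_min lexx orbT.
    have d1 := ell_dist_ge h (X n) q; have d2 := ell_dist_ge h (X n) (pi L q).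
    have d3 := oN n nN q.
    have ar (s t u v : R) : s <= t -> t <= u / 2 -> s + v + s <= v + u by lra.
    exact: le_trans (dist_via2 d1 d3 d2) (ar _ _ _ _ hg e2e).
  have cI : compact [set X n | n in `I_N].
    by apply: finite_compact; apply: finite_image; exact: finite_II.
  have [h [[n nN <-] Fh]] : [set X n | n in `I_N] `&` [set h : ell_infty S R | F --> h] !=set0.
    by move: cI; rewrite compact_ultra; apply.
  by exists (X n); split => //; exact: clF.
have oscF (m : nat) : exists L, F [set h : ell_infty S R | forall q, `|h q - h (pi L q)| <= m.+1%:R^-1].
  have [L [N oN]] := osc m; exists L; apply: contrapT => nF; apply: allF.
  by exists m, L, N.
(* evaluations converge along the ultrafilter *)
have evF q : exists y : R, forall e : R, 0 < e -> F [set h : ell_infty S R | `|y - h q| <= e].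
  have cM : compact `[- M, M]%classic by exact: segment_compact.
  have FQ : ProperFilter ((fun h : ell_infty S R => h q) @ F) by exact: fmap_proper_filter.
  have [|y [_ cy]] := cM ((fun h : ell_infty S R => h q) @ F) FQ.
    have FM : F [set h : ell_infty S R | `[- M, M]%classic (h q)]; last exact: FM.
    by apply: filterS FA => h Ah /=; rewrite in_itv/=; move: (clM h q Ah); rewrite ler_norml.
  exists y => e e0.
  have [//|nF] := in_ultra_setVsetC [set h : ell_infty S R | `|y - h q| <= e] FU.
  have [z [/= hz bz]] := cy [set z | ~ `|y - z| <= e] (ball y e) nF (nbhsx_ballx y e e0).
  by exfalso; apply: hz; move: bz; rewrite /ball/= => /ltW.
have [y0 hy] := choice evF.
have y0M q : `|y0 q| <= M.
  apply/ler_addgt0Pr => e e0.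
  have [h [/= h1 h2]] := filter_ex (filterI FA (hy q e e0)).
  have := clM h q h1; have := ler_normD (y0 q - h q) (h q); rewrite subrK; lra.
pose y : ell_infty S R := EllInfty (bounded_mem y0M).
have Fy : F --> y.
  suff near_y (e : R) : 0 < e -> F [set h : ell_infty S R | `|y - h| <= e].
    move=> U /nbhs_ballP[e /= e0 yU]; have e2 : 0 < e / 2 by rewrite divr_gt0.
    apply: filterS (near_y _ e2) => h /= hy'; apply: yU; rewrite -ball_normE/=.
    by apply: (le_lt_trans hy'); rewrite ltr_pdivrMr// ltr_pMr// ltr1n.
  move=> e0.
  have [m me] : exists m : nat, m.+1%:R^-1 <= e / 4.
    exists (Num.truncn (4 / e)); rewrite -[leRHS]invrK lef_pV2 ?posrE ?invr_gt0 ?divr_gt0//.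
    by rewrite invf_div ltW// truncnS_gt.
  have [L FL] := oscF m.
  have Fnet : F [set h : ell_infty S R | forall i : 'I_(card L), `|y0 (@net L i) - h (@net L i)| <= e / 4].
    have FN := @filter_forall _ _ (fun (i : 'I_(card L)) (h : ell_infty S R) =>
      `|y0 (@net L i) - h (@net L i)| <= e / 4) F filter_filter (fun i => hy _ _ (divr_gt0 e0 (ltr0n R 4))).  
    exact: FN.
  have yL q : `|y0 q - y0 (pi L q)| <= e / 4.
    suff yLe (e1 : R) : 0 < e1 -> `|y0 q - y0 (pi L q)| <= e / 4 + e1 by exact/ler_addgt0Pr.
    move=> e10; have e12 : 0 < e1 / 2 by rewrite divr_gt0.
    have [h [[/= h1 h2] h3]] := filter_ex (filterI (filterI (hy q _ e12) (hy (pi L q) _ e12)) FL).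
    apply: le_trans (dist_via2 h1 (h3 q) h2) _.
    by rewrite addrAC -splitr addrC lerD2r.
  apply: filterS (filterI FL Fnet) => h [h1 h2].
  apply: ell_dist_le; first exact: ltW.
  move=> q; have [i pi_i] := pi_net L q; have h3 := h2 i; rewrite -pi_i in h3.
  apply: le_trans (dist_via2 (yL q) h3 (h1 q)) _.
  by apply: le_trans (lerD (lexx _) me) _; lra.
by exists y; split => //; exact: clF.
Qed.

End ell_infty_topology.


(** * The limit set of an equicontinuous sequence *)

Section limit_set.
Context {S : Type} {R : realType}.
Variable K : S -> S -> R.
Hypothesis K_sym : forall p q, K p q = K q p.
Hypothesis K_psd : forall n (pt : 'I_n -> S) (c : 'I_n -> R),
  0 <= \sum_i \sum_k c i * c k * K (pt i) (pt k).
Variable X : nat -> ell_infty S R.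
Variables (pi : nat -> S -> S) (card : nat -> nat) (net : forall l, 'I_(card l) -> S).
Variable V : R.
Hypothesis V_ge0 : 0 <= V.
Hypothesis K_le : forall q, K q q <= V ^+ 2.
Hypothesis pi_net : forall l q, exists i, pi l q = @net l i.
Hypothesis rho2_small : forall e : R, 0 < e ->
  exists L0, forall L, (L0 <= L)%N -> forall q, rho2 K q (pi L q) <= e.
Hypothesis X_up : forall L (r : {ffun 'I_(card L) -> rat}) (m : nat),
  exists N, forall n, (N <= n)%N ->
    \sum_i ratr (r i) * X n (net i) <=
      Num.sqrt (quad K (@net L) (fun i => ratr (r i))) + m.+1%:R^-1.
Hypothesis X_lo : forall L (r : {ffun 'I_(card L) -> rat}) (m : nat),
  quad K (@net L) (fun i => ratr (r i)) < 1 ->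
  forall N, exists2 n, (N <= n)%N & forall i,
    `|X n (net i) - \sum_k ratr (r k) * K (net k) (@net L i)| <= m.+1%:R^-1.
Hypothesis X_osc : forall m : nat, exists L0, forall L, (L0 <= L)%N ->
  exists N, forall n, (N <= n)%N -> forall q, `|X n q - X n (pi L q)| <= m.+1%:R^-1.

Lemma inv_nat_le (e : R) : 0 < e -> exists m : nat, m.+1%:R^-1 <= e.
Proof.
move=> e0; exists (Num.truncn e^-1).
by rewrite -[leRHS]invrK lef_pV2 ?posrE ?invr_gt0// ltW// truncnS_gt.
Qed.

Lemma scale_small (e C : R) : 0 < e -> exists2 s, 0 < s <= e & s * C <= e.
Proof.
move=> e0; have d0 : 0 < `|C| + 1 by rewrite ltr_wpDl.
exists (e / (`|C| + 1)); first by rewrite divr_gt0//= ler_pdivrMr// ler_peMr ?lerDr// ltW.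
rewrite mulrAC ler_pdivrMr// ler_pM2l//; have := ler_norm C; lra.
Qed.

Lemma K_cross_le p q : `|K p q| <= V ^+ 2.
Proof.
have h s : 0 <= K p p + 2 * s * K p q + s ^+ 2 * K q q.
  have := bf_ge0 K_psd [:: (1, p); (s, q)].
  by rewrite /bf !big_cons !big_nil/= (K_sym q p); lra.
have := h 1; have := h (-1); have := K_le p; have := K_le q.
by rewrite ler_norml expr1n sqrrN expr1n => h1 h2 h3 h4; apply/andP; split; lra.
Qed.

(** Positivity of [K] on three points, with a free third weight: a
    Cauchy-Schwarz inequality without square roots. *)
Lemma K_continuous p q r (e : R) : 0 < e -> rho2 K p q <= e ^+ 2 ->
  `|K p r - K q r| <= e * (1 + V ^+ 2).
Proof.
move=> e0 pq; have h s : 0 <= rho2 K p q + 2 * s * (K p r - K q r) + s ^+ 2 * K r r.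
  have := bf_ge0 K_psd [:: (1, p); (-1, q); (s, r)].
  by rewrite /bf /rho2 !big_cons !big_nil/= (K_sym q p) (K_sym r p) (K_sym r q); lra.
have h1 := h e; have h2 := h (- e); have K0 := K_le r.
move: h1 h2; set D := K p r - K q r; rewrite sqrrN => h1 h2.
have e2 : e ^+ 2 * K r r <= e ^+ 2 * V ^+ 2 by rewrite ler_wpM2l ?sqr_ge0.
have V2 := sqr_ge0 V; move: (V ^+ 2) V2 e2 => V2 V20 e2.
rewrite ler_norml; apply/andP; split; rewrite -(ler_pM2l e0); nra.
Qed.

Lemma unit_ball_continuous f p q (e : R) : nsq_le K f 1 -> 0 < e -> rho2 K p q <= e ^+ 2 ->
  `|f p - f q| <= e.
Proof.
move=> f1 e0 pq; have h s := ev_sqr_le K_sym [:: (1, p); (-1, q)] s f1.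
have bE : bf K [:: (1, p); (-1, q)] [:: (1, p); (-1, q)] = rho2 K p q.
  by rewrite /bf /rho2 !big_cons !big_nil/= (K_sym q p); ring.
have eE : ev [:: (1, p); (-1, q)] f = f p - f q.
  by rewrite /ev !big_cons !big_nil/=; ring.
have h1 := h e^-1; have h2 := h (- e^-1).
rewrite bE eE sqrrN exprVn in h1 h2.
have r1 : (e ^+ 2)^-1 * rho2 K p q <= 1 by rewrite mulrC ler_pdivrMr ?exprn_gt0// mul1r.
have ei : 0 < e^-1 by rewrite invr_gt0.
have u1 : e^-1 * (f p - f q) <= 1 by lra.
have u2 : e^-1 * (f q - f p) <= 1 by lra.
rewrite ler_norml; apply/andP; split.
  by rewrite -lerN2 opprK opprB; move: u2; rewrite mulrC ler_pdivrMr// mul1r.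
by move: u1; rewrite mulrC ler_pdivrMr// mul1r.
Qed.

Lemma pi_close (e : R) : 0 < e -> exists L0, forall L, (L0 <= L)%N ->
  (forall q, rho2 K q (pi L q) <= e ^+ 2) /\
  exists N, forall n, (N <= n)%N -> forall q, `|X n q - X n (pi L q)| <= e.
Proof.
move=> e0; have [m me] := inv_nat_le e0.
have [L1 h1] := X_osc m; have [L2 h2] := rho2_small (exprn_gt0 2 e0).
exists (maxn L1 L2) => L; rewrite geq_max => /andP[L1L L2L]; split; first exact: h2.
have [N HN] := h1 L L1L; exists N => n Nn q; exact: le_trans (HN n Nn q) me.
Qed.

(** Each function of the unit ball is approached: on a fine net by the lower
    law of the iterated logarithm, and elsewhere by equicontinuity. *)
Lemma unit_ball_approached f (e : R) : nsq_le K f 1 -> 0 < e ->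
  forall N, exists2 n, (N <= n)%N & forall q, `|X n q - f q| <= e.
Proof.
move=> f1 e0 N; have e8 : 0 < e / 8 by rewrite divr_gt0.
have [L /(_ L (leqnn L))[rhoL [N1 oscL]]] := pi_close e8.
have [c c1 cf] := finite_duality K_sym K_psd (@net L) f1 e8.
have dq : 0 < Num.min ((1 - quad K (@net L) c) / 2) (e / 8).
  by rewrite lt_min e8 divr_gt0// subr_gt0.
have [s /andP[s0 sd] sC] := scale_small ((card L)%:R * V ^+ 2) dq.
move: sd sC; rewrite !le_min => /andP[s1 s2] /andP[_ s3].
have [r rc rq] := quad_rat_approx K (@net L) c s0.
have q1 : quad K (@net L) (fun i => ratr (r i)) < 1.
  by move: rq; rewrite ler_norml => /andP[_]; move: c1 s1; lra.
have [m me] := inv_nat_le e8.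
have [n nN Xn] := X_lo m q1 (maxn N N1).
move: nN; rewrite geq_max => /andP[Nn N1n]; exists n => // q.
have [i qi] := pi_net L q.
have rcK : `|\sum_k ratr (r k) * K (net k) (@net L i) - \sum_k c k * K (net k) (@net L i)| <= e / 8.
  apply: le_trans s3; rewrite -sumrB; apply: (le_trans (ler_norm_sum _ _ _)).
  apply: (@le_trans _ _ (\sum_(k < card L) s * V ^+ 2)).
    by apply: ler_sum => k _; rewrite -mulrBl normrM ler_pM// K_cross_le.
  by rewrite sumr_const card_ord -[leLHS]mulr_natl mulrCA.
have d1 := oscL n N1n q; have d2 := le_trans (Xn i) me; have d3 := cf i.
have d4 := unit_ball_continuous f1 e8 (rhoL q).
rewrite -qi in d2 d3 rcK; rewrite distrC in d4.
have ar (x y z u v : R) : `|x - y| <= e / 8 -> `|y - z| <= e / 8 -> `|z - u| <= e / 8 ->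
    `|u - f (pi L q)| <= e / 8 -> `|f (pi L q) - v| <= e / 8 -> `|x - v| <= e.
  move=> h1 h2 h3 h4 h5.
  rewrite (_ : x - v = (x - y) + (y - z) + (z - u) + (u - f (pi L q)) + (f (pi L q) - v)); last by ring.
  do !apply: (le_trans (ler_normD _ _)); apply: (@le_trans _ _ (e / 8 + e / 8 + e / 8 + e / 8 + e / 8)); last by lra.
  do 4!(apply: lerD => //; do !apply: (le_trans (ler_normD _ _))).
exact: ar d1 d2 rcK d3 d4.
Qed.

(** On a net the bound is the upper law for single points with signs [1] and
    [-1]. *)
Lemma sup_upper (e : R) : 0 < e ->
  exists N, forall n, (N <= n)%N -> forall q, `|X n q| <= V + e.
Proof.
move=> e0; have e2 : 0 < e / 2 by rewrite divr_gt0.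
have [L /(_ L (leqnn L))[_ [N1 oscL]]] := pi_close e2.
have [m me] := inv_nat_le e2.
have side (s : rat) : s ^+ 2 = 1 -> forall i : 'I_(card L), exists N, forall n, (N <= n)%N ->
    ratr s * X n (net i) <= V + e / 2.
  move=> s2 i; have [N HN] := X_up [ffun k => if k == i then s else 0] m; exists N => n Nn.
  have r2 : ratr s * ratr s = 1 :> R by rewrite -rmorphM -expr2 s2 rmorph1.
  have sE (F : 'I_(card L) -> R) :
      \sum_k ratr ([ffun k => if k == i then s else 0] k) * F k = ratr s * F i.
    rewrite (bigD1 i)//= big1 ?addr0 ?ffunE ?eqxx// => k ki.
    by rewrite ffunE (negPf ki) rmorph0 mul0r.
  have := HN n Nn; rewrite sE => h; apply: (le_trans h); apply: lerD => //.
  rewrite /quad; under eq_bigr do under eq_bigr do rewrite -mulrA.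
  under eq_bigr do rewrite -mulr_sumr; rewrite sE sE mulrA r2 mul1r.
  by rewrite -[leRHS](ger0_norm V_ge0) -sqrtr_sqr ler_wsqrtr.
have [N2 HN2] := choice (side 1 (expr1n _ _)).
have [N3 HN3] := choice (side (-1) (etrans (sqrrN 1) (expr1n _ _))).
exists (maxn N1 (maxn (\max_i N2 i) (\max_i N3 i))) => n; rewrite !geq_max => /and3P[n1 n2 n3] q.
have [i qi] := pi_net L q; have d1 := oscL n n1 q.
have d2 := HN2 i n (leq_trans (leq_bigmax i) n2); have d3 := HN3 i n (leq_trans (leq_bigmax i) n3).
rewrite rmorph1 mul1r -qi in d2; rewrite rmorphN1 mulN1r -qi in d3.
move: d1; rewrite !ler_norml => /andP[h1 h2]; apply/andP; split; lra.
Qed.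

Lemma processes_bounded : exists M, forall n q, `|X n q| <= M.
Proof.
have [N HN] := sup_upper ltr01; pose Z (n : 'I_N) := ell_norm (X n).
have [c c0 hc] := finite_bounded Z; exists (c + (V + 1)) => n q.
have [/HN/(_ q)|nN] := leqP N n; first by move: c0 V_ge0; lra.
have := le_trans (ell_norm_ub (X n) q) (le_trans (ler_norm _) (hc (Ordinal nN))).
by move: V_ge0; lra.
Qed.

(** The normalized kernel function of [q] belongs to the unit ball, and its value
    at [q] is the square root of [K q q]. *)
Lemma sup_lower q (e : R) : 0 < e ->
  forall N, exists2 n, (N <= n)%N & Num.sqrt (K q q) - e <= `|X n q|.
Proof.
move=> e0 N; have K0 : 0 <= K q q.
  by have := bf_ge0 K_psd [:: (1, q)]; rewrite /bf !big_cons !big_nil/=; lra.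
have [K1|Kpos] := leP (K q q) 0.
  exists N => //; rewrite (_ : K q q = 0); last by apply/eqP; rewrite eq_le K1.
  by rewrite sqrtr0; have := normr_ge0 (X N q); lra.
have s0 : 0 < Num.sqrt (K q q) by rewrite sqrtr_gt0.
have Kball : nsq_le K (K q) (K q q).
  move=> a; have := bf_ge0 K_psd (a ++ [:: (-1, q)]).
  rewrite !bf_catl !(bf_catr K_sym) (bf_sym K_sym _ a) (bf_ev K_sym) bf1 /val2; lra.
have f1 : nsq_le K ((Num.sqrt (K q q))^-1 *: K q) 1.
  have := nsq_leZ K_sym K_psd (Num.sqrt (K q q))^-1 Kball.
  by rewrite exprVn sqr_sqrtr// mulVf// lt0r_neq0.
have [n Nn hn] := unit_ball_approached f1 e0 N; exists n => //.
have := hn q; rewrite (_ : (_ *: K q) q = Num.sqrt (K q q)); last first.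
  change ((Num.sqrt (K q q))^-1 * K q q = Num.sqrt (K q q)).
  by rewrite -{2}(sqr_sqrtr K0) expr2 mulrA mulVf ?mul1r// lt0r_neq0.
by rewrite ler_norml => /andP[h _]; have := ler_norm (X n q); lra.
Qed.

(** On a net, the upper laws with rational coefficients bound a limit point
    by the kernel norm; other points are replaced by nearby points of a net. *)
Lemma limit_point_nsq_le (g : S -> R) :
  (forall e : R, 0 < e -> forall N, exists2 n, (N <= n)%N & forall q, `|X n q - g q| <= e) ->
  nsq_le K g 1.
Proof.
move=> Xg.
have sum_close n (x y c : 'I_n -> R) (s : R) : (forall i, `|x i - y i| <= s) ->
    \sum_i x i * c i <= \sum_i y i * c i + s * \sum_i `|c i|.
  move=> xy; rewrite mulr_sumr -big_split/=; apply: ler_sum => i _.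
  rewrite -lerBlDl -mulrBl; apply: (le_trans (ler_norm _)); rewrite normrM.
  by rewrite ler_wpM2r.
(* on a net: rational coefficients close to [b], and an index at which [X n] is
   close to [g] *)
have onnet L (b : 'I_(card L) -> R) : 2 * \sum_i b i * g (net i) - quad K (@net L) b <= 1.
  suff h (e : R) : 0 < e -> 2 * \sum_i b i * g (net i) - quad K (@net L) b <= 1 + e by exact/ler_addgt0Pr.
  move=> e0; have e8 : 0 < e / 8 by rewrite divr_gt0.
  have [s /andP[s0 s1] sC] := scale_small (\sum_i `|g (@net L i)|) e8.
  have [r rb rq] := quad_rat_approx K (@net L) b s0.
  have [t /andP[t0 t1] tC] := scale_small (\sum_i `|ratr (r i)| : R) e8.
  have [m me] := inv_nat_le e8; have [N HN] := X_up r m.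
  have [n Nn Xn] := Xg t t0 N.
  have h1 := le_trans (HN n Nn) (lerD (lexx _) me).
  have h2 : \sum_i b i * g (@net L i) <= \sum_i ratr (r i) * g (net i) + e / 8.
    have sc i : `|b i - ratr (r i)| <= s by rewrite distrC.
    by apply: le_trans (sum_close _ _ _ (fun i => g (net i)) s sc) _; rewrite lerD2l.
  have h3 : \sum_i ratr (r i) * g (@net L i) <= \sum_i ratr (r i) * X n (net i) + e / 8.
    have sc i : `|g (@net L i) - X n (net i)| <= t by rewrite distrC.
    have := sum_close _ _ _ (fun i => ratr (r i)) t sc.
    under eq_bigr do rewrite mulrC; under [X in _ <= X + _]eq_bigr do rewrite mulrC.
    by move=> h; apply: le_trans h _; rewrite lerD2l.
  have qr0 : 0 <= quad K (@net L) (fun i => ratr (r i)) by exact: K_psd.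
  have h4 : 2 * Num.sqrt (quad K (@net L) (fun i => ratr (r i))) <= 1 + quad K (@net L) (fun i => ratr (r i)).
    rewrite -{2}(sqr_sqrtr qr0); have := sqr_ge0 (Num.sqrt (quad K (@net L) (fun i => ratr (r i))) - 1).
    by move: (Num.sqrt _) => x; nra.
  move: rq; rewrite ler_norml => /andP[_ h5].
  move: h1 h2 h3 h4 h5 s1.
  set a1 := \sum_i _; set a2 := \sum_i _; set a3 := \sum_i _.
  set q1 := quad _ _ _; set q2 := quad _ _ _; set q3 := Num.sqrt _; lra.
have g_osc (e : R) : 0 < e -> exists L0, forall L, (L0 <= L)%N -> forall q, `|g q - g (pi L q)| <= e.
  move=> e0; have e3 : 0 < e / 3 by rewrite divr_gt0.
  have [L0 HL] := pi_close e3; exists L0 => L /HL[_ [N oN]] q.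
  have [n Nn Xn] := Xg _ e3 N.
  have h1 := Xn q; have h2 := Xn (pi L q); rewrite distrC in h1; rewrite distrC in h2.
  by apply: le_trans (dist_via2 h1 (oN n Nn q) h2) _; lra.
apply: fd_nsq_le => n pt c.
suff h (e : R) : 0 < e -> 2 * \sum_i c i * g (pt i) - quad K pt c <= 1 + e by exact/ler_addgt0Pr.
move=> e0; have e4 : 0 < e / 4 by rewrite divr_gt0.
pose C := \sum_i `|c i|.
have C0 : 0 <= C by exact: sumr_ge0.
have [s /andP[s0 _] sC] := scale_small C e4.
have [t /andP[t0 _] tC] := scale_small ((1 + V ^+ 2) * 2 * C * C) e4.
have [L1 HL1] := g_osc s s0; have [L2 HL2] := pi_close t0.
pose L := maxn L1 L2.
have gL q : `|g q - g (pi L q)| <= s by apply: HL1; exact: leq_maxl.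
have [rL _] := HL2 L (leq_maxr _ _).
have [idx hidx] := choice (fun i => pi_net L (pt i)).
(* the weights of all points with the same nearest net point are added up *)
pose b j := \sum_(i | idx i == j) c i.
have sum_idx (F : 'I_(card L) -> R) : \sum_j b j * F j = \sum_i c i * F (idx i).
  rewrite [RHS](partition_big idx xpredT)//=; apply: eq_bigr => j _.
  by rewrite /b mulr_suml; apply: eq_bigr => i /eqP ->.
have qb : quad K (@net L) b = \sum_i \sum_k c i * c k * K (pi L (pt i)) (pi L (pt k)).
  rewrite /quad; under eq_bigr do under eq_bigr do rewrite -mulrA.
  under eq_bigr do rewrite -mulr_sumr; rewrite (sum_idx (fun j => \sum_i b i * K (net j) (net i))).
  apply: eq_bigr => i _; rewrite (sum_idx (fun k => K (net (idx i)) (net k))) mulr_sumr.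
  by apply: eq_bigr => k _; rewrite !hidx mulrA.
have h1 : \sum_i c i * g (pt i) <= \sum_j b j * g (net j) + e / 4.
  rewrite sum_idx; under [X in _ <= X + _]eq_bigr do rewrite -hidx.
  apply: le_trans (_ : _ <= \sum_i c i * g (pi L (pt i)) + s * C) _; last by rewrite lerD2l.
  rewrite mulr_sumr -big_split/=; apply: ler_sum => i _.
  rewrite -lerBlDl -mulrBr; apply: (le_trans (ler_norm _)); rewrite normrM mulrC.
  by rewrite ler_wpM2r.
have h2 : quad K (@net L) b <= quad K pt c + e / 4.
  rewrite qb; apply: le_trans (_ : _ <= quad K pt c + t * ((1 + V ^+ 2) * 2 * C * C)) _; last by rewrite lerD2l.
  rewrite -lerBlDl /quad -sumrB.
  have -> : t * ((1 + V ^+ 2) * 2 * C * C) = \sum_i `|c i| * (t * (1 + V ^+ 2) * 2 * C).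
    by rewrite -mulr_suml -/C; ring.
  apply: ler_sum => i _; rewrite -sumrB /C !mulr_sumr; apply: ler_sum => k _.
  rewrite -mulrBr; apply: (le_trans (ler_norm _)); rewrite !normrM.
  rewrite (_ : `|c i| * (_ * `|c k|) = `|c i| * `|c k| * (t * (1 + V ^+ 2) * 2)); last by ring.
  rewrite ler_wpM2l ?mulr_ge0//.
  have k1 := K_continuous (pi L (pt k)) t0 (rL (pt i)).
  have k2 := K_continuous (pt i) t0 (rL (pt k)).
  rewrite (K_sym (pt k)) (K_sym _ (pt i)) in k2.
  rewrite (_ : K (pi L (pt i)) (pi L (pt k)) - K (pt i) (pt k)
    = - (K (pt i) (pi L (pt k)) - K (pi L (pt i)) (pi L (pt k))) - (K (pt i) (pt k) - K (pt i) (pi L (pt k)))); last by ring.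
  by apply: (le_trans (ler_normB _ _)); rewrite normrN; lra.
have := onnet L b; move: h1 h2; move: (\sum_i _) (\sum_j _) (quad _ _ _) (quad _ _ _) => x1 x2 x3 x4; lra.
Qed.

(** The subsequence for a point of the ball is chosen recursively, each index
    being larger than the preceding one and correct up to [1 / (k + 1)]. *)
Lemma limit_set_unit_ball : [set ell_fun h | h in limit_set X] = rkhs_unit_ball K.
Proof.
apply/seteqP; split => [_ [h [phi phi_inc /cvgrPdist_le Xh]] <-|f /(rkhs_unit_ball_nsq K_sym K_psd) f1].
  apply/(rkhs_unit_ball_nsq K_sym K_psd)/limit_point_nsq_le => e e0 N.
  have [N1 _ HN1] := Xh e e0; exists (phi (maxn N N1)).
    have id_le k : (k <= phi k)%N.
      elim: k => // k IHk; apply: (leq_ltn_trans IHk).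
      by rewrite (leqW_mono phi_inc).
    exact: leq_trans (leq_maxl _ _) (id_le _).
  move=> q; have := HN1 (maxn N N1) (leq_maxr _ _); rewrite distrC.
  by apply: le_trans; exact: ell_dist_ge.
have f_bd : f \in @bounded_pred S R.
  have [M XM] := processes_bounded; apply: (@bounded_mem _ _ _ (M + 1)) => q.
  have [n _ /(_ q)] := unit_ball_approached f1 ltr01 0.
  by have := XM n q; rewrite !ler_norml => /andP[h1 h2] /andP[h3 h4]; apply/andP; split; lra.
exists (EllInfty f_bd) => //.
have step (kN : nat * nat) : exists n, (kN.2 <= n)%N /\ forall q, `|X n q - f q| <= kN.1.+1%:R^-1.
  have k0 : 0 < kN.1.+1%:R^-1 :> R by rewrite invr_gt0.
  by have [n Nn hn] := unit_ball_approached f1 k0 kN.2; exists n.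
have [nx hnx] := choice step.
pose phi := fix phi k := if k is k'.+1 then nx (k, (phi k').+1) else nx (0%N, 0%N).
have phi_lt k : (phi k < phi k.+1)%N by have [] := hnx (k.+1, (phi k).+1).
exists phi.
  apply/increasing_seqP => k; exact: phi_lt.
apply/cvgrPdist_le => e e0; have [m me] := inv_nat_le e0; exists m => // k /= mk.
rewrite distrC; apply: ell_dist_le; first exact: ltW.
move=> q; apply: (@le_trans _ _ k.+1%:R^-1).
  by case: k {mk} => [|k] /=; [have [_] := hnx (0%N, 0%N)|have [_] := hnx (k.+1, (phi k).+1)]; exact.
by apply: le_trans me; rewrite lef_pV2 ?posrE// ler_nat ltnS.
Qed.

End limit_set.


(** * The compact law of the iterated logarithm *)

Section lil_compact.
Context d (Omega : measurableType d) (R : realType) (P : probability Omega R).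
Context {S : Type} (phi : nat -> S -> Omega -> R) (K : S -> S -> R) (W V : R).
Hypothesis fd : finite_dimensional P phi K W.
Hypothesis W_gt0 : 0 < W.
Hypothesis V_ge0 : 0 <= V.
Hypothesis K_le : forall q, K q q <= V ^+ 2.
Variables (pi : nat -> S -> S) (card : nat -> nat) (net : forall l, 'I_(card l) -> S).
Variables (c0 C1 C2 g : R) (A0 l1 : nat).
Hypotheses (c0_ge0 : 0 <= c0) (C1_ge0 : 0 <= C1) (C2_ge0 : 0 <= C2).
Hypotheses (g01 : 0 < g < 1) (A0_gt0 : (0 < A0)%N).
Hypothesis pi_net : forall l q, exists i, pi l q = @net l i.
Hypothesis card_net : forall l, (card l)%:R <= expR (c0 * l.+1%:R).
Hypothesis rho2_net : forall l q, (l1 <= l)%N -> rho2 K q (pi l q) <= C1 * g ^+ l.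
Hypothesis fine_net : {ae P, forall w, exists k0, forall k, (k0 <= k)%N ->
  forall n q, (n <= 2 ^ k)%N ->
    `|psum phi n q w - psum phi n (pi (A0 * k) q) w| <= C2 * k.+1%:R}.
Variable X : Omega -> nat -> ell_infty S R.
Hypothesis X_def : forall w n q, expR 1 < n%:R :> R -> X w n q = psum phi n q w / lilr n%:R.

Lemma rho2_small (e : R) : 0 < e ->
  exists L0, forall L, (L0 <= L)%N -> forall q, rho2 K q (pi L q) <= e.
Proof.
move=> e0; have C0 : 0 <= C1 / e by rewrite divr_ge0// ltW.
have [L1 _ HL1] := poly_geometric_small 0 g01 C0.
exists (maxn l1 L1) => L; rewrite geq_max => /andP[l1L L1L] q.
apply: (le_trans (rho2_net q l1L)); have := HL1 L L1L.
by rewrite /= expr0 mulr1 mulrAC ler_pdivrMr// mul1r.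
Qed.

Let n1 := (Num.truncn (expR 1 : R)).+1.

Let n1P n : (n1 <= n)%N -> expR 1 < n%:R :> R.
Proof. by move=> n1n; apply: lt_le_trans (truncnS_gt _) _; rewrite ler_nat. Qed.

(** The three laws of the iterated logarithm that are used, for countably many
    choices of parameters, hold simultaneously on one almost sure event. *)
Lemma lil_laws : {ae P, forall w,
  [/\ forall L (r : {ffun 'I_(card L) -> rat}) (m : nat),
        exists N, forall n, (N <= n)%N ->
          \sum_i ratr (r i) * X w n (net i) <=
            Num.sqrt (quad K (@net L) (fun i => ratr (r i))) + m.+1%:R^-1,
      forall L (r : {ffun 'I_(card L) -> rat}) (m : nat),
        quad K (@net L) (fun i => ratr (r i)) < 1 ->
        forall N, exists2 n, (N <= n)%N & forall i,
          `|X w n (net i) - \sum_k ratr (r k) * K (net k) (@net L i)| <= m.+1%:R^-1 &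
      forall m : nat, exists L0, forall L, (L0 <= L)%N ->
        exists N, forall n, (N <= n)%N ->
          forall q, `|X w n q - X w n (pi L q)| <= m.+1%:R^-1]}.
Proof.
have m0 (m : nat) : 0 < m.+1%:R^-1 :> R by rewrite invr_gt0.
have up : {ae P, forall w, forall L (r : {ffun 'I_(card L) -> rat}) (m : nat),
    exists N, forall n, (N <= n)%N -> \sum_i ratr (r i) * X w n (net i) <=
      Num.sqrt (quad K (@net L) (fun i => ratr (r i))) + m.+1%:R^-1}.
  apply: ae_forall_countable => L; apply: ae_forall_countable => r.
  apply: ae_forall_countable => m.
  have := upper_lil_fd fd (@net L) (fun i => ratr (r i)) (m0 m).
  apply: filterS => w [N HN]; exists (maxn N n1) => n; rewrite geq_max => /andP[Nn /n1P n3].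
  have l0 := lilr_gt0 n3; have := HN n Nn; rewrite -ler_pdivrMr//; apply: le_trans.
  rewrite mulr_suml le_eqVlt; apply/orP; left; apply/eqP; apply: eq_bigr => i _.
  by rewrite X_def// mulrA.
have lo : {ae P, forall w, forall L (r : {ffun 'I_(card L) -> rat}) (m : nat),
    quad K (@net L) (fun i => ratr (r i)) < 1 ->
    forall N, exists2 n, (N <= n)%N & forall i,
      `|X w n (net i) - \sum_k ratr (r k) * K (net k) (@net L i)| <= m.+1%:R^-1}.
  apply: ae_forall_countable => L; apply: ae_forall_countable => r.
  apply: ae_forall_countable => m.
  have [q1|q1] := pselect (quad K (@net L) (fun i => ratr (r i)) < 1); last first.
    by apply: aeW => w /q1.
  have := lower_lil_fd fd (m0 m) q1; apply: filterS => w Hw _ N.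
  have [n] := Hw (maxn N n1); rewrite geq_max => /andP[Nn /n1P n3] hn; exists n => // i.
  have l0 := lilr_gt0 n3; have := hn i; rewrite -ler_pdivrMr//; apply: le_trans.
  rewrite -[X in _ <= _ / X](gtr0_norm l0) -normfV -normrM mulrBl mulfK ?lt0r_neq0//.
  by rewrite X_def.
have osc : {ae P, forall w, forall m : nat, exists L0, forall L, (L0 <= L)%N ->
    exists N, forall n, (N <= n)%N -> forall q, `|X w n q - X w n (pi L q)| <= m.+1%:R^-1}.
  apply: ae_forall_countable => m.
  have [L0 HL0] := lil_equicontinuity fd W_gt0 c0_ge0 C1_ge0 C2_ge0 g01 A0_gt0 pi_net
    card_net rho2_net fine_net (m0 m).
  suff : {ae P, forall w, forall L, (L0 <= L)%N -> exists N, forall n, (N <= n)%N ->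
      forall q, `|X w n q - X w n (pi L q)| <= m.+1%:R^-1}.
    by apply: filterS => w Hw; exists L0.
  apply: ae_forall_countable => L; have [L0L|LL0] := leqP L0 L; last first.
    by apply: aeW.
  have := HL0 L L0L; apply: filterS => w [N HN] _.
  exists (maxn N n1) => n; rewrite geq_max => /andP[Nn /n1P n3] q.
  have l0 := lilr_gt0 n3; have := HN n Nn q; rewrite -ler_pdivrMr//; apply: le_trans.
  rewrite -[X in _ <= _ / X](gtr0_norm l0) -normfV -normrM mulrBl.
  by rewrite !X_def.
by apply: filterS2 up (filterI lo osc) => w h1 [h2 h3]; split.
Qed.

Lemma lil_compactness : {ae P, forall w,
  precompact [set X w n | n in [set n | (3 <= n)%N]] /\
  [set ell_fun h | h in limit_set (X w)] = rkhs_unit_ball K}.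
Proof.
have Ks := cov_sym fd; have Kp := cov_psd fd.
apply: filterS lil_laws => w [up lo osc]; split; last first.
  exact: (limit_set_unit_ball Ks Kp V_ge0 K_le pi_net rho2_small up lo osc).
have [M XM] := processes_bounded V_ge0 K_le pi_net rho2_small up osc.
by apply: ell_precompact XM pi_net _ => m; have [L0 /(_ L0 (leqnn _))] := osc m; exists L0.
Qed.

Lemma lil_sup : {ae P, forall w,
  (forall e : R, 0 < e -> exists N, forall n, (N <= n)%N -> forall q, `|X w n q| <= V + e) /\
  (forall q (e : R), 0 < e -> forall N, exists2 n, (N <= n)%N &
     Num.sqrt (K q q) - e <= `|X w n q|)}.
Proof.
have Ks := cov_sym fd; have Kp := cov_psd fd.
apply: filterS lil_laws => w [up lo osc]; split => [e|q e].
  exact: (sup_upper V_ge0 K_le pi_net rho2_small up osc).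
exact: (sup_lower Ks Kp K_le pi_net rho2_small lo osc).
Qed.

End lil_compact.


(** * The weighted indicator processes and their covariance *)

Section summands.
Context d (Omega : measurableType d) (R : realType) (P : probability Omega R).
Variables (T kappa : R) (B : nat -> R -> {RV P >-> R}).
Hypotheses (kappa_gt0 : 0 < kappa) (B_iid : iid_processes B).
Local Notation S := (set_type (time_space T)).
Implicit Types q r : S.

Definition tm q : R := (\val q).1.
Definition lv q : R := (\val q).2.
Definition wgt q : R := tm q `^ kappa.
Definition below j q : set Omega := [set w | B j (tm q) w <= lv q].
Definition cdf q : R := marginal_cdf (B 0%N) (tm q) (lv q).
Definition joint q r : R := fine (P (below 0 q `&` below 0 r)).
Definition summand j q w : R := wgt q * (\1_(below j q) w - cdf q).
Definition fcov q r : R := weighted_covariance kappa (B 0%N) (\val q) (\val r).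

Lemma fcovE q r : fcov q r = wgt q * wgt r * (joint q r - cdf q * cdf r).
Proof. by []. Qed.

Lemma tm_itv q : 0 <= tm q <= T.
Proof. by have [/= h _] := set_valP q; move: h; rewrite in_itv. Qed.

Lemma tm_ge0 q : 0 <= tm q. Proof. by have /andP[] := tm_itv q. Qed.

Lemma wgt_ge0 q : 0 <= wgt q. Proof. exact: powR_ge0. Qed.

Lemma wgt_le q : wgt q <= T `^ kappa.
Proof.
have /andP[q0 qT] := tm_itv q.
by rewrite ge0_ler_powR ?nnegrE ?(ltW kappa_gt0)// (le_trans q0).
Qed.

Lemma measurable_RV_in j t (D : set R) : measurable D -> measurable [set w | D (B j t w)].
Proof. by move=> mD; have := measurable_funPT (B j t) measurableT _ mD; rewrite setTI. Qed.

Lemma measurable_below j q : measurable (below j q).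
Proof.
rewrite (_ : below j q = [set w | `]-oo, lv q]%classic (B j (tm q) w)]).
  by apply: measurable_RV_in; exact: measurable_itv.
by apply/seteqP; split => w; rewrite /below/= in_itv.
Qed.

Lemma fine_prob_itv (E : set Omega) : measurable E -> 0 <= fine (P E) <= 1.
Proof.
by move=> mE; rewrite fine_ge0//= -lee_fin fineK ?fin_num_measure// probability_le1.
Qed.

Lemma cdf_itv q : 0 <= cdf q <= 1.
Proof. exact: (fine_prob_itv (measurable_below 0 q)). Qed.

Lemma joint_le q r : 0 <= joint q r <= cdf q /\ joint q r <= cdf r.
Proof.
have mq := measurable_below 0 q; have mr := measurable_below 0 r.
have mqr := measurableI _ _ mq mr.
have le1 (A C : set Omega) : measurable A -> measurable C -> A `<=` C -> fine (P A) <= fine (P C).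
  by move=> mA mC AC; rewrite fine_le ?fin_num_measure// le_measure ?inE.
split; last by apply: le1 mqr mr _; exact: subIsetr.
apply/andP; split; first by have /andP[] := fine_prob_itv mqr.
by apply: le1 mqr mq _; exact: subIsetl.
Qed.

Lemma joint_self q : joint q q = cdf q.
Proof. by rewrite /joint setIid. Qed.

(** At finitely many points the summands are functions of the pattern of the
    indicators. *)
Lemma summand_finite_dimensional : finite_dimensional P summand fcov (T `^ kappa).
Proof.
move=> n pt; pose D i := [set` `]-oo, lv (pt i)]].
have mD i : measurable (D i) by exact: measurable_itv.
have t0 i : 0 <= tm (pt i) by exact: tm_ge0.
pose t i := tm (pt i); pose f i (a : {ffun 'I_n -> bool}) := wgt (pt i) * ((a i)%:R - cdf (pt i)).
exists {ffun 'I_n -> bool}, (pattern B t D), (pattern_law B t D), f.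
have patE j i w : pattern B t D j w i = (w \in below j (pt i)).
  by rewrite ffunE /D/= in_itv/=; apply/asboolP/idP; rewrite inE.
have law1 i : \sum_a pattern_law B t D a * (a i)%:R = cdf (pt i).
  rewrite (eq_bigr (fun a : {ffun 'I_n -> bool} => if a i then pattern_law B t D a else 0)); last first.
    by move=> a _; case: (a i); rewrite ?mulr1 ?mulr0.
  rewrite -big_mkcond/=; apply: EFin_inj.
  rewrite (pattern_law_sum B_iid t0 mD (fun a : {ffun 'I_n -> bool} => a i)) /cdf /marginal_cdf.
  rewrite fineK ?fin_num_measure//; last exact: (measurable_below 0 (pt i)).
  by congr (P _); apply/seteqP; split => w /=; rewrite patE inE.
have law2 i k : \sum_a pattern_law B t D a * ((a i)%:R * (a k)%:R) = joint (pt i) (pt k).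
  rewrite (eq_bigr (fun a : {ffun 'I_n -> bool} => if a i && a k then pattern_law B t D a else 0)); last first.
    by move=> a _; case: (a i); case: (a k); rewrite ?mulr1 ?mulr0.
  rewrite -big_mkcond/=; apply: EFin_inj.
  rewrite (pattern_law_sum B_iid t0 mD (fun a : {ffun 'I_n -> bool} => a i && a k)) /joint.
  rewrite fineK ?fin_num_measure//; last by apply: measurableI; exact: measurable_below.
  congr (P _); apply/seteqP; split => w /=; rewrite !patE.
    by move=> /andP[/set_mem ? /set_mem ?].
  by move=> [? ?]; apply/andP; split; apply/mem_set.
have iid := pattern_iid B_iid t0 mD; have sum1 := fi_sum1 iid.
split => //.
- by move=> j i w; rewrite /summand indicE -patE.
- move=> i a; rewrite normrM ger0_norm ?wgt_ge0// -[leRHS]mulr1 ler_pM ?wgt_ge0 ?wgt_le//.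
  have /andP[c0 c1] := cdf_itv (pt i).
  by case: (a i); rewrite /= ?mulr1n ?mulr0n ler_norml; apply/andP; split; lra.
- move=> i; rewrite /f (eq_bigr (fun a : {ffun 'I_n -> bool} => wgt (pt i) * (pattern_law B t D a * (a i)%:R)
    - wgt (pt i) * cdf (pt i) * pattern_law B t D a)); last by move=> a _; ring.
  by rewrite sumrB -!mulr_sumr law1 sum1; ring.
- move=> i k; rewrite fcovE /f (eq_bigr (fun a : {ffun 'I_n -> bool} => wgt (pt i) * wgt (pt k) *
    (pattern_law B t D a * ((a i)%:R * (a k)%:R) - cdf (pt k) * (pattern_law B t D a * (a i)%:R)
     - cdf (pt i) * (pattern_law B t D a * (a k)%:R) + cdf (pt i) * cdf (pt k) * pattern_law B t D a)));
    last by move=> a _; ring.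
  by rewrite -mulr_sumr big_split/= !sumrB -!mulr_sumr !law1 law2 sum1; ring.
Qed.

(** The probability that the indicators at [q] and [r] differ. *)
Definition symdiff q r : R := cdf q + cdf r - 2 * joint q r.

Lemma symdiff_itv q r : 0 <= symdiff q r <= 2.
Proof.
have [/andP[h1 h2] h3] := joint_le q r; have /andP[_ h4] := cdf_itv q; have /andP[_ h5] := cdf_itv r.
by rewrite /symdiff; apply/andP; split; lra.
Qed.

Lemma symdiff_le (E : set Omega) q r : measurable E ->
  (forall w, below 0 q w <> below 0 r w -> E w) -> symdiff q r <= 2 * fine (P E).
Proof.
move=> mE qrE; have mq := measurable_below 0 q; have mr := measurable_below 0 r.
have split1 (A C : set Omega) : measurable A -> measurable C -> A `\` C `<=` E ->
    fine (P A) <= fine (P (A `&` C)) + fine (P E).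
  move=> mA mC sE; have mAC := measurableI _ _ mA mC.
  have /= h := fineD (fin_num_measure P _ mAC) (fin_num_measure P _ mE).
  rewrite -h fine_le ?fin_numD ?fin_num_measure//.
  have PU : (P ((A `&` C) `|` E) <= P (A `&` C) + P E)%E by exact: measureU2.
  apply: le_trans PU; apply: le_measure; rewrite ?inE//; first exact: measurableU.
  move=> w Aw; have [Cw|nC] := pselect (C w); [by left|by right; apply: sE].
have h1 := split1 _ _ mq mr _; have h2 := split1 _ _ mr mq _.
rewrite setIC in h2.
have {}h1 : cdf q <= joint q r + fine (P E).
  apply: h1 => w [qw nr]; apply: qrE => e; apply: nr; by rewrite -e.
have {}h2 : cdf r <= joint q r + fine (P E).
  apply: h2 => w [rw nq]; apply: qrE => e; apply: nq; by rewrite e.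
rewrite /symdiff; lra.
Qed.

(** The difference of the summands splits into a change of the weight, of
    variance at most the first term, and a change of the indicator. *)
Lemma rho2_fcov_le q r (m : R) : wgt q <= m -> wgt r <= m ->
  rho2 fcov q r <= (wgt q - wgt r) ^+ 2 + 5 * m ^+ 2 * symdiff q r.
Proof.
move=> qm rm; rewrite /rho2 !fcovE !joint_self.
have [/andP[h1 h2] h3] := joint_le q r; have /andP[c0 c1] := cdf_itv q; have /andP[d0 d1] := cdf_itv r.
have s0 := wgt_ge0 q; have s1 := wgt_ge0 r.
have D2 := symdiff_itv q r.
move: (wgt q) (wgt r) s0 s1 qm rm => s t s0 t0 sm tm.
rewrite /symdiff in D2 *.
move: (cdf q) (cdf r) (joint q r) h1 h2 h3 c0 c1 d0 d1 D2 => F G J J0 JF JG F0 F1 G0 G1 /andP[D0 D2].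
set D := F + G - 2 * J in D0 D2 *.
have e1 : s * s * (F - F * F) - 2 * (s * t * (J - F * G)) + t * t * (G - G * G) =
  (s - t) ^+ 2 * (F * (1 - F)) + 2 * ((s - t) * t) * (F - J - F * (F - G)) + t ^+ 2 * (D - (F - G) ^+ 2).
  by rewrite /D; ring.
rewrite e1.
have FG : `|F - G| <= D by rewrite /D ler_norml; apply/andP; split; lra.
have b1 : F * (1 - F) <= 1 by nra.
have b2 : `|F - J - F * (F - G)| <= 2 * D.
  have h : `|F * (F - G)| <= D by rewrite normrM ger0_norm//; apply: le_trans FG; rewrite ler_piMl.
  apply: (le_trans (ler_normB _ _)); rewrite (ger0_norm (_ : 0 <= F - J)) ?subr_ge0//.
  by move: h; rewrite /D; lra.
have b3 : `|(s - t) * t| <= m ^+ 2.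
  by rewrite normrM (ger0_norm t0) expr2 ler_pM// ler_norml; apply/andP; split; lra.
have b4 : (s - t) * t * (F - J - F * (F - G)) <= m ^+ 2 * (2 * D).
  by apply: (le_trans (ler_norm _)); rewrite normrM ler_pM.
have b5 : (s - t) ^+ 2 * (F * (1 - F)) <= (s - t) ^+ 2 by rewrite ler_piMr// sqr_ge0.
have b6 : t ^+ 2 * (D - (F - G) ^+ 2) <= m ^+ 2 * D.
  have FG1 : `|F - G| <= 1 by rewrite ler_norml; apply/andP; split; lra.
  have FG2 : (F - G) ^+ 2 <= D.
    by rewrite -real_normK ?num_real// expr2; apply: le_trans FG; rewrite ler_piMl.
  rewrite ler_pM ?sqr_ge0 ?subr_ge0//; last by rewrite gerBl sqr_ge0.
  by rewrite lerXn2r ?nnegrE ?(le_trans t0).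
lra.
Qed.

Lemma summand_diff_le j q r w : 
  `|summand j q w - summand j r w| <=
     `|wgt q - wgt r| + wgt r * (`|\1_(below j q) w - \1_(below j r) w| + symdiff q r).
Proof.
have [/andP[h1 h2] h3] := joint_le q r; have /andP[c0 c1] := cdf_itv q.
rewrite /summand (_ : _ - _ = (wgt q - wgt r) * (\1_(below j q) w - cdf q) +
  wgt r * ((\1_(below j q) w - \1_(below j r) w) - (cdf q - cdf r))); last by ring.
apply: (le_trans (ler_normD _ _)); apply: lerD.
  rewrite normrM ler_piMr// indicE; case: (_ \in _); rewrite /= ?mulr1n ?mulr0n ler_norml; apply/andP; split; lra.
rewrite normrM ger0_norm ?wgt_ge0// ler_wpM2l ?wgt_ge0//.
apply: (le_trans (ler_normB _ _)); rewrite lerD2l /symdiff ler_norml; apply/andP; split; lra.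
Qed.

Lemma summand_le j q w : `|summand j q w| <= wgt q.
Proof.
have /andP[c0 c1] := cdf_itv q.
rewrite normrM ger0_norm ?wgt_ge0// ler_piMr ?wgt_ge0//.
by rewrite indicE; case: (_ \in _); rewrite /= ?mulr1n ?mulr0n ler_norml; apply/andP; split; lra.
Qed.

(** The variance of an indicator is at most one quarter. *)
Lemma fcov_self_le q : fcov q q <= (T `^ kappa / 2) ^+ 2.
Proof.
rewrite fcovE joint_self; have s0 := wgt_ge0 q; have s1 := wgt_le q.
have b : wgt q * wgt q <= T `^ kappa * T `^ kappa by exact: ler_pM.
have : cdf q - cdf q * cdf q <= 4^-1.
  by have := sqr_ge0 (cdf q - 2^-1); rewrite expr2; lra.
have /andP[c0 c1] := cdf_itv q.
have c2 : 0 <= cdf q - cdf q * cdf q by nra.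
move=> c3; apply: le_trans (ler_pM (mulr_ge0 s0 s0) c2 b c3) _.
by rewrite expr2 mulf_div -natrM.
Qed.

End summands.


(** * Grids of times and levels *)

Section grid.
Context d (Omega : measurableType d) (R : realType) (P : probability Omega R).
Variables (H T : R) (B : nat -> R -> {RV P >-> R}).
Hypotheses (H_gt0 : 0 < H) (H_lt1 : H < 1) (T_gt1 : 1 < T).
Hypotheses (B_fbm : forall j, is_continuous_fbm H (B j)) (B_iid : iid_processes B).
Local Notation S := (set_type (time_space T)).
Local Notation bt := (bt H).
Local Notation btC := (btC H).
Implicit Types q r : S.

Let T_gt0 : 0 < T. Proof. exact: lt_trans T_gt1. Qed.
Let p2 l : 0 < 2 ^+ l :> R. Proof. exact: exprn_gt0. Qed.

(** Levels are rounded down to multiples of [2 ^- l] in [[-2^l, 2^l]], after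
    being clipped to this interval. *)
Definition gidx (l : nat) (x : R) : nat :=
  if x <= - 2 ^+ l then 0%N else if 2 ^+ l <= x then (2 * 4 ^ l)%N
  else Num.truncn ((x + 2 ^+ l) * 2 ^+ l).

Definition gval (l k : nat) : R := k%:R / 2 ^+ l - 2 ^+ l.

Lemma gval_max l : gval l (2 * 4 ^ l) = 2 ^+ l.
Proof.
rewrite /gval natrM natrX (_ : 4%:R = 2 * 2 :> R); last by rewrite -natrM.
by rewrite exprMn; field; rewrite lt0r_neq0.
Qed.

Lemma gidx_le l x : (gidx l x <= 2 * 4 ^ l)%N.
Proof.
rewrite /gidx; case: (leP x (- 2 ^+ l)) => // x1; case: (leP (2 ^+ l) x) => // x2.
have x0 : 0 <= (x + 2 ^+ l) * 2 ^+ l by rewrite mulr_ge0 ?(ltW (p2 l))//; move: x1; lra.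
have /andP[h _] := truncn_itv x0.
rewrite -(ler_nat R); apply: (le_trans h).
have := gval_max l; rewrite /gval => /(canRL (subrK _)) /(canRL (divfK (lt0r_neq0 (p2 l)))) ->.
by rewrite ler_wpM2r ?(ltW (p2 l))//; move: x2; lra.
Qed.

Lemma gidxP l x : [\/ gval l (gidx l x) <= x < gval l (gidx l x) + (2 ^+ l)^-1,
  gval l (gidx l x) = 2 ^+ l /\ 2 ^+ l <= x | gval l (gidx l x) = - 2 ^+ l /\ x <= - 2 ^+ l].
Proof.
rewrite /gidx; case: (leP x (- 2 ^+ l)) => x1.
  by apply: Or33; split => //; rewrite /gval mul0r sub0r.
case: (leP (2 ^+ l) x) => x2; first by apply: Or32; split => //; exact: gval_max.
apply: Or31; have x0 : 0 <= (x + 2 ^+ l) * 2 ^+ l.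
  by rewrite mulr_ge0 ?(ltW (p2 l))//; move: x1; lra.
have /andP[h1 h2] := truncn_itv x0; rewrite /gval; set m := Num.truncn _ in h1 h2 *.
rewrite -ler_pdivrMr// in h1; rewrite -(natr1 m) -ltr_pdivlMr// mulrDl mul1r in h2.
by apply/andP; split; move: h1 h2; lra.
Qed.

(** The minimum with [T] keeps the last grid times inside the time interval; it
    does not affect the rounding of times in [[0, T]]. *)
Lemma net_in (l i k : nat) : time_space T (Num.min (dyad R l i) T, gval l k).
Proof. by split => //=; rewrite in_itv/= ge_min lexx orbT andbT le_min dyad_ge0 ltW. Qed.

Definition net_pt (l i k : nat) : S := exist (fun x => x \in time_space T) _ (mem_set (net_in l i k)).
Definition gwidth (l : nat) : nat := (2 * 4 ^ l).+1.
Definition grid_card (l : nat) : nat := horizon T * 2 ^ l * gwidth l.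
Definition grid l (m : 'I_(grid_card l)) : S := net_pt l (m %/ gwidth l) (m %% gwidth l).
Definition gfloor l q : S := net_pt l (Num.truncn (tm q * 2 ^+ l)) (gidx l (lv q)).

Lemma gfloor_grid l q : exists m, gfloor l q = @grid l m.
Proof.
have /andP[q0 qT] := tm_itv q.
have h : (Num.truncn (tm q * 2 ^+ l) < horizon T * 2 ^ l)%N.
  rewrite -(ltr_nat R) natrM natrX; have /andP[h1 _] := truncn_itv (mulr_ge0 q0 (ltW (p2 l))).
  by apply: (le_lt_trans h1); rewrite ltr_pM2r//; apply: (le_lt_trans qT); exact: truncnS_gt.
have g0 : (gidx l (lv q) < gwidth l)%N by rewrite ltnS gidx_le.
have m_lt : (Num.truncn (tm q * 2 ^+ l) * gwidth l + gidx l (lv q) < grid_card l)%N.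
  apply: (@leq_trans ((Num.truncn (tm q * 2 ^+ l)).+1 * gwidth l)%N).
    by rewrite mulSn addnC ltn_add2r.
  by rewrite leq_mul2r h orbT.
exists (Ordinal m_lt); rewrite /grid /= divnMDl// (divn_small g0) addn0.
by rewrite modnMDl modn_small.
Qed.

Lemma tm_gfloor l q : tm (gfloor l q) = tfloor l (tm q).
Proof.
have /andP[q0 qT] := tm_itv q; have /andP[h _] := tfloor_itv l q0.
by rewrite /tm /gfloor /= /Num.min -/(tfloor l (tm q)); case: ltP => // h2; apply: le_anti; rewrite h2 (le_trans h).
Qed.

Definition grid_rate : R := ln ((horizon T)%:R * 3 * 8).

Lemma grid_rate_ge0 : 0 <= grid_rate.
Proof.
rewrite ln_ge0//; have : (1 : R) <= (horizon T)%:R by rewrite ler1n.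
lra.
Qed.

Lemma grid_card_le l : (grid_card l)%:R <= expR (grid_rate * l.+1%:R).
Proof.
have h1 : (1 : R) <= (horizon T)%:R by rewrite ler1n.
have M1 : 1 <= (horizon T)%:R * 3 * 8 :> R by lra.
rewrite mulrC expRM_natl /grid_rate lnK ?posrE; last by lra.
apply: (@le_trans _ _ (((horizon T)%:R * 3) * 8 ^+ l)).
  rewrite /grid_card /gwidth !natrM natrX -mulrA [leRHS](_ : _ = (horizon T)%:R * (3 * 8 ^+ l)); last by ring.
  rewrite ler_wpM2l// (_ : 8 = 2 * 4 :> R); last by rewrite -natrM.
  rewrite exprMn mulrCA ler_wpM2l ?exprn_ge0// -natr1 natrM natrX.
  have : 1 <= 4 ^+ l :> R by rewrite exprn_ege1// ler1n.
  lra.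
move: M1; set a := _ * 3; have a1 : 1 <= a by rewrite /a; lra.
move=> M1; rewrite exprS; apply: (@le_trans _ _ (a * (a * 8) ^+ l)).
  by rewrite ler_wpM2l ?lerXn2r ?nnegrE//; lra.
by rewrite ler_wpM2r ?exprn_ge0//; lra.
Qed.

(** The exponent makes [tau ^+ 4] equal to one half, and the power [H] of [tau]
    equal to [bt]: at times before [tau ^+ l] the weights are negligible, and
    after it the density of [B t] is at most of the order of [bt ^- l]. *)
Definition tau : R := expR (- (ln 2 / 4)).

Lemma tau_gt0 : 0 < tau. Proof. exact: expR_gt0. Qed.

Lemma tau_lt1 : tau < 1.
Proof. by rewrite /tau expR_lt1 oppr_lt0 divr_gt0// ln_gt0// ltr1n. Qed.

Lemma tau4 l : tau ^+ (4 * l) = (2 ^+ l)^-1.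
Proof.
rewrite exprM -exprVn; congr (_ ^+ l); rewrite /tau -expRM_natl.
rewrite (_ : 4%:R * - (ln 2 / 4) = - ln 2 :> R); last by field.
by rewrite expRN lnK// posrE.
Qed.

Lemma tau_powR (s : R) l : (tau ^+ l) `^ s = expR (- (ln 2 / 4 * s)) ^+ l.
Proof.
by rewrite /tau -!expRM_natl -expRM; congr expR; ring.
Qed.

Lemma tau_powR_H l : (tau ^+ l) `^ H = bt ^+ l.
Proof. by rewrite tau_powR /bt; congr (expR _ ^+ l); ring. Qed.

Lemma bt_expr_le m n : (m <= n)%N -> bt ^+ n <= bt ^+ m.
Proof. by move=> mn; rewrite ler_wiXn2l ?ltW ?bt_gt0 ?bt_lt1. Qed.

Lemma inv2_le_bt l : (2 ^+ l)^-1 <= bt ^+ (4 * l).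
Proof.
have t0 := ltW tau_gt0; have b0 : 0 <= bt := ltW (bt_gt0 H).
rewrite -tau4 lerXn2r ?nnegrE// ler_expR lerN2 mulrAC ler_pM2r ?invr_gt0//.
by rewrite ler_piMl ?(ltW H_lt1)// ltW// ln_gt0// ltr1n.
Qed.

Let btX_ge0 n : 0 <= bt ^+ n. Proof. by rewrite exprn_ge0 ?(ltW (bt_gt0 H)). Qed.
Let btC0 : 0 < btC. Proof. exact: btC_gt0. Qed.

(** A strict upper bound for the oscillation of the paths, once they are regular,
    over one mesh of the time grid of level [l]. *)
Definition slack (l : nat) : R := (btC + 1) * bt ^+ (2 * l).

Lemma slack_gt0 l : 0 < slack l.
Proof. by rewrite mulr_gt0 ?exprn_gt0 ?bt_gt0// addr_gt0 ?btC_gt0. Qed.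

Definition strip (l : nat) (r : S) : set R :=
  [set y | `|y - lv r| <= slack l + (2 ^+ l)^-1 \/ 2 ^+ l <= `|y|].

Lemma measurable_strip l r : measurable (strip l r).
Proof.
pose e := slack l + (2 ^+ l)^-1.
rewrite (_ : strip l r = `[lv r - e, lv r + e]%classic `|` (`]-oo, - 2 ^+ l]%classic `|` `[2 ^+ l, +oo[%classic)).
  by apply: measurableU => //; exact: measurableU.
apply/seteqP; split => y; rewrite /strip /= !in_itv/= andbT ler_distl -/e.
  by move=> [?|]; [left|rewrite ler_normr => /orP[?|?]; right; [right|left] => //; lra].
move=> [?|[?|?]]; [by left|right..]; rewrite ler_normr; apply/orP; [right; lra|by left].
Qed.

(** If the path moves less than the slack, the indicators at a point and at
    its grid point differ only when the path is near the grid level, or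
    beyond the range of the grid. *)
Lemma indicators_agree j w l q :
  `|B j (tm q) w - B j (tm (gfloor l q)) w| < slack l ->
  ~ strip l (gfloor l q) (B j (tm (gfloor l q)) w) ->
  below B j q w = below B j (gfloor l q) w.
Proof.
set r := gfloor l q; have lvr : lv r = gval l (gidx l (lv q)) by [].
rewrite /below /strip /=; move: (B j (tm q) w) (B j (tm r) w) => y z.
have p := p2 l; have i2 : 0 < (2 ^+ l)^-1 :> R by rewrite invr_gt0.
rewrite ltr_distl => /andP[y1 y2] /not_orP[/negP s1 /negP s2]; apply/propext.
move: s1 s2; rewrite -!ltNge ltr_norml => s1 /andP[s2 s3].
move: s1; rewrite ltr_normr => /orP s1.
have s0 := slack_gt0 l.
case: (gidxP l (lv q)); rewrite -lvr.
- move=> /andP[h1 h2]; split => h; case: s1 => s1; lra.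
- move=> [h1 h2]; split => h; case: s1 => s1; lra.
- move=> [h1 h2]; split => h; case: s1 => s1; lra.
Qed.

Definition strip_rate : R := 8 * (btC + 2) + T `^ (2 * H).

(** The density of [B t] bounds the probability of the neighbourhood of a level;
    Chebyshev bounds that of the values beyond the grid. *)
Lemma prob_strip j l r : tau ^+ l <= tm r ->
  (P [set w | strip l r (B j (tm r) w)] <= (strip_rate * bt ^+ l)%:E)%E.
Proof.
move=> tr; have t0 : 0 < tm r by apply: lt_le_trans tr; rewrite exprn_gt0 ?tau_gt0.
pose e := slack l + (2 ^+ l)^-1.
have e0 : 0 <= e by rewrite addr_ge0 ?ltW ?slack_gt0// invr_gt0.
pose E1 := [set w | lv r - e <= B j (tm r) w <= lv r + e].
pose E2 := [set w | 2 ^+ l <= `|B j (tm r) w|].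
have -> : [set w | strip l r (B j (tm r) w)] = E1 `|` E2.
  by apply/seteqP; split => w; rewrite /strip /E1 /E2 /= ler_distl.
have mE1 : measurable E1.
  rewrite (_ : E1 = [set w | `[lv r - e, lv r + e]%classic (B j (tm r) w)]).
    by apply: measurable_RV_in; exact: measurable_itv.
  by apply/seteqP; split => w; rewrite /E1/= in_itv.
have mE2 : measurable E2 by apply: measurable_ge_set; exact: measurableT_comp.
have PU : (P (E1 `|` E2) <= P E1 + P E2)%E by exact: measureU2.
apply: (le_trans PU).
have h1 := fbm_itv H_gt0 (B_fbm j) t0 (_ : lv r - e <= lv r + e).
have h2 := fbm_chebyshev H_gt0 (B_fbm j) (ltW t0) (p2 l).
apply: (le_trans (leeD (h1 _) h2)); first by lra.
rewrite -EFinD lee_fin /strip_rate [leRHS]mulrDl; apply: lerD.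
  rewrite ler_pdivrMr ?powR_gt0//.
  apply: (@le_trans _ _ (8 * (btC + 2) * bt ^+ l * bt ^+ l)); last first.
    have C8 : 0 <= 8 * (btC + 2) by move: btC0; lra.
    rewrite ler_wpM2l ?(mulr_ge0 C8)//.
    rewrite -tau_powR_H ge0_ler_powR ?nnegrE ?(ltW H_gt0) ?(ltW t0)//.
    by rewrite exprn_ge0 ?(ltW tau_gt0).
  rewrite -mulrA -exprD addnn -mul2n.
  have : e <= (btC + 2) * bt ^+ (2 * l).
    have : (2 ^+ l)^-1 <= bt ^+ (2 * l).
      by apply: (le_trans (inv2_le_bt l)); rewrite bt_expr_le// leq_mul2r orbT.
    rewrite /e /slack; move: (bt ^+ _) (btC) => x y; lra.
  rewrite (_ : lv r + e - (lv r - e) = 2 * e); last by ring.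
  move=> h; rewrite [leLHS](_ : _ = 4 * e); last by ring.
  apply: (le_trans (ler_wpM2l _ h)); first by [].
  rewrite mulrA ler_wpM2r//.
  by move: btC0; lra.
apply: ler_pM.
- exact: powR_ge0.
- by rewrite invr_ge0 exprn_ge0// ltW.
- have /andP[_ rT] := tm_itv r.
  by rewrite ge0_ler_powR ?nnegrE ?(ltW t0) ?(ltW T_gt0) ?mulr_ge0 ?(ltW H_gt0).
apply: (@le_trans _ _ (2 ^+ l)^-1).
  by rewrite lef_pV2 ?posrE ?exprn_gt0// expr2 ler_peMl ?(ltW (p2 l))// exprn_ege1// ler1n.
by apply: (le_trans (inv2_le_bt l)); rewrite bt_expr_le// leq_pmull.
Qed.

(** Where the indicators differ, the path moves more than the slack or visits the
    strip. *)
Lemma symdiff_gfloor_le l q : tau ^+ l <= tm (gfloor l q) ->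
  symdiff B q (gfloor l q) <= 2 * (strip_rate + 1) * bt ^+ l.
Proof.
set r := gfloor l q => tr.
pose E1 := [set w | slack l <= `|B 0%N (tm q) w - B 0%N (tm r) w|].
pose E2 := [set w | strip l r (B 0%N (tm r) w)].
have mE1 : measurable E1.
  by apply: measurable_ge_set; apply: measurableT_comp => //; exact: measurable_funB.
have mE2 : measurable E2 by apply: measurable_RV_in; exact: measurable_strip.
have mE : measurable (E1 `|` E2) by exact: measurableU.
have h := symdiff_le mE (_ : forall w, below B 0 q w <> below B 0 r w -> (E1 `|` E2) w).
apply: (le_trans (h _)).
  move=> w; apply: contra_notP => /not_orP[/negP]; rewrite -ltNge => n1 n2.
  exact: indicators_agree.
rewrite -mulrA ler_wpM2l// -lee_fin fineK ?fin_num_measure//.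
have PU : (P (E1 `|` E2) <= P E1 + P E2)%E by exact: measureU2.
apply: (le_trans PU).
have h1 := fbm_increment_chebyshev H_gt0 (B_fbm 0) (tm_ge0 r) (tm_ge0 q) (slack_gt0 l).
apply: (le_trans (leeD h1 (prob_strip 0 tr))).
rewrite -EFinD lee_fin [leRHS]mulrDl mul1r addrC lerD2l.
rewrite ler_pdivrMr ?exprn_gt0 ?slack_gt0//.
apply: (@le_trans _ _ (bt ^+ (8 * l))).
  rewrite -pow2_powR ge0_ler_powR ?nnegrE ?mulr_ge0 ?(ltW H_gt0)// ?invr_ge0 ?(ltW (p2 l))//.
  have /andP[u1 u2] := tfloor_itv l (tm_ge0 q).
  by rewrite /r tm_gfloor ger0_norm ?subr_ge0// lerBlDl ltW.
apply: (@le_trans _ _ (bt ^+ l * bt ^+ (2 * l) ^+ 2)).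
  by rewrite -exprM -exprD bt_expr_le//; lia.
rewrite ler_wpM2l//.
rewrite /slack exprMn ler_peMl ?sqr_ge0// exprn_ege1//.
by move: btC0; lra.
Qed.

End grid.


(** * Binomial tails and the distances between points and grid points *)

Section counting.
Context d (Omega : measurableType d) (R : realType) (P : probability Omega R).
Variable B : nat -> R -> {RV P >-> R}.
Hypothesis B_iid : iid_processes B.

Definition visits (t : R) (D : set R) (N : nat) (w : Omega) : R :=
  \sum_(j < N) (`[< D (B j t w) >])%:R.

(** The exponential Chebyshev inequality for a binomial variable. *)
Lemma visits_tail (t : R) (D : set R) (p c : R) (N : nat) : 0 <= t -> measurable D ->
  (P [set w | D (B 0%N t w)] <= p%:E)%E ->
  measurable [set w | c <= visits t D N w] /\
  (P [set w | (c <= visits t D N w)%R] <= (expR (- c + 3 * (N%:R * p)))%:E)%E.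
Proof.
move=> t0 mD pD; pose p0 := fine (P [set w | D (B 0%N t w)]).
have mE0 := measurable_RV_in B 0 t mD.
have p0E : P [set w | D (B 0%N t w)] = p0%:E by rewrite /p0 fineK ?fin_num_measure.
have p0p : p0 <= p by rewrite -lee_fin -p0E.
have /andP[p00 p01] : 0 <= p0 <= 1 := fine_prob_itv P mE0.
clearbody p0.
have iid := pattern_iid B_iid (t := fun _ : 'I_1 => t) (D := fun=> D) (fun=> t0) (fun=> mD); set xi := pattern _ _ _ in iid; set law := pattern_law _ _ _ in iid.
have visitsE w : visits t D N w = \sum_(j < N) (xi j w ord0)%:R.
  by apply: eq_bigr => j _; rewrite /xi ffunE.
pose g (a : {ffun 'I_1 -> bool}) : R := (a ord0)%:R - p0.
have s1 : \sum_a law a * (a ord0)%:R = p0.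
  rewrite (eq_bigr (fun a : {ffun 'I_1 -> bool} => if a ord0 then law a else 0)); last first.
    by move=> a _; case: (a ord0); rewrite ?mulr1 ?mulr0.
  rewrite -big_mkcond/=; apply: EFin_inj.
  rewrite (pattern_law_sum B_iid (t := fun _ : 'I_1 => t) (D := fun=> D) (fun=> t0) (fun=> mD) (fun a : {ffun 'I_1 -> bool} => a ord0)) -p0E.
  by congr (P _); apply/seteqP; split => w /=; rewrite ffunE; move/asboolP.
have g0 : \sum_a law a * g a = 0.
  rewrite (eq_bigr (fun a : {ffun 'I_1 -> bool} => law a * (a ord0)%:R - p0 * law a)); last first.
    by move=> a _; rewrite /g; ring.
  by rewrite sumrB s1 -mulr_sumr (fi_sum1 iid) mulr1 subrr.
have g1 a : `|g a| <= 1.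
  by rewrite /g; case: (a ord0); rewrite /= ?mulr1n ?mulr0n ler_norml; apply/andP; split; lra.
have g2 : \sum_a law a * g a ^+ 2 <= p0.
  rewrite (eq_bigr (fun a : {ffun 'I_1 -> bool} => (1 - 2 * p0) * (law a * (a ord0)%:R) + p0 ^+ 2 * law a)); last first.
    by move=> a _; rewrite /g; case: (a ord0); rewrite /= ?mulr1n ?mulr0n; ring.
  by rewrite big_split/= -!mulr_sumr s1 (fi_sum1 iid); nra.
have mE : measurable [set w | c <= visits t D N w].
  have := measurable_wordQ iid N (fun s => c <= \sum_(a <- s) (a ord0)%:R).
  congr measurable; apply/seteqP; split => w /=; rewrite visitsE.
    by rewrite (sum_word xi (fun a : {ffun 'I_1 -> bool} => (a ord0)%:R)).
  by rewrite (sum_word xi (fun a : {ffun 'I_1 -> bool} => (a ord0)%:R)).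
split => //.
have mH : measurable [set w | hit g (c - N%:R * p0) (word xi N w)] by exact: (measurable_wordQ iid).
apply: (@le_trans _ _ (P [set w | hit g (c - N%:R * p0) (word xi N w)])).
  apply: le_measure; rewrite ?inE// => w /= cw.
  apply: (@hit_take _ _ _ _ _ N); rewrite take_word// sum_word//.
  by rewrite sumrB -visitsE sumr_const card_ord -mulr_natl; lra.
rewrite (prob_word iid) lee_fin.
apply: (le_trans (hit_bound (fi_ge0 iid) (fi_sum1 iid) _ N ler01 _ g1 g0 g2)); first by rewrite mul1r.
rewrite ler_expR.
have : N%:R * p0 <= N%:R * p by rewrite ler_wpM2l.
have : 0 <= N%:R * p0 by rewrite mulr_ge0.
rewrite expr1n !mul1r mulr1 (_ : N%:R * (p0 * (1 + 2) / 2) = N%:R * p0 * (3 / 2)); last by field.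
by move: (N%:R * p0) (N%:R * p) => x y; lra.
Qed.

End counting.

Section grid_estimates.
Context d (Omega : measurableType d) (R : realType) (P : probability Omega R).
Variables (H T kappa : R) (B : nat -> R -> {RV P >-> R}).
Hypotheses (H_gt0 : 0 < H) (H_lt1 : H < 1) (T_gt1 : 1 < T) (kappa_gt0 : 0 < kappa).
Hypotheses (B_fbm : forall j, is_continuous_fbm H (B j)) (B_iid : iid_processes B).
Local Notation S := (set_type (time_space T)).
Local Notation bt := (bt H).
Local Notation tau := (@tau R).
Local Notation wgt := (@wgt R T kappa).
Local Notation gfloor := (gfloor T_gt1).
Local Notation symdiff := (@symdiff _ _ _ P T B).
Local Notation strip_rate := (strip_rate H T).
Implicit Types q r : S.

Definition wtau : R := expR (- (ln 2 / 4 * kappa)).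

Lemma wtau_gt0 : 0 < wtau. Proof. exact: expR_gt0. Qed.

Lemma wtau_lt1 : wtau < 1.
Proof. by rewrite expR_lt1 oppr_lt0 !mulr_gt0 ?invr_gt0// ln_gt0// ltr1n. Qed.

Let tau0 : 0 < tau. Proof. exact: tau_gt0. Qed.
Let tauX0 n : 0 <= tau ^+ n. Proof. by rewrite exprn_ge0 ?(ltW tau0). Qed.

Let tauX_le m n : (m <= n)%N -> tau ^+ n <= tau ^+ m.
Proof. by move=> mn; apply: ler_wiXn2l => //; apply: ltW; [exact: tau0|exact: tau_lt1]. Qed.
Let tauX1 n : tau ^+ n <= 1.
Proof. exact: (tauX_le (leq0n n)). Qed.
Let wtauX1 n : wtau ^+ n <= 1.
Proof. by apply: exprn_ile1; apply: ltW; [exact: wtau_gt0|exact: wtau_lt1]. Qed.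

(** At small times the weights themselves are small. *)
Lemma wgt_small l q : tm (gfloor l q) < tau ^+ l ->
  wgt q <= 2 `^ kappa * wtau ^+ l /\ wgt (gfloor l q) <= 2 `^ kappa * wtau ^+ l.
Proof.
have E : 2 `^ kappa * wtau ^+ l = (2 * tau ^+ l) `^ kappa by rewrite powRM// tau_powR.
have mono (s : R) : 0 <= s -> s <= 2 * tau ^+ l -> s `^ kappa <= 2 `^ kappa * wtau ^+ l.
  move=> s0 st; rewrite E ge0_ler_powR ?nnegrE ?(ltW kappa_gt0)//.
  exact: le_trans st.
move=> h; split; apply: mono; rewrite ?tm_ge0//; last by have := tauX0 l; lra.
have /andP[_ u] := tfloor_itv l (tm_ge0 q); rewrite -(tm_gfloor T_gt1) in u.
have : (2 ^+ l)^-1 <= tau ^+ l.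
  by rewrite -tau4 tauX_le// leq_pmull.
lra.
Qed.

Definition wgt_rate : R := T `^ kappa * (kappa * expR kappa).

Lemma wgt_rate_ge0 : 0 <= wgt_rate.
Proof. by rewrite !mulr_ge0 ?powR_ge0 ?expR_ge0// ltW. Qed.

(** At other times the relative error of rounding the time is small. *)
Lemma wgt_diff_le l q : tau ^+ l <= tm (gfloor l q) ->
  `|wgt q - wgt (gfloor l q)| <= wgt_rate * tau ^+ l.
Proof.
set r := gfloor l q => tr; have tl0 : 0 < tau ^+ l by rewrite exprn_gt0.
have t0 : 0 < tm r by exact: lt_le_trans tr.
have /andP[u1 u2] := tfloor_itv l (tm_ge0 q); rewrite -(tm_gfloor T_gt1) -/r in u1 u2.
pose u := (tm q - tm r) / tm r.
have u0 : 0 <= u by rewrite divr_ge0 ?subr_ge0// ltW.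
have ul : u <= tau ^+ l.
  rewrite /u ler_pdivrMr//; apply: (@le_trans _ _ (tau ^+ l * tau ^+ l)); last by rewrite ler_wpM2l.
  apply: (@le_trans _ _ (tau ^+ (4 * l))); first by rewrite tau4; lra.
  by rewrite -exprD tauX_le// addnn -mul2n leq_mul2r orbT.
have u1' : u <= 1 by exact: le_trans ul (tauX1 l).
have qE : wgt q = wgt r * (1 + u) `^ kappa.
  rewrite /wgt -powRM ?(ltW t0) ?addr_ge0//; congr (_ `^ _).
  by rewrite /u; field; rewrite lt0r_neq0.
have v0 : 0 <= kappa * u by rewrite mulr_ge0// ltW.
have pw : (1 + u) `^ kappa <= 1 + kappa * u * expR kappa.
  apply: (@le_trans _ _ (expR (kappa * u))).
    rewrite /powR gt_eqF ?ltr_wpDr// ler_expR ler_wpM2l ?(ltW kappa_gt0)//.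
    by rewrite le_ln1Dx//; lra.
  have := expR_ge1Dx (- (kappa * u)); rewrite expRN => h.
  have E := expR_gt0 (kappa * u).
  have : 1 >= (1 - kappa * u) * expR (kappa * u) by rewrite -ler_pdivlMr// div1r.
  have : kappa * u * expR (kappa * u) <= kappa * u * expR kappa.
    by rewrite ler_wpM2l// ler_expR ler_piMr// ltW.
  lra.
have pw1 : 1 <= (1 + u) `^ kappa.
  have := @ge0_ler_powR R kappa (ltW kappa_gt0) 1 (1 + u); rewrite !nnegrE powR1; apply => //; lra.
have w0 : 0 <= wgt r by exact: powR_ge0.
have wT : wgt r <= T `^ kappa by exact: wgt_le.
rewrite qE (_ : _ - _ = wgt r * ((1 + u) `^ kappa - 1)); last by ring.
rewrite ger0_norm ?mulr_ge0 ?subr_ge0// /wgt_rate -mulrA ler_pM ?subr_ge0//.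
apply: (@le_trans _ _ (kappa * u * expR kappa)); first by lra.
rewrite [leLHS](_ : _ = kappa * expR kappa * u); last by ring.
by rewrite ler_wpM2l// mulr_ge0 ?expR_ge0// ltW.
Qed.

Definition grid_ratio : R := Num.max (Num.max bt tau) wtau.

Lemma grid_ratio01 : 0 < grid_ratio < 1.
Proof.
rewrite /grid_ratio !lt_max !gt_max bt_gt0/= bt_lt1// tau_lt1 wtau_lt1.
by [].
Qed.

Let srate0 : 0 <= strip_rate.
Proof. by rewrite addr_ge0 ?powR_ge0// mulr_ge0// addr_ge0// ltW// btC_gt0. Qed.

Definition rho2_rate : R :=
  wgt_rate ^+ 2 + 10 * (T `^ kappa) ^+ 2 * (strip_rate + 1) + 11 * (2 `^ kappa) ^+ 2.

Lemma rho2_rate_ge0 : 0 <= rho2_rate.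
Proof.
have s1 : 0 <= strip_rate + 1 by rewrite addr_ge0.
apply: addr_ge0; first apply: addr_ge0; first exact: sqr_ge0.
  by rewrite mulr_ge0// mulr_ge0// sqr_ge0.
by rewrite mulr_ge0// sqr_ge0.
Qed.

Lemma rho2_gfloor_le l q : rho2 (fcov kappa B) q (gfloor l q) <= rho2_rate * grid_ratio ^+ l.
Proof.
set r := gfloor l q.
have /andP[g0 g1] := grid_ratio01.
have pw (x : R) : 0 <= x -> x <= grid_ratio -> x ^+ l <= grid_ratio ^+ l.
  by move=> x0 xg; rewrite lerXn2r ?nnegrE// ltW.
have btg : bt ^+ l <= grid_ratio ^+ l by rewrite pw ?(ltW (bt_gt0 H))// /grid_ratio !le_max lexx.
have taug : tau ^+ l <= grid_ratio ^+ l by rewrite pw ?(ltW tau0)// /grid_ratio !le_max lexx orbT.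
have wtaug : wtau ^+ l <= grid_ratio ^+ l by rewrite pw ?(ltW wtau_gt0)// /grid_ratio !le_max lexx !orbT.
have gl0 : 0 <= grid_ratio ^+ l by rewrite exprn_ge0// ltW.
have sq (x : R) : 0 <= x -> x <= 1 -> x ^+ 2 <= x by move=> x0 x1; rewrite expr2 ler_piMr.
have sr1 : 0 <= strip_rate + 1 by rewrite addr_ge0.
have [tr|tr] := leP (tau ^+ l) (tm r).
  have w1 := wgt_diff_le tr; have s1 := symdiff_gfloor_le H_gt0 H_lt1 B_fbm tr.
  have := rho2_fcov_le B (wgt_le kappa_gt0 q) (wgt_le kappa_gt0 r).
  move=> h; apply: (le_trans h); rewrite /rho2_rate [leRHS]mulrDl; apply: ler_wpDr.
    by rewrite !mulr_ge0// sqr_ge0.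
  rewrite [leRHS]mulrDl; apply: lerD.
    rewrite -real_normK ?num_real//; apply: (@le_trans _ _ ((wgt_rate * tau ^+ l) ^+ 2)).
      by rewrite lerXn2r ?nnegrE// mulr_ge0// wgt_rate_ge0.
    rewrite exprMn ler_wpM2l ?sqr_ge0//; by apply: le_trans taug; exact: sq.
  apply: (@le_trans _ _ (5 * T `^ kappa ^+ 2 * (2 * (strip_rate + 1) * bt ^+ l))).
    by rewrite ler_wpM2l// mulr_ge0// sqr_ge0.
  rewrite [leLHS](_ : _ = 10 * T `^ kappa ^+ 2 * (strip_rate + 1) * bt ^+ l); last by ring.
  by rewrite ler_wpM2l// mulr_ge0// mulr_ge0// sqr_ge0.
have [w1 w2] := wgt_small tr.
have := rho2_fcov_le B w1 w2 => h; apply: (le_trans h).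
set m := 2 `^ kappa * wtau ^+ l in w1 w2 h *.
have /andP[_ D2] := symdiff_itv B q r.
have q0 := wgt_ge0 kappa q; have r0 := wgt_ge0 kappa r.
have m2 : (wgt q - wgt r) ^+ 2 <= m ^+ 2.
  rewrite -real_normK ?num_real// lerXn2r ?nnegrE//; first exact: le_trans w1.
  by rewrite ler_norml; apply/andP; split; lra.
have m3 : 5 * m ^+ 2 * symdiff q r <= 5 * m ^+ 2 * 2.
  by rewrite ler_wpM2l// mulr_ge0// sqr_ge0.
apply: (@le_trans _ _ (11 * m ^+ 2)); first by move: m2 m3; move: (m ^+ 2) => x; lra.
have m4 : m ^+ 2 <= (2 `^ kappa) ^+ 2 * grid_ratio ^+ l.
  rewrite /m exprMn ler_wpM2l ?sqr_ge0//; apply: le_trans wtaug; apply: sq.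
    by rewrite exprn_ge0// ltW// wtau_gt0.
  exact: wtauX1.
apply: (@le_trans _ _ (11 * ((2 `^ kappa) ^+ 2 * grid_ratio ^+ l))); first by rewrite ler_wpM2l.
rewrite mulrA ler_wpM2r// /rho2_rate lerDr addr_ge0 ?sqr_ge0//.
by rewrite mulr_ge0// mulr_ge0// sqr_ge0.
Qed.

End grid_estimates.


(** * Pathwise comparison with a fine grid *)

Section fine_grids.
Context d (Omega : measurableType d) (R : realType) (P : probability Omega R).
Variables (H T kappa : R) (B : nat -> R -> {RV P >-> R}).
Hypotheses (H_gt0 : 0 < H) (H_lt1 : H < 1) (T_gt1 : 1 < T) (kappa_gt0 : 0 < kappa).
Hypotheses (B_fbm : forall j, is_continuous_fbm H (B j)) (B_iid : iid_processes B).
Local Notation S := (set_type (time_space T)).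
Local Notation bt := (bt H).
Local Notation tau := (@tau R).
Local Notation wtau := (wtau kappa).
Local Notation wgt := (@wgt R T kappa).
Local Notation gfloor := (gfloor T_gt1).
Local Notation grid := (grid T_gt1).
Local Notation strip_rate := (strip_rate H T).
Implicit Types q r : S.

Lemma geometric_half (x : R) : 0 < x -> x < 1 -> exists a, forall b, (a <= b)%N -> 2 * x ^+ b <= 1.
Proof.
move=> x0 x1; have x01 : 0 < x < 1 by rewrite x0.
have [a _ ha] := @poly_geometric_small R x 2 0 x01 ltac:(lra).
by exists a => b ab; have := ha b ab; rewrite /= expr0 mulr1.
Qed.

Lemma geometric_pow2 (x : R) (A k : nat) : 0 <= x -> 2 * x ^+ A <= 1 -> 2 ^+ k * x ^+ (A * k) <= 1.
Proof. by move=> x0 xA; rewrite exprM -exprMn exprn_ile1// mulr_ge0// exprn_ge0. Qed.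

Let T_gt0 : 0 < T. Proof. exact: lt_trans T_gt1. Qed.

Let srate0 : 0 <= strip_rate.
Proof. by rewrite addr_ge0 ?powR_ge0// mulr_ge0// addr_ge0// ltW// btC_gt0. Qed.

(** Among the first [2 ^ k] paths, only of the order of [k] ever come near any
    given point of a fine grid: such visits are rare, and the grid has only
    exponentially many points. *)
Lemma ae_few_visits (A : nat) : 2 * bt ^+ A <= 1 ->
  exists2 C : R, 0 <= C & {ae P, forall w, exists k0, forall k, (k0 <= k)%N ->
    forall m : 'I_(grid_card T (A * k)), tau ^+ (A * k) <= tm (@grid (A * k) m) ->
    visits B (tm (grid m)) (strip H (A * k) (grid m)) (2 ^ k) w <= C * k.+1%:R}.
Proof.
move=> btA; pose c0 := @grid_rate R T.
have c00 : 0 <= c0 by exact: grid_rate_ge0.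
(* [C] exceeds the exponential rate of the number of grid points by 2 *)
pose C := c0 * A%:R + c0 + 2.
have C0 : 0 <= C by rewrite !addr_ge0// mulr_ge0.
exists C => //.
pose F k (m : 'I_(grid_card T (A * k))) := if tau ^+ (A * k) <= tm (@grid (A * k) m) then
  [set w | C * k.+1%:R <= visits B (tm (grid m)) (strip H (A * k) (grid m)) (2 ^ k) w] else set0.
pose E k := [set w | exists2 m, m \in enum 'I_(grid_card T (A * k)) & F k m w].
pose D : R := expR (3 * strip_rate).
have FP k m : measurable (F k m) /\ (P (F k m) <= (D * expR (- (C * k.+1%:R)))%:E)%E.
  rewrite /F; case: ifPn => [h|_]; last first.
    by split => //; rewrite measure0 lee_fin mulr_ge0 ?expR_ge0.
  have pS := prob_strip H_gt0 H_lt1 T_gt1 B_fbm 0 h.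
  have [mE PE] := visits_tail B_iid (C * k.+1%:R) (2 ^ k) (tm_ge0 (grid m)) (@measurable_strip R H T (A * k) (grid m)) pS.
  split => //; apply: (le_trans PE); rewrite lee_fin -expRD ler_expR addrC lerD2r ler_wpM2l//.
  by rewrite natrX mulrCA ler_piMr// geometric_pow2// ltW// bt_gt0.
have EP k := measure_union_seq P (r := enum 'I_(grid_card T (A * k))) (fun m _ => (FP k m).1).
pose u k : R := D * (k.+1%:R ^+ 2)^-1.
have u0 k : 0 <= u k by rewrite mulr_ge0 ?expR_ge0// invr_ge0 sqr_ge0.
have Eu k : (0 <= k)%N -> (P (E k) <= (u k)%:E)%E.
  move=> _; apply: (le_trans (EP k).2).
  apply: (@le_trans _ _ (\sum_(m <- enum 'I_(grid_card T (A * k))) (D * expR (- (C * k.+1%:R)))%:E)%E).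
    by apply: lee_sum => m _; exact: (FP k m).2.
  rewrite sumEFin lee_fin big_const_seq count_predT size_enum_ord iter_addr_0.
  rewrite -[leLHS]mulr_natl mulrCA ler_wpM2l ?expR_ge0//.
  apply: (le_trans (ler_wpM2r (expR_ge0 _) (@grid_card_le R T (A * k)))).
  rewrite -expRD -/c0; apply: (@le_trans _ _ (expR (- (2 * k.+1%:R)))).
    rewrite ler_expR /C -(natr1 k) -(natr1 (A * k)) natrM.
    have : 0 <= c0 * A%:R by rewrite mulr_ge0.
    have : 0 <= c0 * k%:R by rewrite mulr_ge0.
    by nra.
  rewrite expRN lef_pV2 ?posrE ?expR_gt0 ?exprn_gt0// mulrC.
  rewrite [leRHS](_ : _ = expR k.+1%:R ^+ 2); last by rewrite -expRM_natr.
  rewrite lerXn2r ?nnegrE ?expR_ge0//.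
  by apply: le_trans (expR_ge1Dx _); rewrite lerDr.
have uM n : \sum_(k < n) u k <= D * 2.
  rewrite -mulr_sumr ler_wpM2l ?expR_ge0//.
  by have := @sum_inv_sqr_le2 R 0 n; rewrite big_mkord.
have := ae_eventually_not (k0 := 0) (fun k => (EP k).1) u0 Eu uM.
apply: filterS => w [k0 Hk0]; exists k0 => k kk m tm_m.
rewrite leNgt; apply/negP => /ltW h; apply: (Hk0 k kk); exists m; first by rewrite mem_enum.
by rewrite /F tm_m.
Qed.

(** At level [A0 * k] the weights near time zero are at most of the order of
    [2 ^ - k], which compensates for the [2 ^ k] paths. At other times the same
    holds for the changes of the weight and of the mean, and the indicators
    differ only for the few paths that visit a strip. *)
Lemma fine_grid : exists A0 C2, [/\ (0 < A0)%N, 0 <= C2 &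
  {ae P, forall w, exists k0, forall k, (k0 <= k)%N -> forall n q, (n <= 2 ^ k)%N ->
    `|psum (summand kappa B) n q w - psum (summand kappa B) n (gfloor (A0 * k) q) w|
      <= C2 * k.+1%:R}].
Proof.
have [a1 h1] := geometric_half (bt_gt0 H) (bt_lt1 H_gt0).
have [a2 h2] := geometric_half (tau_gt0 R) (tau_lt1 R).
have [a3 h3] := geometric_half (wtau_gt0 kappa) (wtau_lt1 kappa_gt0).
(* at level [A * k] each of the three rates beats the number [2 ^ k] of paths *)
pose A := (maxn a1 (maxn a2 a3)).+1.
have btA : 2 * bt ^+ A <= 1 by apply: h1; rewrite leqW// leq_max leqnn.
have tauA : 2 * tau ^+ A <= 1 by apply: h2; rewrite leqW// !leq_max leqnn orbT.
have wtauA : 2 * wtau ^+ A <= 1 by apply: h3; rewrite leqW// !leq_max leqnn !orbT.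
have [Cv Cv0 few] := ae_few_visits btA.
pose D := 2 * (strip_rate + 1).
have D0 : 0 <= D by rewrite mulr_ge0// addr_ge0.
have K0 : 0 <= T `^ kappa by exact: powR_ge0.
pose W := @wgt_rate R T kappa.
have W0 : 0 <= W by exact: wgt_rate_ge0.
have V0 : 0 <= 2 `^ kappa :> R by exact: powR_ge0.
have V2 : 0 <= 2 * 2 `^ kappa :> R by exact: mulr_ge0.
have CD0 : 0 <= Cv + D by exact: addr_ge0.
have WW0 : 0 <= W + T `^ kappa * (Cv + D) by rewrite addr_ge0// mulr_ge0.
exists A, (2 * 2 `^ kappa + (W + T `^ kappa * (Cv + D))); split => //.
  exact: addr_ge0.
apply: filterS2 few (ae_dyadic_increments H_gt0 T_gt0 B_fbm) => w [k1 hk1] [l0 hl0].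
exists (maxn k1 l0) => k; rewrite geq_max => /andP[k1k l0k] n q n2k.
have l0L : (l0 <= A * k)%N by rewrite (leq_trans l0k)// leq_pmull.
set r := gfloor (A * k) q.
have k1_ge1 : 1 <= k.+1%:R :> R by rewrite ler1n.
have n2 : n%:R <= 2 ^+ k :> R by rewrite -natrX ler_nat.
rewrite /psum -sumrB; apply: (le_trans (ler_norm_sum _ _ _)).
have [tr|tr] := leP (tau ^+ (A * k)) (tm r); last first.
  have [w1 w2] := wgt_small kappa_gt0 tr.
  apply: (@le_trans _ _ (\sum_(j < n) 2 * (2 `^ kappa * wtau ^+ (A * k)))).
    apply: ler_sum => j _; apply: (le_trans (ler_normB _ _)).
    have s1 := summand_le kappa B j q w; have s2 := summand_le kappa B j r w.
    by apply: (le_trans (lerD s1 s2)); apply: (le_trans (lerD w1 w2)); lra.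
  rewrite sumr_const card_ord -[leLHS]mulr_natl.
  have wA := geometric_pow2 k (ltW (wtau_gt0 kappa)) wtauA.
  apply: (@le_trans _ _ (2 * 2 `^ kappa)); last first.
    apply: (@le_trans _ _ (2 * 2 `^ kappa + (W + T `^ kappa * (Cv + D)))).
      by rewrite lerDl.
    by rewrite ler_peMr// addr_ge0.
  rewrite [leLHS](_ : _ = 2 * 2 `^ kappa * (n%:R * wtau ^+ (A * k))); last by ring.
  rewrite ler_piMr ?mulr_ge0//; apply: le_trans wA; rewrite ler_wpM2r// exprn_ge0// ltW//.
  exact: wtau_gt0.
have wd := wgt_diff_le kappa_gt0 tr.
have sd := symdiff_gfloor_le H_gt0 H_lt1 B_fbm tr.
have [m rm] := gfloor_grid T_gt1 (A * k) q.
have vis := hk1 k k1k m; rewrite -rm in vis; have {}vis := vis tr.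
pose v j : R := (`[< strip H (A * k) r (B j (tm r) w) >])%:R.
have term j : (j < n)%N -> `|summand kappa B j q w - summand kappa B j r w| <=
    W * tau ^+ (A * k) + T `^ kappa * (v j + D * bt ^+ (A * k)).
  move=> jn; apply: (le_trans (summand_diff_le kappa B j q r w)); apply: lerD => //.
  apply: ler_pM => //; first exact: wgt_ge0.
  - by rewrite addr_ge0//; have /andP[] := symdiff_itv B q r.
  - exact: wgt_le.
  apply: lerD => //; rewrite /v; case: asboolP => nstrip.
    by rewrite !indicE; case: (_ \in _); case: (_ \in _); rewrite /= ?mulr1n ?mulr0n ler_norml; apply/andP; split; lra.
  have jL : (j < 2 ^ (A * k))%N.
    by apply: (leq_trans jn); apply: (leq_trans n2k); rewrite leq_pexp2l// leq_pmull.
  have osc := tfloor_oscillation H_gt0 T_gt0 B_fbm hl0 l0L jL (tm_itv q).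
  rewrite -(tm_gfloor T_gt1) -/r in osc.
  have bl : `|B j (tm q) w - B j (tm r) w| < slack H (A * k).
    apply: (le_lt_trans osc); rewrite /slack mulrDl mul1r ltrDl.
    by rewrite exprn_gt0 ?bt_gt0.
  have e := indicators_agree H_gt0 bl nstrip.
  rewrite !indicE; have -> : w \in below B j q = (w \in below B j r) by apply/idP/idP => /set_mem h; apply/mem_set; [rewrite -e|rewrite e].
  by rewrite subrr normr0.
apply: (@le_trans _ _ (\sum_(j < n) (W * tau ^+ (A * k) + T `^ kappa * (v j + D * bt ^+ (A * k))))).
  by apply: ler_sum => j _; exact: term.
rewrite big_split/= sumr_const card_ord -mulr_sumr big_split/= sumr_const card_ord.
have vn : \sum_(j < n) v j <= Cv * k.+1%:R.
  apply: le_trans vis; rewrite /visits -/v.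
  rewrite (big_ord_widen (2 ^ k) v n2k) [leRHS](bigID (fun j : 'I_(2 ^ k) => (j < n)%N))/= lerDl.
  by apply: sumr_ge0 => j _.
have tA := geometric_pow2 k (ltW (tau_gt0 R)) tauA.
have bA := geometric_pow2 k (ltW (bt_gt0 H)) btA.
have t1 : (W * tau ^+ (A * k)) *+ n <= W * k.+1%:R.
  rewrite -[leLHS]mulr_natr -mulrA ler_wpM2l//; apply: le_trans k1_ge1; apply: le_trans tA.
  by rewrite mulrC ler_wpM2r// exprn_ge0// ltW// tau_gt0.
have t2 : (D * bt ^+ (A * k)) *+ n <= D * k.+1%:R.
  rewrite -[leLHS]mulr_natr -mulrA ler_wpM2l//; apply: le_trans k1_ge1; apply: le_trans bA.
  by rewrite mulrC ler_wpM2r// exprn_ge0// ltW// bt_gt0.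
have t3 : T `^ kappa * (\sum_(j < n) v j + (D * bt ^+ (A * k)) *+ n) <= T `^ kappa * ((Cv + D) * k.+1%:R).
  by rewrite ler_wpM2l// mulrDl lerD.
apply: (le_trans (lerD t1 t3)); rewrite mulrA -mulrDl ler_wpM2r// lerDr mulr_ge0//.
Qed.

End fine_grids.


(** * The median of a marginal, and the theorem *)

Section median.
Context d (Omega : measurableType d) (R : realType) (P : probability Omega R).
Variables (H : R) (B : nat -> R -> {RV P >-> R}).
Hypotheses (H_gt0 : 0 < H) (B_fbm : forall j, is_continuous_fbm H (B j)).

Lemma marginal_cdf_increment (t x y : R) : 0 < t -> x <= y ->
  0 <= marginal_cdf (B 0%N) t y - marginal_cdf (B 0%N) t x <= 2 * (y - x) / t `^ H.
Proof.
move=> t0 xy; pose F z := [set w | B 0%N t w <= z].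
pose I := [set w | x <= B 0%N t w <= y].
have mF z : measurable (F z).
  rewrite (_ : F z = [set w | `]-oo, z]%classic (B 0%N t w)]).
    by apply: measurable_RV_in; exact: measurable_itv.
  by apply/seteqP; split => w; rewrite /F/= in_itv.
have mI : measurable I.
  rewrite (_ : I = [set w | `[x, y]%classic (B 0%N t w)]).
    by apply: measurable_RV_in; exact: measurable_itv.
  by apply/seteqP; split => w; rewrite /I/= in_itv.
rewrite /marginal_cdf -/(F y) -/(F x); apply/andP; split.
  rewrite subr_ge0 fine_le ?fin_num_measure// le_measure ?inE// => w /= h.
  exact: le_trans xy.
have PI : fine (P I) <= 2 * (y - x) / t `^ H.
  by rewrite -lee_fin fineK ?fin_num_measure//; exact: (fbm_itv H_gt0 (B_fbm 0) t0 xy).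
rewrite lerBlDl; apply: le_trans (lerD (lexx _) PI).
have /= h := fineD (fin_num_measure P _ (mF x)) (fin_num_measure P _ mI).
rewrite -h fine_le ?fin_numD ?fin_num_measure//.
have PU : (P (F x `|` I) <= P (F x) + P I)%E by exact: measureU2.
apply: le_trans PU; apply: le_measure; rewrite ?inE//; first exact: measurableU.
move=> w; rewrite /F /I /= => yw; have [h1|h1] := leP (B 0%N t w) x; [by left|right].
by rewrite ltW.
Qed.

(** The marginal distribution function is Lipschitz, as the density is bounded,
    and Chebyshev gives its limits at infinity. *)
Lemma marginal_median (t : R) : 0 < t -> exists x, marginal_cdf (B 0%N) t x = 2^-1.
Proof.
move=> t0; pose F := marginal_cdf (B 0%N) t.
have tH : 0 < t `^ H by rewrite powR_gt0.
pose a := 2 * t `^ H; have a0 : 0 < a by rewrite mulr_gt0.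
pose E := [set w | a <= `|B 0%N t w|].
have mE : measurable E by apply: measurable_ge_set; exact: measurableT_comp.
have PE : fine (P E) <= 4^-1.
  rewrite -lee_fin fineK ?fin_num_measure//.
  apply: (le_trans (fbm_chebyshev H_gt0 (B_fbm 0) (ltW t0) a0)).
  have z0 : t `^ H ^+ 2 != 0 by rewrite expf_neq0 ?lt0r_neq0.
  rewrite lee_fin (powR_sqr H (ltW t0)) /a exprMn le_eqVlt; apply/orP; left; apply/eqP.
  by move: (t `^ H) z0 => y; rewrite expf_eq0/= => y0; field.
have mF z : measurable [set w | B 0%N t w <= z].
  rewrite (_ : [set w | _] = [set w | `]-oo, z]%classic (B 0%N t w)]).
    by apply: measurable_RV_in; exact: measurable_itv.
  by apply/seteqP; split => w; rewrite /= in_itv.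
have Fa : F (- a) <= 4^-1.
  apply: le_trans PE; rewrite fine_le ?fin_num_measure// le_measure ?inE// => w /= h.
  by rewrite /E/= ler_normr; apply/orP; right; rewrite lerNr.
have Fb : 3 / 4 <= F a.
  have PU : (P ([set w | (B 0%N t w <= a)%R] `|` E) <= P [set w | (B 0%N t w <= a)%R] + P E)%E by exact: measureU2.
  have UE : [set w | B 0%N t w <= a] `|` E = setT.
    apply/seteqP; split => w //= _; have [h|h] := leP (B 0%N t w) a; [by left|right].
    by rewrite /E/= ler_normr (ltW h).
  rewrite UE probability_setT -[P [set w | _]]fineK ?fin_num_measure// in PU.
  rewrite -[P E]fineK ?fin_num_measure// -EFinD lee_fin in PU.
  by rewrite -/(marginal_cdf (B 0%N) t a) -/(F a) in PU; lra.
have FD x y : `|F x - F y| <= 2 * `|x - y| / t `^ H.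
  have [xy|yx] := leP x y.
    have /andP[h1 h2] := marginal_cdf_increment t0 xy.
    by rewrite distrC (distrC x) !ger0_norm ?subr_ge0// -subr_ge0.
  have /andP[h1 h2] := marginal_cdf_increment t0 (ltW yx).
  by rewrite !ger0_norm ?subr_ge0 ?(ltW yx)// -subr_ge0.
have cF : continuous F.
  move=> x; apply/cvgrPdist_le => e e0; near=> y.
  apply: (le_trans (FD x y)); rewrite ler_pdivrMr// -ler_pdivlMl// mulrC.
  near: y; apply: cvgr_dist_le => //.
  by rewrite divr_gt0// mulr_gt0.
have [|||x _ Fx] := @IVT R F (- a) a 2^-1.
- by move: a0; lra.
- exact: continuous_subspaceT.
- by rewrite ge_min le_max; apply/andP; split; apply/orP; [left|right]; lra.
by exists x.
Unshelve. all: by end_near. Qed.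

End median.

Theorem mainTheorem6 (R : realType) (d : measure_display)
    (Omega : measurableType d) (P : probability Omega R)
    (H T kappa : R) (B : nat -> R -> {RV P >-> R})
    (H_gt0 : 0 < H) (H_lt1 : H < 1) (T_gt1 : 1 < T) (kappa_gt0 : 0 < kappa)
    (B_fbm : forall j, is_continuous_fbm H (B j))
    (B_modulus : forall j, has_fbm_modulus H T (B j))
    (B_iid : iid_processes B) :
  {ae P, forall w,
    precompact [set lil_process T kappa_gt0 B w n | n in [set n | (3 <= n)%N]]
    /\ [set ell_fun h | h in limit_set (lil_process T kappa_gt0 B w)] =
       rkhs_unit_ball (fun p q : set_type (time_space T) =>
         weighted_covariance kappa (B 0%N) (\val p) (\val q))}
  /\
  {ae P, forall w,
    limn_esup (fun n => ereal_sup
      [set (`|lil_fun kappa B n w p|)%:E | p in time_space T]) =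
    (T `^ kappa / 2)%:E}.
Proof.
have T_gt0 : 0 < T by exact: lt_trans T_gt1.
have fd := @summand_finite_dimensional _ _ _ _ T _ _ kappa_gt0 B_iid.
have W0 : 0 < T `^ kappa by rewrite powR_gt0.
pose V := T `^ kappa / 2; have V0 : 0 <= V by rewrite divr_ge0 ?powR_ge0.
have KV (q : set_type (time_space T)) : fcov kappa B q q <= V ^+ 2 by exact: fcov_self_le.
have [A0 [C2 [A00 C20 fine]]] := fine_grid H_gt0 H_lt1 T_gt1 kappa_gt0 B_fbm B_iid.
have XE w n (q : set_type (time_space T)) : expR 1 < n%:R :> R ->
    lil_process T kappa_gt0 B w n q = psum (summand kappa B) n q w / lilr n%:R.
  move=> _; rewrite /lil_process /= /lil_fun /empirical_process /psum /summand /lilr.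
  by rewrite -mulr_sumr invfM /wgt /tm; ring.
have rho2_le l q : (0 <= l)%N -> rho2 (fcov kappa B) q (gfloor T_gt1 l q) <=
    rho2_rate H T kappa * grid_ratio H kappa ^+ l.
  by move=> _; exact: rho2_gfloor_le.
have g01 := grid_ratio01 H_gt0 kappa_gt0.
have c00 := @grid_rate_ge0 R T.
have C10 := @rho2_rate_ge0 R H T kappa H_gt0.
split.
  exact: (lil_compactness fd W0 V0 KV c00 C10 C20 g01 A00 (gfloor_grid T_gt1)
    (@grid_card_le R T) rho2_le fine XE).
(* the variance of the weighted indicator is maximal at time [T] and the median *)
have [x0 Fx0] := marginal_median H_gt0 B_fbm T_gt0.
have Tx0 : time_space T (T, x0) by split => //=; rewrite in_itv/= lexx ltW.
pose q0 : set_type (time_space T) := exist (fun x => x \in time_space T) _ (mem_set Tx0).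
have Kq0 : Num.sqrt (fcov kappa B q0 q0) = V.
  have -> : fcov kappa B q0 q0 = V ^+ 2.
    by rewrite fcovE joint_self /cdf /wgt /tm /lv /= Fx0 /V; field.
  by rewrite sqrtr_sqr ger0_norm.
have := lil_sup fd W0 V0 KV c00 C10 C20 g01 A00 (gfloor_grid T_gt1)
    (@grid_card_le R T) rho2_le fine XE.
apply: filterS => w [up lo]; rewrite -/V; apply/eqP; rewrite eq_le; apply/andP; split.
  apply/lee_addgt0Pr => e e0; have [N HN] := up e e0.
  apply: (@le_trans _ _ (ereal_sup [set ereal_sup
      [set (`|lil_fun kappa B n w p|)%:E | p in time_space T] | n in [set n | (N <= n)%N]])).
    by apply: ereal_inf_lbound; exists [set n | (N <= n)%N] => //; exists N.
  apply: ge_ereal_sup => _ [n Nn <-]; apply: ge_ereal_sup => _ [p Tp <-].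
  rewrite -EFinD lee_fin.
  exact: (HN n Nn (exist (fun x => x \in time_space T) p (mem_set Tp))).
apply: le_ereal_inf_tmp => _ [A [N _ NA] <-]; apply/lee_subgt0Pr => e e0.
have [n Nn hn] := lo q0 e e0 N; rewrite Kq0 in hn.
apply: (@le_trans _ _ (ereal_sup [set (`|lil_fun kappa B n w p|)%:E | p in time_space T])); last first.
  by apply: ereal_sup_ubound; exists n => //; exact: NA.
apply: (@le_trans _ _ (`|lil_fun kappa B n w (T, x0)|)%:E); first by rewrite -EFinB lee_fin.
by apply: ereal_sup_ubound; exists (T, x0).
Qed.
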